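(* Let $\alpha\in\mathbb{C}\setminus\mathbb{Q}$. For $n\in\mathbb{N}$ consider the semi-simple decomposition $$V(0,\alpha)^{\otimes n}=\bigoplus_{(x,y)\in\mathbb{N}\times\mathbb{N}} T_n(x,y)\otimes V(x,n\alpha+y),$$ where $T_n(x,y)$ is the multiplicity space of the simple module of highest weight $(x,n\alpha+y)$. Then for every $n\in\mathbb{N}$ and every $(x,y)\in\mathbb{N}\times\mathbb{N}$ the multiplicity space $T_{n+1}(x,y)$ is in one-to-one correspondence (in the sense that it has a basis indexed by, so its dimension is the cardinality of) the set of paths of length $n$ in the first quadrant from $(0,0)$ to $(x,y)$ constructed with the moves $M_1,M_2,M_3,M_4$.
   Context: Let $\hbar$ be an indeterminate, $\Bbbk=\mathbb{C}((\hbar))$, $q=e^{\hbar/2}$, $q^{z}=e^{z\hbar/2}$ for $z\in\mathbb{C}$. Everything is $\mathbb{Z}/2$-graded (super) with the usual sign rule $(f\otimes g)(x\otimes y)=(-1)^{\bar g\bar x}f(x)\otimes g(y)$ and super-commutator $[x,y]=xy-(-1)^{\bar x\bar y}yx$. Let $(a_{ij})=\begin{pmatrix}2&-1\\-1&0\end{pmatrix}$. $U_q(sl(2|1))$ is the Hopf superalgebra over $\Bbbk$ generated by $E_i,F_i,h_i$ ($i=1,2$), with $E_2,F_2$ odd and the other generators even, with relations $[h_i,h_j]=0$, $[h_i,E_j]=a_{ij}E_j$, $[h_i,F_j]=-a_{ij}F_j$, $[E_i,F_j]=\delta_{ij}\frac{q^{h_i}-q^{-h_i}}{q-q^{-1}}$,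 $E_2^2=F_2^2=0$, $E_1^2E_2-(q+q^{-1})E_1E_2E_1+E_2E_1^2=0$, $F_1^2F_2-(q+q^{-1})F_1F_2F_1+F_2F_1^2=0$, and coproduct $\Delta(E_i)=E_i\otimes1+q^{-h_i}\otimes E_i$, $\Delta(F_i)=F_i\otimes q^{h_i}+1\otimes F_i$, $\Delta(h_i)=h_i\otimes1+1\otimes h_i$. Tensor powers of modules are modules via $\Delta$. A vector $v$ has weight $(\alpha_1,\alpha_2)$ if $h_iv=\alpha_iv$ for $i=1,2$ (and then $q^{h_i}v=q^{\alpha_i}v$); it is a highest weight vector if moreover $E_1v=E_2v=0$. For $(\alpha_1,\alpha_2)\in\mathbb{N}\times\mathbb{C}$, $V(\alpha_1,\alpha_2)$ denotes the finite-dimensional simple module generated by a highest weight vector of weight $(\alpha_1,\alpha_2)$ (unique up to isomorphism and parity shift; modules are considered up to parity shift in decompositions). Here $\mathbb{N}=\{0,1,2,\dots\}$. For $\alpha\notin\mathbb{Q}$ the tensor powers of $V(0,\alpha)$ are semi-simple, with the shape of decomposition displayed in the claim. Moves on integer points of the plane: $M_1:(x',y')\to(x',y')$ (stay move); $M_2:(x',y')\to(x'+1,y')$; $M_3:(x',y')\to(x',y'+1)$; $M_4:(x',y')\to(x'-1,y'+1)$, allowed only if $x'>0$. A path of length $n$ is a sequence of $n$ such moves (stay moves count towards the length), starting at $(0,0)$. *)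

(* Defs.v *)
(* The complex numbers are R[i] for R : realType. *)
From HB Require Import structures.
From mathcomp Require Import all_boot all_order all_algebra.
From mathcomp Require Import boolp reals.
From mathcomp Require Import complex mxtens.

Set Implicit Arguments.
Unset Strict Implicit.
Unset Printing Implicit Defensive.

Import Order.TTheory GRing.Theory Num.Theory.
Local Open Scope ring_scope.

Record fps (K : fieldType) := Fps { fcoef : nat -> K }.

HB.instance Definition _ (K : fieldType) := gen_eqMixin (fps K).
HB.instance Definition _ (K : fieldType) := gen_choiceMixin (fps K).

Lemma fpsP (K : fieldType) (f g : fps K) :
  (forall n, fcoef f n = fcoef g n) -> f = g.
Proof. by case: f => f; case: g => g /= e; congr Fps; apply/funext. Qed.

Definition fps_zero (K : fieldType) : fps K := Fps (fun _ => 0).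
Definition fps_add (K : fieldType) (f g : fps K) : fps K :=
  Fps (fun n => fcoef f n + fcoef g n).
Definition fps_opp (K : fieldType) (f : fps K) : fps K :=
  Fps (fun n => - fcoef f n).

Lemma fps_addA (K : fieldType) : associative (@fps_add K).
Proof. by move=> f g h; apply: fpsP => n; rewrite /= addrA. Qed.
Lemma fps_addC (K : fieldType) : commutative (@fps_add K).
Proof. by move=> f g; apply: fpsP => n; rewrite /= addrC. Qed.
Lemma fps_add0 (K : fieldType) : left_id (fps_zero K) (@fps_add K).
Proof. by move=> f; apply: fpsP => n; rewrite /= add0r. Qed.
Lemma fps_addN (K : fieldType) :
  left_inverse (fps_zero K) (@fps_opp K) (@fps_add K).
Proof. by move=> f; apply: fpsP => n; rewrite /= addNr. Qed.

HB.instance Definition _ (K : fieldType) :=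
  GRing.isZmodule.Build (fps K) (@fps_addA K) (@fps_addC K)
    (@fps_add0 K) (@fps_addN K).

Definition fps_const (K : fieldType) (c : K) : fps K :=
  Fps (fun n => if n == 0%N then c else 0).
Definition fps_one (K : fieldType) : fps K := fps_const 1.
Definition fps_mul (K : fieldType) (f g : fps K) : fps K :=
  Fps (fun n => \sum_(i < n.+1) fcoef f i * fcoef g (n - i)).

Definition fps_trunc (K : fieldType) (m : nat) (f : fps K) : {poly K} :=
  \poly_(i < m.+1) fcoef f i.

Lemma coef_fps_trunc (K : fieldType) m (f : fps K) n :
  (n <= m)%N -> (fps_trunc m f)`_n = fcoef f n.
Proof. by move=> le_nm; rewrite coef_poly ltnS le_nm. Qed.

Lemma fcoef_mul (K : fieldType) m (f g : fps K) n : (n <= m)%N ->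
  fcoef (fps_mul f g) n = (fps_trunc m f * fps_trunc m g)`_n.
Proof.
move=> le_nm; rewrite coefM; apply: eq_bigr => i _.
rewrite !coef_fps_trunc //; first exact: leq_trans (leq_subr _ _) le_nm.
by apply: leq_trans le_nm; rewrite -ltnS.
Qed.

Lemma fps_mulC (K : fieldType) : commutative (@fps_mul K).
Proof.
by move=> f g; apply: fpsP => n; rewrite !(fcoef_mul _ _ (leqnn n)) mulrC.
Qed.

Lemma fps_mulA (K : fieldType) : associative (@fps_mul K).
Proof.
move=> f g h; apply: fpsP => n; rewrite !(fcoef_mul _ _ (leqnn n)).
transitivity ((fps_trunc n f * (fps_trunc n g * fps_trunc n h))`_n).
  rewrite !coefM; apply: eq_bigr => i _; congr (_ * _).
  by rewrite coef_fps_trunc ?leq_subr // (fcoef_mul _ _ (leq_subr i n)).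
rewrite mulrA !coefM; apply: eq_bigr => i _; congr (_ * _).
have le_in : (i <= n)%N by rewrite -ltnS.
by rewrite coef_fps_trunc // (fcoef_mul _ _ le_in).
Qed.

Lemma fps_mul1 (K : fieldType) : left_id (fps_one K) (@fps_mul K).
Proof.
move=> f; apply: fpsP => n; rewrite /= big_ord_recl /= mul1r subn0.
by rewrite big1 ?addr0 // => i _; rewrite mul0r.
Qed.

Lemma fps_mulDl (K : fieldType) : left_distributive (@fps_mul K) (@fps_add K).
Proof.
move=> f g h; apply: fpsP => n; rewrite /= -big_split /=.
by apply: eq_bigr => i _; rewrite mulrDl.
Qed.

Lemma fps_one_neq0 (K : fieldType) : fps_one K != fps_zero K.
Proof.
apply/eqP => /(congr1 (fun f => fcoef f 0)) /= /eqP.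
by rewrite oner_eq0.
Qed.

HB.instance Definition _ (K : fieldType) :=
  GRing.Zmodule_isComNzRing.Build (fps K) (@fps_mulA K) (@fps_mulC K)
    (@fps_mul1 K) (@fps_mulDl K) (@fps_one_neq0 K).

Definition fps_unit (K : fieldType) : pred (fps K) :=
  fun f => `[< exists g : fps K, g * f = 1 >].
Definition fps_inv (K : fieldType) (f : fps K) : fps K :=
  if pselect (exists g : fps K, g * f = 1) is left e
  then projT1 (cid e) else f.

Lemma fps_mulVr (K : fieldType) :
  {in @fps_unit K, left_inverse 1 (@fps_inv K) *%R}.
Proof.
move=> f /asboolP fU; rewrite /fps_inv; case: pselect => // e.
by case: (cid e).
Qed.
Lemma fps_unitP (K : fieldType) (f g : fps K) : g * f = 1 -> fps_unit f.
Proof. by move=> gf; apply/asboolP; exists g. Qed.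
Lemma fps_inv_out (K : fieldType) :
  {in [predC @fps_unit K], @fps_inv K =1 id}.
Proof.
move=> f /= fNU; rewrite /fps_inv; case: pselect => // e.
by case/negP: fNU; apply/asboolP.
Qed.

HB.instance Definition _ (K : fieldType) :=
  GRing.ComNzRing_hasMulInverse.Build (fps K) (@fps_mulVr K) (@fps_unitP K)
    (@fps_inv_out K).

Lemma fps_neq0_order (K : fieldType) (f : fps K) : f != 0 ->
  exists2 n, fcoef f n != 0 & forall m, (m < n)%N -> fcoef f m = 0.
Proof.
move=> f0; have ex : exists n, fcoef f n != 0.
  apply: contrapT => nex; case/eqP: f0; apply: fpsP => n /=.
  by apply/eqP/negPn/negP => fn; apply: nex; exists n.
exists (ex_minn ex); case: ex_minnP => // n _ minn m lt_mn.
by apply/eqP/negPn/negP => /minn; rewrite leqNgt lt_mn.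
Qed.

Lemma fps_idomain (K : fieldType) : GRing.integral_domain_axiom (fps K).
Proof.
move=> f g fg0; apply/norP => -[/fps_neq0_order [a fa af]].
move=> /fps_neq0_order [b gb bg].
have := congr1 (fun h => fcoef h (a + b)) fg0; rewrite /=.
have lt_a : (a < (a + b).+1)%N by rewrite ltnS leq_addr.
rewrite (bigD1 (Ordinal lt_a)) //= addKn big1 ?addr0.
  by move/eqP; rewrite mulf_eq0 (negPf fa) (negPf gb).
move=> i ia; case: (ltngtP i a) => [/af ->|lt_ai|eia]; first by rewrite mul0r.
  rewrite bg ?mulr0 // ltn_subLR; last by rewrite -ltnS.
  by rewrite ltn_add2r.
by case/eqP: ia; apply: val_inj.
Qed.

HB.instance Definition _ (K : fieldType) :=
  GRing.ComUnitRing_isIntegral.Build (fps K) (@fps_idomain K).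

(* C((hbar)) is the field of fractions of C[[hbar]]. *)
Definition laurent (R : realType) : fieldType := {fraction (fps R[i])}.

Definition cst (R : realType) (z : R[i]) : laurent R :=
  FracField.tofrac (fps_const z).

(* q^z = exp (z hbar / 2) *)
Definition qpow (R : realType) (z : R[i]) : laurent R :=
  FracField.tofrac (Fps (fun m => (z / 2%:R) ^+ m / (m`!)%:R)).

(* A finite-dimensional super vector space over [laurent R], presented by a
   homogeneous basis: its vectors are the columns 'cV_(sdim S) and operators
   act by left multiplication. *)
Record superspace := SuperSpace { sdim : nat; spar : 'I_sdim -> bool }.

(* the matrix of v |-> (-1)^(p |v|) v *)
Definition parity_mx (R : realType) (S : superspace) (p : bool) :
    'M[laurent R]_(sdim S) :=
  diag_mx (\row_i (-1) ^+ (p && spar i)).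

Definition homogeneous (R : realType) (S S' : superspace) (p : bool)
    (A : 'M[laurent R]_(sdim S', sdim S)) : Prop :=
  forall i j, A i j != 0 -> spar i = spar j (+) p.

Definition stens (S S' : superspace) : superspace :=
  @SuperSpace (sdim S * sdim S')
    (fun k => spar (mxtens_unindex k).1 (+) spar (mxtens_unindex k).2).

Definition ssum (S S' : superspace) : superspace :=
  @SuperSpace (sdim S + sdim S')
    (fun k => match split k with inl i => spar i | inr j => spar j end).

(* f (x) g for g of parity p, with the sign rule
   (f (x) g)(x (x) y) = (-1)^(p |x|) f x (x) g y *)
Definition optens (R : realType) (S S' : superspace)
    (f : 'M[laurent R]_(sdim S)) (p : bool) (g : 'M[laurent R]_(sdim S')) :
    'M[laurent R]_(sdim (stens S S')) :=
  (f *m parity_mx R S p) *t g.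

(* Operators for the generators E_i, F_i, h_i and for q^(h_i).  The index i in
   {1, 2} is encoded as an element of 'I_2 = {0, 1}. *)
Record uqdata (R : realType) := UqData {
  uspace :> superspace;
  uE : 'I_2 -> 'M[laurent R]_(sdim uspace);
  uF : 'I_2 -> 'M[laurent R]_(sdim uspace);
  uh : 'I_2 -> 'M[laurent R]_(sdim uspace);
  uK : 'I_2 -> 'M[laurent R]_(sdim uspace) }.

Definition cartan (i j : 'I_2) : int :=
  if (i == ord0) && (j == ord0) then 2
  else if (i == ord_max) && (j == ord_max) then 0 else -1.

(* parity of E_i and F_i *)
Definition gpar (i : 'I_2) : bool := i == ord_max.

(* K = q^h: there is a basis of eigenvectors of h with complex eigenvalues,
   on which K acts by q to the power of the eigenvalue. *)
Definition is_qpow_mx (R : realType) (d : nat) (h K : 'M[laurent R]_d) : Prop :=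
  exists (P : 'M[laurent R]_d) (a : 'I_d -> R[i]),
    [/\ P \in unitmx,
        h *m P = P *m diag_mx (\row_j cst (a j))
      & K *m P = P *m diag_mx (\row_j qpow (a j))].

Definition serre (R : realType) (d : nat) (X Y : 'M[laurent R]_d) : Prop :=
  X *m X *m Y - (qpow 1 + (qpow 1)^-1) *: (X *m Y *m X) + Y *m X *m X = 0.

Definition is_uqmodule (R : realType) (V : uqdata R) : Prop :=
  let: UqData U E F h K := V in
  [/\ (forall i, [/\ homogeneous (S := U) (S' := U) (gpar i) (E i),
                     homogeneous (S := U) (S' := U) (gpar i) (F i),
                     homogeneous (S := U) (S' := U) false (h i)
                   & is_qpow_mx (h i) (K i)]),
      (forall i j, [/\ h i *m h j - h j *m h i = 0,
                       h i *m E j - E j *m h i = (cartan i j)%:~R *: E j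
                     & h i *m F j - F j *m h i = - (cartan i j)%:~R *: F j]),
      (forall i j, E i *m F j - (-1) ^+ (gpar i && gpar j) *: (F j *m E i)
         = (i == j)%:R *: ((qpow 1 - (qpow 1)^-1)^-1 *: (K i - invmx (K i)))),
      E ord_max *m E ord_max = 0 /\ F ord_max *m F ord_max = 0
    & serre (E ord0) (E ord_max) /\ serre (F ord0) (F ord_max)].

(* Super (i.e. Z/2-graded) submodules. *)
Definition is_submodule (R : realType) (V : uqdata R)
    (U : {vspace 'cV[laurent R]_(sdim V)}) : Prop :=
  forall v, v \in U ->
    parity_mx R V true *m v \in U /\
    forall i, [/\ uE V i *m v \in U, uF V i *m v \in U & uh V i *m v \in U].

Definition is_simple (R : realType) (V : uqdata R) : Prop :=
  (0 < sdim V)%N /\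
  forall U : {vspace 'cV[laurent R]_(sdim V)},
    is_submodule (V := V) U -> U = 0%VS \/ U = fullv.

Definition is_hwvector (R : realType) (V : uqdata R) (a1 a2 : R[i])
    (v : 'cV[laurent R]_(sdim V)) : Prop :=
  [/\ v != 0,
      uh V ord0 *m v = cst a1 *: v,
      uh V ord_max *m v = cst a2 *: v
    & forall i, uE V i *m v = 0].

Definition generates (R : realType) (V : uqdata R)
    (v : 'cV[laurent R]_(sdim V)) : Prop :=
  forall U : {vspace 'cV[laurent R]_(sdim V)},
    is_submodule (V := V) U -> v \in U -> U = fullv.

(* W is a copy of V(a1, a2). *)
Definition is_simple_hw (R : realType) (a1 : nat) (a2 : R[i]) (W : uqdata R) :
    Prop :=
  [/\ is_uqmodule W, is_simple W
    & exists2 v, is_hwvector (V := W) a1%:R a2 v & generates (V := W) v].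

(* Delta(E_i) = E_i (x) 1 + q^(-h_i) (x) E_i, Delta(F_i) = F_i (x) q^(h_i)
   + 1 (x) F_i, Delta(h_i) = h_i (x) 1 + 1 (x) h_i. *)
Definition utens (R : realType) (V W : uqdata R) : uqdata R :=
  @UqData R (stens V W)
    (fun i => optens (S := V) (S' := W) (uE V i) false 1%:M
              + optens (S := V) (S' := W) (invmx (uK V i)) (gpar i) (uE W i))
    (fun i => optens (S := V) (S' := W) (uF V i) false (uK W i)
              + optens (S := V) (S' := W) 1%:M (gpar i) (uF W i))
    (fun i => optens (S := V) (S' := W) (uh V i) false 1%:M
              + optens (S := V) (S' := W) 1%:M false (uh W i))
    (fun i => optens (S := V) (S' := W) (uK V i) false (uK W i)).

Definition usum (R : realType) (V W : uqdata R) : uqdata R :=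
  @UqData R (ssum V W)
    (fun i => block_mx (uE V i) 0 0 (uE W i))
    (fun i => block_mx (uF V i) 0 0 (uF W i))
    (fun i => block_mx (uh V i) 0 0 (uh W i))
    (fun i => block_mx (uK V i) 0 0 (uK W i)).

(* A super vector space with the trivial action (through the counit), so that
   [utens (triv R T) W] is T (x) W with the algebra acting on W only. *)
Definition triv (R : realType) (T : superspace) : uqdata R :=
  @UqData R T (fun=> 0) (fun=> 0) (fun=> 0) (fun=> 1%:M).

Definition uunit (R : realType) : uqdata R :=
  triv R (@SuperSpace 1 (fun=> false)).
Definition uzero (R : realType) : uqdata R :=
  triv R (@SuperSpace 0 (fun=> false)).

Fixpoint utpow (R : realType) (V : uqdata R) (n : nat) : uqdata R :=
  if n is n'.+1 then utens (utpow V n') V else uunit R.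

Definition ubigsum (R : realType) (s : seq (uqdata R)) : uqdata R :=
  foldr (@usum R) (uzero R) s.

(* Isomorphisms are even.  Commutation with q^(h_i) follows from commutation
   with h_i when q^(h_i) is determined by h_i as in [is_qpow_mx]. *)
Definition uiso (R : realType) (V W : uqdata R) : Prop :=
  exists (P : 'M[laurent R]_(sdim W, sdim V))
         (Q : 'M[laurent R]_(sdim V, sdim W)),
    [/\ P *m Q = 1%:M, Q *m P = 1%:M,
        homogeneous (S := V) (S' := W) false P
      & forall i, [/\ P *m uE V i = uE W i *m P, P *m uF V i = uF W i *m P
                    & P *m uh V i = uh W i *m P]].

(* V(0,alpha)^(x) n is the direct sum over (x, y) of
   T(x, y) (x) V(x, n alpha + y); all but finitely many T(x, y) vanish.
   Parity shifts are absorbed by the grading of the super vector spaces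
   T(x, y). *)
Definition is_decomposition (R : realType) (V : nat -> R[i] -> uqdata R)
    (alpha : R[i]) (n : nat) (T : nat -> nat -> superspace) : Prop :=
  exists N : nat,
    (forall x y, ~~ ((x < N) && (y < N))%N -> sdim (T x y) = 0%N) /\
    uiso (utpow (V 0%N alpha) n)
      (ubigsum [seq utens (triv R (T x y)) (V x (alpha *+ n + y%:R))
                 | x <- iota 0 N, y <- iota 0 N]).

(* The moves M_1, M_2, M_3, M_4 are encoded as 0, 1, 2, 3 : 'I_4; [None] means
   that the move is not allowed.  No move leaves the first quadrant. *)
Definition apply_move (m : 'I_4) (p : nat * nat) : option (nat * nat) :=
  match nat_of_ord m with
  | 0 => Some p
  | 1 => Some (p.1.+1, p.2)
  | 2 => Some (p.1, p.2.+1)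
  | _ => if (0 < p.1)%N then Some (p.1.-1, p.2.+1) else None
  end.

Fixpoint run (s : seq 'I_4) (p : nat * nat) : option (nat * nat) :=
  if s is m :: s' then obind (run s') (apply_move m p) else Some p.

Definition paths (n x y : nat) : {set n.-tuple 'I_4} :=
  [set s : n.-tuple 'I_4 | run s (0%N, 0%N) == Some (x, y)].

(* Main.v *)
Require Import Defs.
From mathcomp Require Import all_boot all_order all_algebra.
From mathcomp Require Import boolp reals.
From mathcomp Require Import complex mxtens.
From mathcomp Require Import ring zify.

Set Implicit Arguments.
Unset Strict Implicit.
Unset Printing Implicit Defensive.

Import Order.TTheory GRing.Theory Num.Theory.
Local Open Scope ring_scope.

(* A highest weight vector v of weight (x, b) of a finite-dimensional module satisfies
   F_1^(x+1) v = 0, so it generates a module spanned by the 4(x+1) vectors X F_1^i v, where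
   X = 1, F_2, F_1 F_2, F_2 F_1 F_2 and i <= x.  They are independent when [b] and [x+b+1] are nonzero,
   because then F_2 F_1 F_2 F_1^x v is nonzero; all weights (x, n alpha + y) with n > 0 are such.  For
   these weights V(x, b) has dimension 4(x+1) and every highest weight vector of weight (x, b)
   receives a homomorphism from V(x, b).
   A highest weight vector of M (x) V(0, alpha) amounts to a vector of M killed by E_1, its component
   along the highest weight vector of V(0, alpha).  Tensoring with V(0, alpha) produces from a weight
   vector killed by E_1 one vector killed by E_1 for each allowed move, so that V(0, alpha)^(x) n
   contains independent ones indexed by the paths of length n.  The resulting map from the sum of the
   T(x, y) (x) V(x, (n+1) alpha + y) to V(0, alpha)^(x) (n+1) is injective, since its kernel would
   contain a highest weight vector, and bijective, since both sides have dimension 4^(n+1): the sum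
   over the paths of x + 1, for (x, y) the end point, is multiplied by 4 by each step.  Multiplicities
   are unique as dimensions of spaces of highest weight vectors. *)

(** The moves are the Clebsch-Gordan rule for U_q(sl(2)). Under E_1 and F_1, V(0, alpha) splits into
    a trivial module on v, a two-dimensional one on F_2 v and F_1 F_2 v, and a trivial one on F_2
    F_1 F_2 v. Tensoring a vector killed by E_1 of h_1-weight x with the trivial ones keeps x (M_1,
    M_3); tensoring with the two-dimensional one gives x + 1 (M_2) and x - 1 (M_4, absent when x =
    0). The vectors F_1 F_2 v and F_2 F_1 F_2 v have h_2-weight alpha + 1, whence the growth of y
    under M_3 and M_4. The last tensor factor makes no move: it is spent on completing vectors
    killed by E_1 to highest weight vectors. This is why n + 1 factors correspond to paths of length
    n. Complete reducibility is never invoked; the dimension count replaces it. The parity of the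
    vector attached to a path depends only on the end point and the length, so each T(x, y) can be
    taken of a single parity. The tensor power 0 has weight (0, 0), where F_2 F_1 F_2 v may vanish,
    and is decomposed separately. *)

Local Notation i1 := (ord0 : 'I_2).
Local Notation i2 := (ord_max : 'I_2).

(** * Scalars *)

(* The properties of [cst] and [qpow] that the representation theory uses, over an arbitrary field
   [F]: inside the field of fractions [laurent R] every comparison of terms unfolds the fractions. *)
Record qexp (C : numFieldType) (F : fieldType) (cst qp : C -> F) : Prop := Qexp {
  qcstD : forall a b, cst (a + b) = cst a + cst b;
  qcst1 : cst 1 = 1;
  qcst_inj : injective cst;
  qpD : forall a b, qp (a + b) = qp a * qp b;
  qp0 : qp 0 = 1;
  qp_eq1 : forall a, qp a = 1 -> a = 0 }.

Section Scalars.
Variables (C : numFieldType) (F : fieldType) (cst qp : C -> F).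
Hypothesis ax : qexp cst qp.
Implicit Types a b z : C.

Lemma gcst0 : cst 0 = 0.
Proof. by apply: (@addrI _ (cst 0)); rewrite -(qcstD ax) !addr0. Qed.

Lemma gcstN a : cst (- a) = - cst a.
Proof. by apply: (@addrI _ (cst a)); rewrite -(qcstD ax) !subrr gcst0. Qed.

Lemma gcst_nat n : cst n%:R = n%:R.
Proof.
elim: n => [|n IHn]; first exact: gcst0.
by rewrite -addn1 !natrD (qcstD ax) IHn (qcst1 ax).
Qed.

Lemma gcst_int (z : int) : cst z%:~R = z%:~R.
Proof. by case: z => n; rewrite ?NegzE ?mulrNz ?gcstN; rewrite gcst_nat. Qed.

Lemma gnatr_eq0 n : (n%:R == 0 :> F) = (n == 0)%N.
Proof.
apply/eqP/eqP => [|->] // /(etrans (gcst_nat n)); rewrite -gcst0.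
by move/(qcst_inj ax)/eqP; rewrite pnatr_eq0 => /eqP.
Qed.

Lemma qp_neq0 a : qp a != 0.
Proof.
apply/eqP => qa0; have := qp0 ax; rewrite -(subrr a) (qpD ax) qa0 mul0r.
by move/esym/eqP; rewrite oner_eq0.
Qed.

Lemma qpN a : qp (- a) = (qp a)^-1.
Proof.
by apply: (mulfI (qp_neq0 a)); rewrite -(qpD ax) subrr (qp0 ax) mulfV ?qp_neq0.
Qed.

Lemma qp_inj : injective qp.
Proof.
move=> a b qab; apply/eqP; rewrite -subr_eq0; apply/eqP/(qp_eq1 ax).
by rewrite (qpD ax) qpN qab mulfV ?qp_neq0.
Qed.

Lemma qp_subN_eq0 a : (qp a - qp (- a) == 0) = (a == 0).
Proof.
rewrite subr_eq0; apply/eqP/eqP => [/qp_inj/eqP|->]; last by rewrite oppr0.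
by rewrite -addr_eq0 -mulr2n mulrn_eq0 /= => /eqP.
Qed.

Lemma gq_neq0 : qp 1 - (qp 1)^-1 != 0.
Proof. by rewrite -qpN qp_subN_eq0 oner_eq0. Qed.

(** The quantum integer [z] for complex z, by which [E_i, F_i] acts on vectors of h_i-weight z. *)
Definition qint z := (qp 1 - (qp 1)^-1)^-1 * (qp z - qp (- z)).

Lemma qint_eq0 z : (qint z == 0) = (z == 0).
Proof. by rewrite mulf_eq0 invr_eq0 (negPf gq_neq0) qp_subN_eq0. Qed.

Lemma qint0 : qint 0 = 0. Proof. by apply/eqP; rewrite qint_eq0. Qed.

Lemma qint1 : qint 1 = 1.
Proof. by rewrite /qint qpN mulVf ?gq_neq0. Qed.

Lemma qint2 : qint 2 = qp 1 + (qp 1)^-1.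
Proof.
rewrite /qint qpN -[2%:R]/(1 + 1) (qpD ax) invfM; apply: (mulfI gq_neq0).
by rewrite mulrA mulfV ?gq_neq0 // mul1r; ring.
Qed.

(** With x and y the weights of h_1 and h_2, this collapses E_1 E_2 F_2 F_1 F_2 v to one quantum
    integer times F_2 v; the condition on [x + b + 1] originates here. *)
Lemma qintD1 x y : qint (x + 1) * qint (y + 1) - qint x * qint y = qint (x + y + 1).
Proof.
rewrite /qint !qpN !(qpD ax).
have := gq_neq0; have := qp_neq0 1; have := qp_neq0 x; have := qp_neq0 y.
move: (qp 1) (qp x) (qp y) => u v w w0 v0 u0 uu.
(* After clearing denominators, [field] asks for u - u^-1 to be nonzero in this form. *)
have uu2 : u ^+ 2 - 1 != 0.
  apply: contra uu => /eqP e; apply/eqP.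
  by apply: (mulfI u0); rewrite mulr0 mulrBr mulfV // -e.
by field; rewrite w0 v0 u0 /= uu2.
Qed.

(** The recursion in y = i for the coefficient [i] [a - i + 1] in E_1 F_1^i v, with x = a: each new
    F_1 contributes the commutator [a - 2 i]. *)
Lemma qint_step x y :
  qint (y + 1) * qint (x - y) = qint y * qint (x - y + 1) + qint (x - y - y).
Proof.
rewrite /qint !qpN !(qpD ax) !qpN.
have := gq_neq0; have := qp_neq0 1; have := qp_neq0 x; have := qp_neq0 y.
move: (qp 1) (qp x) (qp y) => u v w w0 v0 u0 uu.
have uu2 : u ^+ 2 - 1 != 0.
  apply: contra uu => /eqP e; apply/eqP.
  by apply: (mulfI u0); rewrite mulr0 mulrBr mulfV // -e.
by field; rewrite w0 v0 u0 /= uu2.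
Qed.

End Scalars.

(** * Modules over an abstract field *)

(* [uqdata], [is_uqmodule] and the operations on modules, with [F] in place of [laurent R]. *)
Record gmod (F : fieldType) := GMod {
  gsp :> superspace;
  gE : 'I_2 -> 'M[F]_(sdim gsp);
  gF : 'I_2 -> 'M[F]_(sdim gsp);
  gh : 'I_2 -> 'M[F]_(sdim gsp);
  gK : 'I_2 -> 'M[F]_(sdim gsp) }.

Definition gpar_mx (F : fieldType) (S : superspace) (p : bool) : 'M[F]_(sdim S) :=
  diag_mx (\row_i (-1) ^+ (p && spar i)).

Definition gis_qp (C : numFieldType) (F : fieldType) (cst qp : C -> F) d (h K : 'M[F]_d) : Prop :=
  exists (P : 'M[F]_d) (a : 'I_d -> C),
    [/\ P \in unitmx, h *m P = P *m diag_mx (\row_j cst (a j))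
      & K *m P = P *m diag_mx (\row_j qp (a j))].

(** In an eigenbasis of h, the entry (i, j) of X can be nonzero only if the exponents satisfy a_i =
    a_j + c. Injectivity of [cst] brings this from F back to the exponents, where [qp] turns the sum
    into a product. *)
Lemma gis_qp_comm (C : numFieldType) (F : fieldType) (cst qp : C -> F) d (h K X : 'M[F]_d) c :
  qexp cst qp -> gis_qp cst qp h K ->
  h *m X = X *m h + cst c *: X -> K *m X = qp c *: (X *m K).
Proof.
move=> ax [P [a [Pu hP KP]]] hX.
pose Y := invmx P *m X *m P.
have XP : X *m P = P *m Y by rewrite /Y !mulmxA mulmxV // mul1mx.
clearbody Y.
have hY : diag_mx (\row_j cst (a j)) *m Y = Y *m diag_mx (\row_j cst (a j)) + cst c *: Y.
  have: h *m X *m P = (X *m h + cst c *: X) *m P by rewrite hX.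
  rewrite mulmxDl -!mulmxA hP XP !mulmxA hP XP -scalemxAl XP -!mulmxA.
  rewrite scalemxAr -mulmxDr => /(congr1 (mulmx (invmx P))).
  by rewrite !mulmxA mulVmx // !mul1mx.
have KY : diag_mx (\row_j qp (a j)) *m Y = qp c *: (Y *m diag_mx (\row_j qp (a j))).
  apply/matrixP => i j; rewrite mul_diag_mx mxE [RHS]mxE mul_mx_diag !mxE.
  move/matrixP/(_ i j): hY; rewrite mul_diag_mx 3!mxE mul_mx_diag !mxE.
  have [->|Yij] := eqVneq (Y i j) 0; first by rewrite !(mulr0, mul0r).
  rewrite [_ * cst _]mulrC -mulrDl -(qcstD ax) => /(mulIf Yij) /(qcst_inj ax) ->.
  by rewrite (qpD ax); ring.
have : K *m X *m P = qp c *: (X *m K) *m P.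
  rewrite -scalemxAl -[K *m _ *m _]mulmxA XP mulmxA KP -[LHS]mulmxA KY -scalemxAr.
  by rewrite -[X *m _ *m _]mulmxA KP !mulmxA XP.
move/(congr1 (mulmx^~ (invmx P))); rewrite -!mulmxA mulmxV // !mulmx1 //.
Qed.

Lemma gis_qp_unit (C : numFieldType) (F : fieldType) (cst qp : C -> F) d (h K : 'M[F]_d) :
  qexp cst qp -> gis_qp cst qp h K -> K \in unitmx.
Proof.
move=> ax [P [a [Pu hP KP]]].
have := congr1 (mulmx^~ (invmx P)) KP; rewrite -mulmxA mulmxV // mulmx1 => ->.
rewrite !unitmx_mul Pu unitmx_inv Pu andbT /= unitmxE det_diag unitfE.
by apply/prodf_neq0 => i _; rewrite mxE (qp_neq0 ax).
Qed.

Lemma gis_qp_eigen (C : numFieldType) (F : fieldType) (cst qp : C -> F) d m (h K : 'M[F]_d)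
    (X : 'M_(d, m)) c :
  qexp cst qp -> gis_qp cst qp h K -> h *m X = cst c *: X -> K *m X = qp c *: X.
Proof.
move=> ax [P [a [Pu hP KP]]] hX.
pose Y := invmx P *m X.
have XP : X = P *m Y by rewrite /Y !mulmxA mulmxV // mul1mx.
clearbody Y.
have hY : diag_mx (\row_j cst (a j)) *m Y = cst c *: Y.
  move: hX; rewrite {1 2}XP mulmxA hP -mulmxA => /(congr1 (mulmx (invmx P))).
  by rewrite -scalemxAr !mulmxA mulVmx // !mul1mx.
rewrite XP mulmxA KP -mulmxA scalemxAr; congr (_ *m _).
apply/matrixP => i j; move/matrixP/(_ i j): hY.
rewrite !mul_diag_mx !mxE.
have [->|Yij] := eqVneq (Y i j) 0; first by rewrite !(mulr0, mul0r).
by move/(mulIf Yij)/(qcst_inj ax) ->.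
Qed.

Section Modules.
Variables (C : numFieldType) (F : fieldType) (cst qp : C -> F).
Hypothesis ax : qexp cst qp.
Implicit Type M : gmod F.
Local Notation q := (qp 1).
Local Notation qint := (qint qp).
Local Notation P M := (gpar_mx F M true).

(** Homogeneity is expressed as commutation up to sign with the parity operator, so that every axiom
    is a matrix identity; [homogeneousP] gives the equivalence. *)
Record is_gmod M : Prop := IsGmod {
  gm_parE : forall i, P M *m gE M i = (-1) ^+ gpar i *: (gE M i *m P M);
  gm_parF : forall i, P M *m gF M i = (-1) ^+ gpar i *: (gF M i *m P M);
  gm_parh : forall i, P M *m gh M i = gh M i *m P M;
  gm_qp : forall i, gis_qp cst qp (gh M i) (gK M i);
  gm_hh : forall i j, gh M i *m gh M j = gh M j *m gh M i;
  gm_hE : forall i j, gh M i *m gE M j = gE M j *m gh M i + (cartan i j)%:~R *: gE M j;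
  gm_hF : forall i j, gh M i *m gF M j = gF M j *m gh M i - (cartan i j)%:~R *: gF M j;
  gm_EF : forall i j, gE M i *m gF M j = (-1) ^+ (gpar i && gpar j) *: (gF M j *m gE M i)
      + (i == j)%:R *: ((q - q^-1)^-1 *: (gK M i - invmx (gK M i)));
  gm_EE : gE M i2 *m gE M i2 = 0;
  gm_FF : gF M i2 *m gF M i2 = 0;
  gm_serreE : gE M i1 *m gE M i1 *m gE M i2 - (q + q^-1) *: (gE M i1 *m gE M i2 *m gE M i1)
     + gE M i2 *m gE M i1 *m gE M i1 = 0;
  gm_serreF : gF M i1 *m gF M i1 *m gF M i2 - (q + q^-1) *: (gF M i1 *m gF M i2 *m gF M i1)
     + gF M i2 *m gF M i1 *m gF M i1 = 0 }.

Lemma gpar_mxF (S : superspace) : gpar_mx F S false = 1%:M.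
Proof. by rewrite -diag_const_mx; congr diag_mx; apply/rowP => i; rewrite !mxE. Qed.

Lemma gpar_mxK (S : superspace) p : gpar_mx F S p *m gpar_mx F S p = 1%:M.
Proof.
rewrite mulmx_diag -diag_const_mx; congr diag_mx; apply/rowP => i; rewrite !mxE.
by rewrite -expr2 sqrr_sign.
Qed.

Section One.
Variable M : gmod F.
Hypothesis hM : is_gmod M.
Variable m : nat.
Implicit Type X : 'M[F]_(sdim M, m).

(** The relations are restated on an arbitrary matrix X, with products nested to the right, so that
    they serve as rewriting rules on words in the generators. *)
Lemma gKE i j X : gK M i *m (gE M j *m X) = qp (cartan i j)%:~R *: (gE M j *m (gK M i *m X)).
Proof.
rewrite !mulmxA (gis_qp_comm ax (gm_qp hM i) (c := (cartan i j)%:~R)) ?scalemxAl //.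
by rewrite (gcst_int ax) (gm_hE hM).
Qed.

Lemma gKF i j X : gK M i *m (gF M j *m X) = qp (- (cartan i j)%:~R) *: (gF M j *m (gK M i *m X)).
Proof.
rewrite !mulmxA (gis_qp_comm ax (gm_qp hM i) (c := - (cartan i j)%:~R)) ?scalemxAl //.
by rewrite (gcstN ax) (gcst_int ax) (gm_hF hM) scaleNr.
Qed.

Lemma gKP i X : gK M i *m (P M *m X) = P M *m (gK M i *m X).
Proof.
rewrite !mulmxA (gis_qp_comm ax (gm_qp hM i) (c := 0)) ?(qp0 ax) ?scale1r //.
by rewrite (gcst0 ax) scale0r addr0 (gm_parh hM).
Qed.

Lemma gPE1 X : P M *m (gE M i1 *m X) = gE M i1 *m (P M *m X).
Proof. by rewrite !mulmxA (gm_parE hM) scale1r. Qed.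
Lemma gPF1 X : P M *m (gF M i1 *m X) = gF M i1 *m (P M *m X).
Proof. by rewrite !mulmxA (gm_parF hM) scale1r. Qed.
Lemma gPE2 X : P M *m (gE M i2 *m X) = - (gE M i2 *m (P M *m X)).
Proof. by rewrite !mulmxA (gm_parE hM) expr1 scaleN1r mulNmx. Qed.
Lemma gPF2 X : P M *m (gF M i2 *m X) = - (gF M i2 *m (P M *m X)).
Proof. by rewrite !mulmxA (gm_parF hM) expr1 scaleN1r mulNmx. Qed.
Lemma gPh i X : P M *m (gh M i *m X) = gh M i *m (P M *m X).
Proof. by rewrite !mulmxA (gm_parh hM). Qed.
Lemma gPP X : P M *m (P M *m X) = X.
Proof. by rewrite !mulmxA gpar_mxK mul1mx. Qed.

Lemma gE2E2 X : gE M i2 *m (gE M i2 *m X) = 0.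
Proof. by rewrite mulmxA (gm_EE hM) mul0mx. Qed.
Lemma gF2F2 X : gF M i2 *m (gF M i2 *m X) = 0.
Proof. by rewrite mulmxA (gm_FF hM) mul0mx. Qed.

Lemma gE1E1E2 X : gE M i1 *m (gE M i1 *m (gE M i2 *m X)) =
  (q + q^-1) *: (gE M i1 *m (gE M i2 *m (gE M i1 *m X))) - gE M i2 *m (gE M i1 *m (gE M i1 *m X)).
Proof.
apply/eqP; rewrite -subr_eq0 opprB addrA addrAC; apply/eqP.
have := congr1 (mulmx^~ X) (gm_serreE hM).
by rewrite mulmxDl mulmxBl mul0mx -scalemxAl -!mulmxA.
Qed.
Lemma gF1F1F2 X : gF M i1 *m (gF M i1 *m (gF M i2 *m X)) =
  (q + q^-1) *: (gF M i1 *m (gF M i2 *m (gF M i1 *m X))) - gF M i2 *m (gF M i1 *m (gF M i1 *m X)).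
Proof.
apply/eqP; rewrite -subr_eq0 opprB addrA addrAC; apply/eqP.
have := congr1 (mulmx^~ X) (gm_serreF hM).
by rewrite mulmxDl mulmxBl mul0mx -scalemxAl -!mulmxA.
Qed.

Lemma gE1F2 X : gE M i1 *m (gF M i2 *m X) = gF M i2 *m (gE M i1 *m X).
Proof. by rewrite !mulmxA (gm_EF hM) /= scale0r addr0 scale1r. Qed.
Lemma gE2F1 X : gE M i2 *m (gF M i1 *m X) = gF M i1 *m (gE M i2 *m X).
Proof. by rewrite !mulmxA (gm_EF hM) /= scale0r addr0 scale1r. Qed.

Lemma gKeig i c X : gh M i *m X = cst c *: X -> gK M i *m X = qp c *: X.
Proof. exact: gis_qp_eigen (gm_qp hM i). Qed.

Lemma gK_unit i : gK M i \in unitmx.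
Proof. exact: gis_qp_unit (gm_qp hM i). Qed.

Lemma gKVeig i c X : gh M i *m X = cst c *: X -> invmx (gK M i) *m X = qp (- c) *: X.
Proof.
move/gKeig => KX; rewrite (qpN ax).
have {1}-> : X = (qp c)^-1 *: (gK M i *m X).
  by rewrite KX scalerA mulVf ?scale1r // (qp_neq0 ax).
by rewrite -scalemxAr mulmxA mulVmx ?gK_unit // mul1mx.
Qed.

Lemma gE1F1 c X : gh M i1 *m X = cst c *: X ->
  gE M i1 *m (gF M i1 *m X) = gF M i1 *m (gE M i1 *m X) + qint c *: X.
Proof.
move=> hX; rewrite !mulmxA (gm_EF hM) /= !scale1r mulmxDl; congr (_ + _).
rewrite -scalemxAl mulmxBl (gKeig hX) (gKVeig hX) -scalerBl scalerA.
by [].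
Qed.

Lemma gE2F2 c X : gh M i2 *m X = cst c *: X ->
  gE M i2 *m (gF M i2 *m X) = - (gF M i2 *m (gE M i2 *m X)) + qint c *: X.
Proof.
move=> hX; rewrite !mulmxA (gm_EF hM) /= !scale1r mulmxDl.
rewrite expr1 scaleN1r mulNmx; congr (_ + _).
rewrite -scalemxAl mulmxBl (gKeig hX) (gKVeig hX) -scalerBl scalerA.
by [].
Qed.

Lemma ghE i j c X : gh M i *m X = cst c *: X ->
  gh M i *m (gE M j *m X) = cst (c + (cartan i j)%:~R) *: (gE M j *m X).
Proof.
move=> hX; rewrite mulmxA (gm_hE hM) mulmxDl -mulmxA hX.
by rewrite -scalemxAr -scalemxAl -scalerDl (qcstD ax) (gcst_int ax).
Qed.
Lemma ghF i j c X : gh M i *m X = cst c *: X ->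
  gh M i *m (gF M j *m X) = cst (c - (cartan i j)%:~R) *: (gF M j *m X).
Proof.
move=> hX; rewrite mulmxA (gm_hF hM) mulmxBl -mulmxA hX.
by rewrite -scalemxAr -scalemxAl -scalerBl (qcstD ax) (gcstN ax) (gcst_int ax).
Qed.

End One.

End Modules.

(** * Highest weight vectors *)

(** Finite dimension enters here: d + 1 nonzero vectors would give d + 1 distinct roots of a
    characteristic polynomial of degree d. The transpose appears because [eigenvalue] refers to row
    vectors. *)
Lemma ex_zero_eigenvector (C : numFieldType) (F : fieldType) (cst qp : C -> F) d (A : 'M[F]_d)
    (c s : C) (v : nat -> 'cV[F]_d) : qexp cst qp -> s != 0 ->
  (forall k, A *m v k = cst (c + k%:R * s) *: v k) -> exists k, v k = 0.
Proof.
move=> ax s0 Av; apply: contrapT => nv.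
pose rs := [seq cst (c + k%:R * s) | k <- iota 0 d.+1].
have urs : uniq rs.
  rewrite map_inj_uniq ?iota_uniq // => i j /(qcst_inj ax)/addrI/(mulIf s0)/eqP.
  by rewrite eqr_nat => /eqP.
have rrs : all (root (char_poly A^T)) rs.
  apply/allP => _ /mapP[k _ ->]; rewrite -eigenvalue_root_char; apply/eigenvalueP.
  exists (v k)^T; first by rewrite -trmx_mul Av linearZ.
  by rewrite trmx_eq0; apply/eqP => vk; apply: nv; exists k.
have := max_poly_roots (monic_neq0 (char_poly_monic A^T)) rrs urs.
by rewrite size_char_poly size_map size_iota ltnn.
Qed.

Section HighestWeight.
Variables (C : numFieldType) (F : fieldType) (cst qp : C -> F).
Hypothesis ax : qexp cst qp.
Implicit Type M : gmod F.
Local Notation q := (qp 1).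
Local Notation qint := (qint qp).
Local Notation P M := (gpar_mx F M true).
Local Notation is_gmod := (is_gmod cst qp).

Definition gwt M m (a b : C) (X : 'M[F]_(sdim M, m)) : Prop :=
  gh M i1 *m X = cst a *: X /\ gh M i2 *m X = cst b *: X.

Definition ghw M (a b : C) (v : 'cV[F]_(sdim M)) : Prop :=
  [/\ v != 0, gwt a b v & forall i, gE M i *m v = 0].

Definition F1k M i (v : 'cV[F]_(sdim M)) := iter i (mulmx (gF M i1)) v.

(* The elements X F_1^i v for X = 1, F_2, F_1 F_2, F_2 F_1 F_2; they span the submodule generated by
   a highest weight vector v. *)
Definition fam M (v : 'cV[F]_(sdim M)) k i : 'cV[F]_(sdim M) :=
  match k with
  | 0 => F1k i v
  | 1 => gF M i2 *m F1k i v
  | 2 => gF M i1 *m (gF M i2 *m F1k i v)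
  | _ => gF M i2 *m (gF M i1 *m (gF M i2 *m F1k i v))
  end%N.

Section Weights.
Variable M : gmod F.
Hypothesis hM : is_gmod M.
Variable m : nat.
Implicit Type X : 'M[F]_(sdim M, m).

Lemma gwtE1 a b X : gwt a b X -> gwt (a + 2) (b - 1) (gE M i1 *m X).
Proof. by case=> h1 h2; split; [rewrite (ghE ax hM _ h1) | rewrite (ghE ax hM _ h2)]. Qed.
Lemma gwtE2 a b X : gwt a b X -> gwt (a - 1) b (gE M i2 *m X).
Proof. by case=> h1 h2; split; [rewrite (ghE ax hM _ h1) | rewrite (ghE ax hM _ h2) addr0]. Qed.
Lemma gwtF1 a b X : gwt a b X -> gwt (a - 2) (b + 1) (gF M i1 *m X).
Proof.
by case=> h1 h2; split; [rewrite (ghF ax hM _ h1) | rewrite (ghF ax hM _ h2) opprK].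
Qed.
Lemma gwtF2 a b X : gwt a b X -> gwt (a + 1) b (gF M i2 *m X).
Proof.
by case=> h1 h2; split; [rewrite (ghF ax hM _ h1) opprK | rewrite (ghF ax hM _ h2) subr0].
Qed.
Lemma gwtP a b X : gwt a b X -> gwt a b (P M *m X).
Proof. by case=> h1 h2; split; rewrite -(gPh hM) ?h1 ?h2 -scalemxAr. Qed.
Lemma gwtZ a b c X : gwt a b X -> gwt a b (c *: X).
Proof. by case=> h1 h2; split; rewrite -scalemxAr ?h1 ?h2 scalerA mulrC -scalerA. Qed.
Lemma gwtD a b X Y : gwt a b X -> gwt a b Y -> gwt a b (X + Y).
Proof. by case=> h1 h2 [h3 h4]; split; rewrite mulmxDr scalerDr ?h1 ?h2 ?h3 ?h4. Qed.

End Weights.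

Section Sl2.
Variable M : gmod F.
Hypothesis hM : is_gmod M.
Variables (v : 'cV[F]_(sdim M)) (a : C).
Hypotheses (hv : gh M i1 *m v = cst a *: v) (Ev : gE M i1 *m v = 0).

Lemma gh1F1k i : gh M i1 *m F1k i v = cst (a - i%:R * 2) *: F1k i v.
Proof.
elim: i => [|i IHi]; first by rewrite mul0r subr0.
rewrite /= (ghF ax hM _ IHi); congr (cst _ *: _); rewrite -[i.+1]addn1 natrD.
by rewrite /cartan /=; ring.
Qed.

(** At i = 0 the factor [0] vanishes, which makes the default value [0.-1 = 0] harmless. *)
Lemma gE1F1k i : gE M i1 *m F1k i v = (qint i%:R * qint (a - i%:R + 1)) *: F1k i.-1 v.
Proof.
elim: i => [|i IHi]; first by rewrite Ev (qint0 ax) mul0r scale0r.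
rewrite [F1k _ _]/= (gE1F1 ax hM (gh1F1k i)) IHi -scalemxAr.
have -> : (qint i%:R * qint (a - i%:R + 1)) *: (gF M i1 *m F1k i.-1 v) =
  (qint i%:R * qint (a - i%:R + 1)) *: F1k i v.
  by case: (i) => [|j] //; rewrite (qint0 ax) mul0r !scale0r.
rewrite -scalerDl; congr (_ *: _).
have := qint_step ax a i%:R.
have -> : a - i%:R - i%:R = a - i%:R * 2 by ring.
by move=> <-; rewrite -[i.+1]addn1 natrD; congr (_ * qint _); ring.
Qed.

Lemma F1k_neq0 x : v != 0 -> a = x%:R -> forall i, (i <= x)%N -> F1k i v != 0.
Proof.
move=> v0 ea; elim=> [|i IHi] // lt_ix; apply: contra (IHi (ltnW lt_ix)) => /eqP Fi.
have := gE1F1k i.+1; rewrite Fi mulmx0 => /esym/eqP; rewrite scaler_eq0.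
rewrite mulf_eq0 !(qint_eq0 ax) ea pnatr_eq0 /=.
suff /negPf-> : x%:R - i.+1%:R + 1 != 0 :> C by [].
by rewrite -natrB // natr1 pnatr_eq0.
Qed.

(** For the least x with F_1^(x+1) v = 0, applying E_1 gives [x + 1] [a - x] F_1^x v = 0 with F_1^x
    v nonzero, hence a = x. *)
Lemma F1k_nilpotent : v != 0 -> exists2 x, a = x%:R & F1k x.+1 v = 0.
Proof.
move=> v0; have ex : exists k, F1k k v == 0.
  have s0 : - 2%:R != 0 :> C by rewrite oppr_eq0 pnatr_eq0.
  have [|k e] := ex_zero_eigenvector (A := gh M i1) (c := a) (v := fun k => F1k k v) ax s0.
    by move=> k; rewrite gh1F1k mulrN.
  by exists k; apply/eqP.
have [k /eqP Fk kmin] := ex_minnP ex.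
case: k Fk kmin => [/= e|x Fx xmin]; first by rewrite e eqxx in v0.
exists x => //; have := gE1F1k x.+1; rewrite Fx mulmx0 => /esym/eqP.
rewrite scaler_eq0 => /orP[|/xmin]; last by rewrite ltnn.
rewrite mulf_eq0 !(qint_eq0 ax) pnatr_eq0 /= -natr1 opprD addrA subrK subr_eq0.
by move/eqP.
Qed.

Lemma F1k_eq0 x : a = x%:R -> forall i, (x < i)%N -> F1k i v = 0.
Proof.
move=> ea i; have [v0|v0] := eqVneq v 0.
  by rewrite v0 => _; elim: i => //= i ->; rewrite mulmx0.
have [y] := F1k_nilpotent v0; rewrite ea => /eqP; rewrite eqr_nat => /eqP <- Fx lt_xi.
rewrite -(subnK lt_xi) /F1k iterD (_ : iter x.+1 _ v = 0) //.
by elim: (i - _)%N => //= j ->; rewrite mulmx0.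
Qed.

End Sl2.

Section Family.
Variable M : gmod F.
Hypothesis hM : is_gmod M.
Variables (v : 'cV[F]_(sdim M)) (a b : C).
Hypotheses (hv : gwt a b v) (Ev : forall i, gE M i *m v = 0).
Local Notation e i := (qint i%:R * qint (a - i%:R + 1)).

Lemma gwtF1k i : gwt (a - i%:R * 2) (b + i%:R) (F1k i v).
Proof.
elim: i => [|i /(gwtF1 hM)]; first by rewrite mul0r subr0 addr0.
have -> : a - i%:R * 2 - 2 = a - i.+1%:R * 2 by rewrite -(natr1 i); ring.
by rewrite -addrA natr1.
Qed.

Lemma gE2F1k i : gE M i2 *m F1k i v = 0.
Proof. by elim: i => [|i IHi] //=; rewrite ?Ev // (gE2F1 hM) IHi mulmx0. Qed.

Lemma famF1_0 i : gF M i1 *m fam v 0 i = fam v 0 i.+1. Proof. by []. Qed.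
Lemma famF1_1 i : gF M i1 *m fam v 1 i = fam v 2 i. Proof. by []. Qed.
Lemma famF1_2 i : gF M i1 *m fam v 2 i = (q + q^-1) *: fam v 2 i.+1 - fam v 1 i.+2.
Proof. exact: (gF1F1F2 hM). Qed.

(** Multiplying the Serre relation by F_2 on the right and on the left, with F_2^2 = 0, expresses
    F_2 F_1 F_1 F_2 as [2] times either side, and [2] is nonzero. It is the reason why four words
    suffice in [fam]. *)
Lemma gF1212 m (X : 'M_(_, m)) : gF M i1 *m (gF M i2 *m (gF M i1 *m (gF M i2 *m X))) =
  gF M i2 *m (gF M i1 *m (gF M i2 *m (gF M i1 *m X))).
Proof.
have e1 := gF1F1F2 hM (gF M i2 *m X); rewrite (gF2F2 hM) !mulmx0 in e1.
have e2 := congr1 (mulmx (gF M i2)) (gF1F1F2 hM X).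
move/esym/eqP: e1; rewrite subr_eq0 => /eqP e1.
move: e2; rewrite -e1 mulmxBr (gF2F2 hM) subr0 -scalemxAr => /(scalerI _); apply.
by rewrite -(qint2 ax) (qint_eq0 ax) pnatr_eq0.
Qed.

End Family.
End HighestWeight.

(** * Matrices given by their columns *)

Definition cols (F : fieldType) d n (g : 'I_n -> 'cV[F]_d) : 'M[F]_(d, n) :=
  \matrix_(r, k) g k r 0.

Lemma mul_cols (F : fieldType) d e n (A : 'M[F]_(e, d)) (g : 'I_n -> 'cV[F]_d) :
  A *m cols g = cols (fun k => A *m g k).
Proof. by apply/matrixP => r k; rewrite !mxE; apply: eq_bigr => j _; rewrite mxE. Qed.

Lemma cols_mul (F : fieldType) d n (g : 'I_n -> 'cV[F]_d) (c : 'cV_n) :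
  cols g *m c = \sum_k c k 0 *: g k.
Proof.
apply/colP => r; rewrite mxE summxE; apply: eq_bigr => k _.
by rewrite !mxE mulrC.
Qed.

Lemma eq_cols (F : fieldType) d n (g g' : 'I_n -> 'cV[F]_d) :
  cols g = cols g' <-> g =1 g'.
Proof.
split=> [e k|e]; last by apply/matrixP => r k; rewrite !mxE e.
by apply/colP => r; move/matrixP/(_ r k): e; rewrite !mxE.
Qed.

Lemma cols_delta (F : fieldType) d n (g : 'I_n -> 'cV[F]_d) k : cols g *m delta_mx k 0 = g k.
Proof.
rewrite cols_mul (bigD1 k) //= big1 => [|j jk]; rewrite !mxE ?eqxx ?scale1r ?addr0 //.
by rewrite (negPf jk) scale0r.
Qed.

(** * Action of the generators on the family, and its independence *)

Section FamilyAction.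
Variables (C : numFieldType) (F : fieldType) (cst qp : C -> F).
Hypothesis ax : qexp cst qp.
Local Notation q := (qp 1).
Local Notation qint := (qint qp).
Local Notation P M := (gpar_mx F M true).
Local Notation is_gmod := (is_gmod cst qp).
Variable M : gmod F.
Hypothesis hM : is_gmod M.
Variables (v : 'cV[F]_(sdim M)) (a b : C).
Hypotheses (hv : gwt cst a b v) (Ev : forall i, gE M i *m v = 0).
Local Notation e i := (qint i%:R * qint (a - i%:R + 1)).
Local Notation fm := (fam v).

Lemma famF1_3 i : gF M i1 *m fm 3 i = fm 3 i.+1.
Proof. exact: (gF1212 ax hM). Qed.
Lemma famF2_0 i : gF M i2 *m fm 0 i = fm 1 i. Proof. by []. Qed.
Lemma famF2_1 i : gF M i2 *m fm 1 i = 0. Proof. exact: (gF2F2 hM). Qed.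
Lemma famF2_2 i : gF M i2 *m fm 2 i = fm 3 i. Proof. by []. Qed.
Lemma famF2_3 i : gF M i2 *m fm 3 i = 0. Proof. exact: (gF2F2 hM). Qed.

Lemma famE1_0 i : gE M i1 *m fm 0 i = e i *: fm 0 i.-1.
Proof. by case: hv => h1 _; exact: (gE1F1k ax hM h1). Qed.
Lemma famE1_1 i : gE M i1 *m fm 1 i = e i *: fm 1 i.-1.
Proof. by rewrite /= (gE1F2 hM) famE1_0 -scalemxAr. Qed.
Lemma famE1_2 i : gE M i1 *m fm 2 i = e i *: fm 2 i.-1 + qint (a - i%:R * 2 + 1) *: fm 1 i.
Proof.
have [h1 _] := gwtF2 ax hM (gwtF1k ax hM hv i).
by rewrite /= (gE1F1 ax hM h1) famE1_1 -scalemxAr.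
Qed.
Lemma famE1_3 i : gE M i1 *m fm 3 i = e i *: fm 3 i.-1.
Proof.
rewrite /= (gE1F2 hM) [X in _ *m X = _]famE1_2 mulmxDr -!scalemxAr famF2_1.
by rewrite scaler0 addr0.
Qed.
Lemma famE2_0 i : gE M i2 *m fm 0 i = 0. Proof. exact: (gE2F1k hM Ev). Qed.
Lemma famE2_1 i : gE M i2 *m fm 1 i = qint (b + i%:R) *: fm 0 i.
Proof.
have [_ h2] := gwtF1k ax hM hv i.
by rewrite /= (gE2F2 ax hM h2) famE2_0 mulmx0 oppr0 add0r.
Qed.
Lemma famE2_2 i : gE M i2 *m fm 2 i = qint (b + i%:R) *: fm 0 i.+1.
Proof. by rewrite /= (gE2F1 hM) famE2_1 -scalemxAr. Qed.
Lemma famE2_3 i : gE M i2 *m fm 3 i = qint (b + i%:R + 1) *: fm 2 i - qint (b + i%:R) *: fm 1 i.+1.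
Proof.
have [_ h2] := gwtF1 ax hM (gwtF2 ax hM (gwtF1k ax hM hv i)).
by rewrite [fm _ _]/= (gE2F2 ax hM h2) famE2_2 -scalemxAr addrC.
Qed.

(** The shift of the weight by the word in front of F_1^i: F_2 adds (1, 0) and F_1 adds (-2, 1). *)
Definition fam_a k : C := match k with 0%N => 0 | 1%N => 1 | 2%N => -1 | _ => 0 end.
Definition fam_b k : C := match k with 0%N | 1%N => 0 | _ => 1 end.

Lemma gwt_fam k i : gwt cst (a - i%:R * 2 + fam_a k) (b + i%:R + fam_b k) (fm k i).
Proof.
have w0 := gwtF1k ax hM hv i; have w1 := gwtF2 ax hM w0; have w2 := gwtF1 ax hM w1.
have e2 : a - i%:R * 2 + 1 - 2 = a - i%:R * 2 - 1 by ring.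
case: k => [|[|[|k]]] /=; rewrite ?addr0 // -?e2 //.
by have := gwtF2 ax hM w2; rewrite e2 subrK.
Qed.

Local Arguments fam : simpl never.

Variable x : nat.
Hypothesis ea : a = x%:R.

Lemma fam_eq0 k i : (x < i)%N -> fm k i = 0.
Proof.
case: hv => h1 _ lt_xi; have e0 := F1k_eq0 ax hM h1 (Ev _) ea lt_xi.
by case: k => [|[|[|k]]]; rewrite /fam e0 ?mulmx0.
Qed.

Definition famx : 'M[F]_(sdim M, 4 * x.+1) :=
  cols (fun k => fm (mxtens_unindex k).1 (mxtens_unindex k).2).

Lemma famx_index (k : 'I_4) (i : 'I_x.+1) : famx *m delta_mx (mxtens_index (k, i)) 0 = fm k i.
Proof. by rewrite cols_delta mxtens_indexK. Qed.

Lemma famx_span k i : (k < 4)%N -> exists c, fm k i = famx *m c.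
Proof.
move=> lk; case: (ltnP x i) => [/fam_eq0->|le_ix]; first by exists 0; rewrite mulmx0.
by exists (delta_mx (mxtens_index (Ordinal lk, inord i)) 0); rewrite famx_index inordK.
Qed.

Lemma famx_mul (c : 'cV[F]_(4 * x.+1)) :
  famx *m c = \sum_(k < 4) \sum_(i < x.+1) c (mxtens_index (k, i)) 0 *: fm k i.
Proof.
rewrite cols_mul pair_bigA (reindex (@mxtens_index 4 x.+1)); last first.
  by exists (@mxtens_unindex 4 x.+1) => k _; rewrite ?mxtens_indexK ?mxtens_unindexK.
by apply: eq_bigr => -[k i] _; rewrite mxtens_indexK.
Qed.

Hypotheses (v0 : v != 0) (b0 : b != 0) (xb0 : x%:R + b + 1 != 0).

(** E_2 E_1 E_2 brings the vector back to [b] [x + b + 1] v, which is nonzero by the two hypotheses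
    on b. *)
Lemma fam3_0_neq0 : fm 3 0 != 0.
Proof.
apply/eqP => T0; have := congr1 (mulmx (gE M i2)) T0.
rewrite famE2_3 mulmx0 => /(congr1 (mulmx (gE M i1))).
rewrite mulmxBr -!scalemxAr famE1_2 famE1_1 (qint0 ax) mul0r scale0r add0r !addr0 mulmx0.
rewrite !scalerA (qint1 ax) mul1r mul0r subr0 subrK -scalerBl /=.
rewrite (qintD1 ax) (addrC b) => /(congr1 (mulmx (gE M i2))).
rewrite mulmx0 -scalemxAr (famE2_1 0) scalerA => /eqP.
by rewrite scaler_eq0 mulf_eq0 !(qint_eq0 ax) ea addr0 (negPf b0) (negPf v0) (negPf xb0).
Qed.

Lemma fam3_x i : fm 3 i = F1k i (fm 3 0).
Proof. by elim: i => [|i IHi] //; rewrite -famF1_3 IHi. Qed.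

Lemma fam3_indep (d : 'I_x.+1 -> F) : \sum_i d i *: fm 3 i = 0 -> forall i, d i = 0.
Proof.
move=> sd; suff H n : forall i : 'I_x.+1, (i < n)%N -> d i = 0 by move=> i; exact: (H x.+1).
elim: n => // n IHn i; rewrite ltnS leq_eqVlt => /orP[/eqP ein|]; last exact: IHn.
have F3 j m : F1k j (fm 3 m) = fm 3 (j + m).
  by elim: j => [|j IHj] //; rewrite addSn -famF1_3 -IHj.
have F3s j : F1k j (\sum_i d i *: fm 3 i) = \sum_i d i *: fm 3 (j + i).
  elim: j => [|j IHj] //; rewrite [LHS]/= IHj mulmx_sumr; apply: eq_bigr => k _.
  by rewrite -scalemxAr famF1_3.
(* F_1^(x - n) moves the terms of index above n beyond x, where they vanish; those below n have zero
   coefficients by induction. Only d_n F_1^x (F_2 F_1 F_2 v) is left. *)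
have := F3s (x - n)%N; rewrite sd.
have -> : F1k (x - n) (0 : 'cV[F]_(sdim M)) = 0 by elim: (_ - _)%N => //= j ->; rewrite mulmx0.
rewrite (bigD1 i) //= big1 => [|j ji]; last first.
  have [lt_jn|] := ltnP j n; first by rewrite IHn ?scale0r.
  rewrite leq_eqVlt => /orP[/eqP enj|lt_nj].
    by case/eqP: ji; apply: val_inj; rewrite /= -enj.
  have le_nx : (n <= x)%N by rewrite -ein -ltnS.
  by rewrite fam_eq0 ?scaler0 // -{1}(subnK le_nx) ltn_add2l.
have le_ix : (i <= x)%N by rewrite -ltnS.
rewrite addr0 -ein subnK // => /esym/eqP; rewrite scaler_eq0 => /orP[/eqP //|].
(* F_2 F_1 F_2 v has h_1-weight x again and is killed by E_1, so F_1^x does not kill it. *)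
case: (gwt_fam 3 0) => h1 _; rewrite mul0r subr0 addr0 in h1.
rewrite fam3_x; have E1T : gE M i1 *m fm 3 0 = 0.
  by rewrite famE1_3 (qint0 ax) mul0r scale0r.
by rewrite (negPf (F1k_neq0 ax hM h1 E1T fam3_0_neq0 ea (leqnn x))).
Qed.

Lemma famx_inj (c : 'cV[F]_(4 * x.+1)) : famx *m c = 0 -> c = 0.
Proof.
rewrite famx_mul (@big_ord_recl _ _ _ 3) (@big_ord_recl _ _ _ 2) (@big_ord_recl _ _ _ 1)
  (@big_ord_recl _ _ _ 0) big_ord0 addr0 => c0.
have {}c0 : (\sum_(i < x.+1) c (mxtens_index (ord0, i)) 0 *: fm 0 i) +
  ((\sum_(i < x.+1) c (mxtens_index (lift ord0 ord0, i)) 0 *: fm 1 i) +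
  ((\sum_(i < x.+1) c (mxtens_index (lift ord0 (lift ord0 ord0), i)) 0 *: fm 2 i) +
  (\sum_(i < x.+1) c (mxtens_index (lift ord0 (lift ord0 (lift ord0 ord0)), i)) 0 *: fm 3 i))) = 0 := c0.
have T4 (d : 'I_x.+1 -> F) (A : 'M[F]_(sdim M)) (g h : nat -> 'cV[F]_(sdim M)) :
    (forall i, A *m g i = h i) ->
    A *m (\sum_i d i *: g i) = \sum_i d i *: h i.
  by move=> Ag; rewrite mulmx_sumr; apply: eq_bigr => i _; rewrite -scalemxAr Ag.
have Z (d : 'I_x.+1 -> F) : \sum_i d i *: (0 : 'cV[F]_(sdim M)) = 0.
  by rewrite big1 // => i _; rewrite scaler0.
(* T, then F_2, then F_2 F_1 kill all blocks but one of those not yet known to vanish, which they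
   move to the block of T. *)
pose T := gF M i2 *m (gF M i1 *m gF M i2).
pose FF := gF M i2 *m gF M i1.
have TE (w : 'cV_(sdim M)) : T *m w = gF M i2 *m (gF M i1 *m (gF M i2 *m w)) by rewrite /T !mulmxA.
have FFE (w : 'cV_(sdim M)) : FF *m w = gF M i2 *m (gF M i1 *m w) by rewrite /FF !mulmxA.
have T0 i : T *m fm 0 i = fm 3 i by rewrite TE famF2_0.
have T1 i : T *m fm 1 i = 0 by rewrite TE famF2_1 !mulmx0.
have T2 i : T *m fm 2 i = 0 by rewrite TE famF2_2 famF1_3 famF2_3.
have T3 i : T *m fm 3 i = 0 by rewrite TE famF2_3 !mulmx0.
have FF1 i : FF *m fm 1 i = fm 3 i by rewrite FFE famF1_1 famF2_2.
have FF3 i : FF *m fm 3 i = 0 by rewrite FFE famF1_3 famF2_3.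
have := congr1 (mulmx T) c0.
rewrite mulmx0 !mulmxDr (T4 _ _ _ _ T0) (T4 _ _ _ _ T1) (T4 _ _ _ _ T2) (T4 _ _ _ _ T3).
rewrite !Z !addr0 => /fam3_indep d0.
move: c0; rewrite [X in X + _]big1 ?add0r => [c0|i _]; last by rewrite d0 scale0r.
have := congr1 (mulmx (gF M i2)) c0.
rewrite mulmx0 !mulmxDr (T4 _ _ _ _ famF2_1) (T4 _ _ _ _ famF2_2) (T4 _ _ _ _ famF2_3).
rewrite !Z add0r addr0 => /fam3_indep d2.
move: c0; rewrite [X in _ + (X + _)]big1 ?add0r => [c0|i _]; last by rewrite d2 scale0r.
have := congr1 (mulmx FF) c0.
rewrite mulmx0 !mulmxDr (T4 _ _ _ _ FF1) (T4 _ _ _ _ FF3) Z addr0 => /fam3_indep d1.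
move: c0; rewrite [X in X + _]big1 ?add0r => [/fam3_indep d3|i _]; last by rewrite d1 scale0r.
apply/colP => k; rewrite -[k]mxtens_unindexK mxE.
by case: (mxtens_unindex k) => -[[|[|[|[|//]]]] lt] i;
  [rewrite -(d0 i) | rewrite -(d1 i) | rewrite -(d2 i) | rewrite -(d3 i)];
  congr (c (mxtens_index (_, _)) 0); apply: val_inj.
Qed.

End FamilyAction.

(** If [mu k] differs from l, applying A - mu_k removes the term k, rescales the others and
    multiplies v by a nonzero scalar. Were this so for every k, v would end up as an empty sum. *)
Lemma eigenvalue_in_span (F : fieldType) d (A : 'M[F]_d) (I : Type) (s : seq I)
    (g : I -> 'cV[F]_d) (mu : I -> F) (v : 'cV[F]_d) l :
  (forall k, A *m g k = mu k *: g k) -> A *m v = l *: v -> v != 0 ->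
  v = \sum_(k <- s) g k -> exists k, mu k = l.
Proof.
elim: s g v => [|k s IHs] g v Ag Av v0 ev; first by rewrite ev big_nil eqxx in v0.
have [ek|nk] := eqVneq (mu k) l; first by exists k.
apply: (IHs (fun j => (mu j - mu k) *: g j) ((l - mu k) *: v)).
- by move=> j; rewrite -scalemxAr Ag !scalerA mulrC.
- by rewrite -scalemxAr Av !scalerA mulrC.
- by rewrite scaler_eq0 subr_eq0 eq_sym (negPf nk).
have : A *m v - mu k *: v = A *m v - mu k *: v by [].
rewrite {1}Av -scalerBl => ->; rewrite ev mulmx_sumr scaler_sumr -sumrB big_cons.
rewrite Ag subrr add0r; apply: eq_bigr => j _.
by rewrite Ag scalerBl.
Qed.

Lemma mul_cols_span (F : fieldType) d n m (A : 'M[F]_d) (g : 'I_n -> 'cV[F]_d) (B : 'M[F]_(d, m)) :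
  (forall k, exists c, A *m g k = B *m c) -> exists Y, A *m cols g = B *m Y.
Proof.
move=> /(fin_all_exists (U := fun _ => 'cV[F]_m))[f Af]; exists (cols f).
by rewrite !mul_cols; apply/eq_cols.
Qed.

Lemma mulmx1_size (F : fieldType) m n (A : 'M[F]_(m, n)) (B : 'M[F]_(n, m)) :
  A *m B = 1%:M -> (m <= n)%N.
Proof.
by move=> AB; rewrite -(mxrank1 F m) -AB (leq_trans (mxrankM_maxl _ _)) // rank_leq_col.
Qed.

Lemma ord2P (i : 'I_2) : i = i1 \/ i = i2.
Proof. by case: i => [[|[|//]] lt]; [left | right]; apply: val_inj. Qed.

(** * Simple modules with a highest weight vector *)

Section Simple.
Variables (C : numFieldType) (F : fieldType) (cst qp : C -> F).
Hypothesis ax : qexp cst qp.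
Local Notation q := (qp 1).
Local Notation qint := (qint qp).
Local Notation P M := (gpar_mx F M true).
Local Notation is_gmod := (is_gmod cst qp).
Local Notation ghw := (ghw cst).
Local Notation gwt := (gwt cst).

Definition gstable (M : gmod F) m (B : 'M[F]_(sdim M, m)) : Prop :=
  (exists Y, P M *m B = B *m Y) /\
  forall i, [/\ exists Y, gE M i *m B = B *m Y, exists Y, gF M i *m B = B *m Y
              & exists Y, gh M i *m B = B *m Y].

(* Subspaces are presented by matrices [B] whose columns span them. *)
Definition gsimple (M : gmod F) : Prop :=
  forall m (B : 'M[F]_(sdim M, m)), B != 0 -> gstable B -> exists D, B *m D = 1%:M.

(** The parity operator preserves weights and the kernels of E_1 and E_2, so v + P v serves, or v
    itself when that sum is 0. An eigenvector of P is wanted because submodules are graded. *)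
Lemma ghw_homogeneous (M : gmod F) a b (v : 'cV_(sdim M)) : is_gmod M -> ghw a b v ->
  exists (w : 'cV_(sdim M)) (p : bool), ghw a b w /\ P M *m w = (-1) ^+ p *: w.
Proof.
move=> hM [v0 wv Ev].
have EP i : gE M i *m (P M *m v) = 0.
  have := congr1 (mulmx^~ v) (gm_parE hM i); rewrite -scalemxAl -!mulmxA Ev mulmx0.
  by move/esym/eqP; rewrite scaler_eq0 signr_eq0 /= => /eqP.
have [e|n] := eqVneq (v + P M *m v) 0.
  exists v, true; split; first by split.
  by rewrite expr1 scaleN1r; apply/eqP; rewrite -addr_eq0 addrC e.
exists (v + P M *m v), false; split.
  split=> // [|i]; first by apply: gwtD => //; exact: (gwtP hM).
  by rewrite mulmxDr Ev EP addr0.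
by rewrite mulmxDr gPP expr0 scale1r addrC.
Qed.

Section Span.
Variable M : gmod F.
Hypothesis hM : is_gmod M.
Variables (v : 'cV[F]_(sdim M)) (x : nat) (b : C).
Hypotheses (hv : ghw x%:R b v).
Local Notation fam := (fam v).
Local Notation B := (famx v x).

Let wv : gwt x%:R b v. Proof. by case: hv. Qed.
Let Ev i : gE M i *m v = 0. Proof. by case: hv. Qed.
Let inB (w : 'cV[F]_(sdim M)) := exists c, w = B *m c.

Lemma inB_D u w : inB u -> inB w -> inB (u + w).
Proof. by move=> [c ->] [d ->]; exists (c + d); rewrite mulmxDr. Qed.
Lemma inB_Z k u : inB u -> inB (k *: u).
Proof. by move=> [c ->]; exists (k *: c); rewrite scalemxAr. Qed.
Lemma inB_0 : inB 0. Proof. by exists 0; rewrite mulmx0. Qed.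
Lemma inB_fam k i : (k < 4)%N -> inB (fam k i).
Proof. exact: (famx_span ax hM wv Ev). Qed.

Lemma famx_stable (p : bool) : P M *m v = (-1) ^+ p *: v -> gstable B.
Proof.
move=> Pv.
have Pf0 i : P M *m fam 0 i = (-1) ^+ p *: fam 0 i.
  by elim: i => //= i IHi; rewrite (gPF1 hM) IHi -scalemxAr.
have bnd (A : 'M[F]_(sdim M)) : (forall k i, (k < 4)%N -> inB (A *m fam k i)) ->
    exists Y, A *m B = B *m Y.
  by move=> H; apply: mul_cols_span => k; apply: H.
have iZ := inB_Z; have iD := inB_D; have iF := inB_fam.
have NB u : inB u -> inB (- u) by move/(iZ (-1)); rewrite scaleN1r.
split=> [|i].
  apply: bnd => -[|[|[|[|//]]]] i _; rewrite /fam ?(gPF2 hM, gPF1 hM, mulmxN) Pf0.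
  - by apply: iZ; exact: (iF 0).
  - by rewrite -!scalemxAr; apply/NB/iZ; exact: (iF 1%N).
  - by rewrite -!scalemxAr; apply/NB/iZ; exact: (iF 2).
  - by rewrite -!scalemxAr ?opprK; apply/iZ; exact: (iF 3).
split; apply: bnd.
- case: (ord2P i) => -> [|[|[|[|//]]]] j _.
  + by rewrite (famE1_0 ax hM wv Ev); apply/iZ; exact: (iF 0).
  + by rewrite (famE1_1 ax hM wv Ev); apply/iZ; exact: (iF 1%N).
  + by rewrite (famE1_2 ax hM wv Ev); apply: iD; apply/iZ; [exact: (iF 2) | exact: (iF 1%N)].
  + by rewrite (famE1_3 ax hM wv Ev); apply/iZ; exact: (iF 3).
  + by rewrite (famE2_0 hM Ev); exact: inB_0.
  + by rewrite (famE2_1 ax hM wv Ev); apply/iZ; exact: (iF 0).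
  + by rewrite (famE2_2 ax hM wv Ev); apply/iZ; exact: (iF 0).
  + rewrite (famE2_3 ax hM wv Ev); apply/iD; first by apply/iZ; exact: (iF 2).
    by apply/NB/iZ; exact: (iF 1%N).
- case: (ord2P i) => -> [|[|[|[|//]]]] j _.
  + exact: (iF 0 j.+1).
  + exact: (iF 2 j).
  + rewrite (famF1_2 hM); apply/iD; first by apply/iZ; exact: (iF 2).
    by apply/NB; exact: (iF 1%N).
  + by rewrite (famF1_3 ax hM); exact: (iF 3).
  + exact: (iF 1%N j).
  + by rewrite (famF2_1 hM); exact: inB_0.
  + exact: (iF 3 j).
  + by rewrite (famF2_3 hM); exact: inB_0.
- move=> k j lk; have [h1 h2] := gwt_fam ax hM wv k j.
  by case: (ord2P i) => ->; rewrite ?h1 ?h2; apply/iZ; exact: iF.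
Qed.

Lemma famx_neq0 : B != 0.
Proof.
apply/eqP => B0; case: hv => /eqP v0 _ _; apply: v0.
by have [c] := inB_fam 0 (isT : (0 < 4)%N); rewrite B0 mul0mx.
Qed.

(* F_1 and F_2 do not decrease the eigenvalues of h_1 + 2 h_2 and of h_2. *)
Lemma weight_in_famx (u : 'cV[F]_(sdim M)) a' b' : inB u -> u != 0 -> gwt a' b' u ->
  (exists k, a' + b' + b' = x%:R + b + b + k%:R) /\ (exists k, b' = b + k%:R).
Proof.
move=> [c uc] u0 [u1 u2].
pose g k := c k 0 *: fam (mxtens_unindex k).1 (mxtens_unindex k).2.
pose D := gh M i1 + gh M i2 + gh M i2.
have ug : u = \sum_k g k by rewrite uc cols_mul.
(* [dk] counts the letters F_2 of the word in front of F_1^i and [bk] its letters F_1. F_1 leaves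
   h_1 + 2 h_2 unchanged, while F_2 raises it by 1. *)
pose dk k : nat := match k with 0 => 0 | 1 | 2 => 1 | _ => 2 end%N.
pose bk k : nat := if k is k'.+2 then 1%N else 0%N.
have Dg (k : 'I_(4 * x.+1)) : D *m g k = cst (x%:R + b + b + (dk (mxtens_unindex k).1)%:R) *: g k.
  rewrite /g -scalemxAr !mulmxDl; set i := (mxtens_unindex k).2.
  have [-> ->] := gwt_fam ax hM wv (mxtens_unindex k).1 i.
  rewrite -!scalerDl -!(qcstD ax) !scalerA mulrC; congr (cst _ * _ *: _).
  by case: (mxtens_unindex k).1 => -[|[|[|[|//]]]] lt; rewrite /fam_a /fam_b /=; ring.
have Du : D *m u = cst (a' + b' + b') *: u.
  by rewrite !mulmxDl u1 u2 !(qcstD ax) !scalerDl.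
have hg (k : 'I_(4 * x.+1)) : gh M i2 *m g k =
    cst (b + ((mxtens_unindex k).2 + bk (mxtens_unindex k).1)%:R) *: g k.
  rewrite /g -scalemxAr; set i := (mxtens_unindex k).2.
  have [_ ->] := gwt_fam ax hM wv (mxtens_unindex k).1 i.
  rewrite !scalerA mulrC natrD addrA; congr (cst _ * _ *: _).
  by case: (mxtens_unindex k).1 => -[|[|[|[|//]]]] lt; rewrite /fam_b /=; ring.
have [k /(qcst_inj ax) <-] := eigenvalue_in_span Dg Du u0 ug.
have [j /(qcst_inj ax) <-] := eigenvalue_in_span hg u2 u0 ug.
by split; eexists.
Qed.

End Span.

(** Each of the two vectors can be taken to generate W, so by [weight_in_famx] the weights differ by
    natural numbers in both directions, in h_1 + 2 h_2 as well as in h_2. In characteristic 0 these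
    differences vanish. *)
Lemma simple_hw_weight (W : gmod F) a b a' b' (v v' : 'cV_(sdim W)) : is_gmod W -> gsimple W ->
  ghw a b v -> ghw a' b' v' -> a = a' /\ b = b'.
Proof.
move=> hW sW.
have key a1 b1 (v1 : 'cV_(sdim W)) a2 b2 (v2 : 'cV_(sdim W)) : ghw a1 b1 v1 -> ghw a2 b2 v2 ->
    (exists k, a2 + b2 + b2 = a1 + b1 + b1 + k%:R) /\ (exists k, b2 = b1 + k%:R).
  move=> h1 [v20 w2 Ev2].
  have [w [p [hw Pw]]] := ghw_homogeneous hW h1.
  case: (hw) => w0 [w1 _] Ew; have [x ea _] := F1k_nilpotent ax hW w1 (Ew _) w0.
  rewrite ea in hw *; have [D BD] := sW _ _ (famx_neq0 hW hw) (famx_stable hW hw Pw).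
  by apply: (weight_in_famx hW hw _ v20 w2); exists (D *m v2); rewrite mulmxA BD mul1mx.
move=> h h'; have [[k ek] [j ej]] := key _ _ _ _ _ _ h h'.
have [[k' ek'] [j' ej']] := key _ _ _ _ _ _ h' h.
have z n n' (z z' : C) : z' = z + n%:R -> z = z' + n'%:R -> z = z'.
  move=> -> /eqP; rewrite -addrA -subr_eq0 opprD addNKr oppr_eq0 -natrD pnatr_eq0 addn_eq0.
  by case/andP => /eqP-> _; rewrite addr0.
have eb := z _ _ _ _ ej ej'; have := z _ _ _ _ ek ek'; rewrite eb.
by move/addIr/addIr.
Qed.

Section Typical.
Variable W : gmod F.
Hypotheses (hW : is_gmod W) (sW : gsimple W).
Variables (v : 'cV[F]_(sdim W)) (x : nat) (b : C) (p : bool).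
Hypotheses (hv : ghw x%:R b v) (Pv : P W *m v = (-1) ^+ p *: v).
Hypotheses (b0 : b != 0) (xb0 : x%:R + b + 1 != 0).

(** Simplicity makes the family span W, and the conditions on b make it independent. *)
Lemma typical_inv : exists D, famx v x *m D = 1%:M /\ D *m famx v x = 1%:M.
Proof.
have [D BD] := sW (famx_neq0 hW hv) (famx_stable hW hv Pv); exists D; split=> //.
have [v0 wv Ev] := hv.
apply/eqP; rewrite -subr_eq0; apply/eqP/matrixP => i j.
have := famx_inj ax hW wv Ev (erefl _) v0 b0 xb0 (c := (D *m famx v x - 1%:M) *m delta_mx j 0).
rewrite mulmxA mulmxBr mulmxA BD mul1mx mulmx1 subrr mul0mx => /(_ erefl)/colP/(_ i).
by rewrite -colE !mxE.
Qed.

Lemma typical_dim : sdim W = (4 * x.+1)%N.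
Proof.
have [D [BD DB]] := typical_inv; apply/eqP; rewrite eqn_leq.
by rewrite (mulmx1_size BD) (mulmx1_size DB).
Qed.

(** Expanded in the basis [famx], u involves only members of weight (x, b). The h_2-weight forces i
    = 0 and excludes the words containing F_1; the h_1-weight then excludes F_2 v, leaving v
    alone. *)
Lemma typical_hw_unique a' b' (u : 'cV_(sdim W)) : ghw a' b' u ->
  [/\ a' = x%:R, b' = b & exists c, u = c *: v].
Proof.
move=> hu; have [ea eb] := simple_hw_weight hW sW hu hv; split=> //.
rewrite {}ea {}eb in hu; case: hu => u0 [u1 u2] _.
have [v0 wv Ev] := hv.
have [D [BD DB]] := typical_inv; pose c := D *m u.
have uc : u = famx v x *m c by rewrite mulmxA BD mul1mx.
clearbody c; exists (c (mxtens_index (ord0, ord0)) 0).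
have wt i (a : 'I_(4 * x.+1) -> C) t : gh W i *m u = cst t *: u ->
  (forall k, gh W i *m fam v (mxtens_unindex k).1 (mxtens_unindex k).2 =
     cst (a k) *: fam v (mxtens_unindex k).1 (mxtens_unindex k).2) ->
  forall k, c k 0 != 0 -> a k = t.
  move=> hu ha k ck.
  have : famx v x *m (\col_k (cst (a k) * c k 0) - cst t *: c) = 0.
    rewrite mulmxBr -scalemxAr -uc -hu uc !cols_mul mulmx_sumr -sumrB big1 // => j _.
    by rewrite -scalemxAr ha mxE scalerA mulrC subrr.
  move/(famx_inj ax hW wv Ev (erefl _) v0 b0 xb0)/colP/(_ k)/eqP.
  by rewrite !mxE subr_eq0 => /eqP/(mulIf ck)/(qcst_inj ax).
have H1 := wt _ _ _ u1 (fun k => (gwt_fam ax hW wv (mxtens_unindex k).1 (mxtens_unindex k).2).1).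
have H2 := wt _ _ _ u2 (fun k => (gwt_fam ax hW wv (mxtens_unindex k).1 (mxtens_unindex k).2).2).
rewrite uc cols_mul (bigD1 (mxtens_index (ord0, ord0))) // big1 => [|k nk].
  by rewrite mxtens_indexK; exact: addr0.
have [->|ck] := eqVneq (c k 0) 0; first by rewrite scale0r.
case/eqP: nk; rewrite -[k]mxtens_unindexK; congr (mxtens_index _).
move: (H1 k ck) (H2 k ck); case: (mxtens_unindex k) => -[kk lk] i /= e1 e2.
have fb : fam_b C kk = (1 < kk)%:R by case: (kk) => [|[|]].
move/eqP: e2; rewrite fb -addrA -subr_eq0 [_ - b]addrC addKr -natrD pnatr_eq0 addn_eq0.
case/andP => /eqP i0 k1; move: e1; rewrite i0 mul0r subr0 => /eqP.
rewrite addrC -subr_eq0 addrK; case: kk lk k1 {fb} => [|[|//]] lk _ fa; last by rewrite /= oner_eq0 in fa.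
by congr (_, _); apply: val_inj.
Qed.

End Typical.
End Simple.

(** * Tensor products *)

(* Turns an identity between sums of words into a linear identity, one variable per word. *)
Ltac mx_linear := repeat match goal with
  | |- context [@mulmx ?R ?m ?n ?p ?x ?y] =>
    let w := fresh "w" in set w := (@mulmx R m n p x y); clearbody w
  | |- context [@tensmx ?R ?m ?n ?p ?r ?x ?y] =>
    let w := fresh "w" in set w := (@tensmx R m n p r x y); clearbody w end.

Definition gserre (F : fieldType) (q : F) d (X Y : 'M[F]_d) : Prop :=
  X *m X *m Y - (q + q^-1) *: (X *m Y *m X) + Y *m X *m X = 0.

(* With a = E_1 (x) 1, b = q^-h_1 (x) E_1, c = E_2 (x) 1 and d = q^-h_2 (x) E_2 this is the Serre
   relation for the coproduct. *)
Lemma gserre_sum (F : fieldType) (q : F) n (a b c d : 'M[F]_n) : q != 0 ->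
  b *m a = (q * q)^-1 *: (a *m b) -> b *m c = q *: (c *m b) ->
  d *m a = q *: (a *m d) ->
  gserre q a c -> gserre q b d -> gserre q (a + b) (c + d).
Proof.
(* The identity is multiplied by X = 1 on the right so that the relations apply to right-nested
   words. They bring every word to a normal form, and the coefficients are then compared. *)
move=> q0 ba bc da ac bd; rewrite /gserre -[LHS]mulmx1; move: (1%:M : 'M_n) => X.
have baX Y : b *m (a *m Y) = (q * q)^-1 *: (a *m (b *m Y) : 'M_n) by rewrite !mulmxA ba -scalemxAl.
have bcX Y : b *m (c *m Y) = q *: (c *m (b *m Y) : 'M_n) by rewrite !mulmxA bc -scalemxAl.
have daX Y : d *m (a *m Y) = q *: (a *m (d *m Y) : 'M_n) by rewrite !mulmxA da -scalemxAl.
have acX Y : a *m (a *m (c *m Y)) = (q + q^-1) *: (a *m (c *m (a *m Y))) - c *m (a *m (a *m Y)) :> 'M_n.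
  apply/eqP; rewrite -subr_eq0 opprB addrA addrAC; apply/eqP.
  have := congr1 (mulmx^~ Y) ac.
  by rewrite mulmxDl mulmxBl mul0mx -scalemxAl -!mulmxA.
have bdX Y : b *m (b *m (d *m Y)) = (q + q^-1) *: (b *m (d *m (b *m Y))) - d *m (b *m (b *m Y)) :> 'M_n.
  apply/eqP; rewrite -subr_eq0 opprB addrA addrAC; apply/eqP.
  have := congr1 (mulmx^~ Y) bd.
  by rewrite mulmxDl mulmxBl mul0mx -scalemxAl -!mulmxA.
rewrite !(mulmxDl, mulmxDr, =^~ scalemxAl, mulNmx) -!mulmxA.
rewrite !(baX, bcX, daX, acX, bdX, =^~ scalemxAr, mulmxBr, mulmxDr).
mx_linear; apply/matrixP => i j; rewrite !mxE.
by field.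
Qed.

Section TensMx.
Variable F : fieldType.
Implicit Types m n p r : nat.

Lemma tensDl m n p r (A B : 'M[F]_(m, n)) (C : 'M_(p, r)) : (A + B) *t C = A *t C + B *t C.
Proof. by apply/matrixP => i j; rewrite !mxE mulrDl. Qed.
Lemma tensDr m n p r (A B : 'M[F]_(m, n)) (C : 'M_(p, r)) : C *t (A + B) = C *t A + C *t B.
Proof. by apply/matrixP => i j; rewrite !mxE mulrDr. Qed.
Lemma tensNl m n p r (A : 'M[F]_(m, n)) (C : 'M_(p, r)) : (- A) *t C = - (A *t C).
Proof. by apply/matrixP => i j; rewrite !mxE mulNr. Qed.
Lemma tensNr m n p r (A : 'M[F]_(m, n)) (C : 'M_(p, r)) : C *t (- A) = - (C *t A).
Proof. by apply/matrixP => i j; rewrite !mxE mulrN. Qed.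
Lemma tensZl m n p r k (A : 'M[F]_(m, n)) (C : 'M_(p, r)) : (k *: A) *t C = k *: (A *t C).
Proof. by apply/matrixP => i j; rewrite !mxE mulrA. Qed.
Lemma tensZr m n p r k (A : 'M[F]_(m, n)) (C : 'M_(p, r)) : C *t (k *: A) = k *: (C *t A).
Proof. by apply/matrixP => i j; rewrite !mxE mulrCA. Qed.

Lemma tens_diag m n (u : 'rV[F]_m) (w : 'rV[F]_n) :
  diag_mx u *t diag_mx w =
    diag_mx (\row_k (u 0 (mxtens_unindex k).1 * w 0 (mxtens_unindex k).2)).
Proof.
apply/matrixP => i j; case: (mxtens_indexP i) => i1 i2; case: (mxtens_indexP j) => j1 j2.
rewrite tensmxE !mxE mxtens_indexK /= (inj_eq (can_inj (@mxtens_indexK m n))) xpair_eqE.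
by case: (i1 == j1); case: (i2 == j2); rewrite ?mulr1n ?mulr0n ?mul0r ?mulr0.
Qed.

Lemma tens11 m n : (1%:M : 'M[F]_m) *t (1%:M : 'M[F]_n) = 1%:M.
Proof.
rewrite -!diag_const_mx tens_diag; congr diag_mx.
by apply/rowP => k; rewrite !mxE mulr1.
Qed.

End TensMx.

(** The identity factors, such as [gpar_mx F V false], are kept so that the image of [utens] under
    [to_gmod] is convertible to this module. *)
Definition gtens (F : fieldType) (V W : gmod F) : gmod F :=
  @GMod F (stens V W)
    (fun i => (gE V i *m gpar_mx F V false) *t 1%:M
              + (invmx (gK V i) *m gpar_mx F V (gpar i)) *t gE W i)
    (fun i => (gF V i *m gpar_mx F V false) *t gK W i
              + (1%:M *m gpar_mx F V (gpar i)) *t gF W i)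
    (fun i => (gh V i *m gpar_mx F V false) *t 1%:M
              + (1%:M *m gpar_mx F V false) *t gh W i)
    (fun i => (gK V i *m gpar_mx F V false) *t gK W i).

Section TensMod.
Variables (C : numFieldType) (F : fieldType) (cst qp : C -> F).
Hypothesis ax : qexp cst qp.
Local Notation q := (qp 1).
Local Notation P M := (gpar_mx F M true).
Local Notation is_gmod := (is_gmod cst qp).

Lemma gpar_tens (S S' : superspace) : P (stens S S') = P S *t P S'.
Proof.
rewrite tens_diag; congr diag_mx; apply/rowP => k; rewrite !mxE /=.
by rewrite signr_addb.
Qed.

Section Two.
Variables V W : gmod F.
Hypotheses (hV : is_gmod V) (hW : is_gmod W).

Lemma gtensE i : gE (gtens V W) i = gE V i *t 1%:M + (invmx (gK V i) *m gpar_mx F V (gpar i)) *t gE W i.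
Proof. by rewrite /= gpar_mxF mulmx1. Qed.
Lemma gtensF i : gF (gtens V W) i = gF V i *t gK W i + gpar_mx F V (gpar i) *t gF W i.
Proof. by rewrite /= gpar_mxF mulmx1 mul1mx. Qed.
Lemma gtensh i : gh (gtens V W) i = gh V i *t 1%:M + 1%:M *t gh W i.
Proof. by rewrite /= gpar_mxF !mulmx1. Qed.
Lemma gtensK i : gK (gtens V W) i = gK V i *t gK W i.
Proof. by rewrite /= gpar_mxF mulmx1. Qed.
Lemma gtensKV i : invmx (gK (gtens V W) i) = invmx (gK V i) *t invmx (gK W i).
Proof.
have e : (invmx (gK V i) *t invmx (gK W i)) *m gK (gtens V W) i = 1%:M.
  by rewrite gtensK tensmx_mul !mulVmx ?(gK_unit ax hV) ?(gK_unit ax hW) // tens11.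
have [_ u] := mulmx1_unit e.
by rewrite -[LHS]mul1mx -e -mulmxA mulmxV // mulmx1.
Qed.

Lemma gtens_qp i : gis_qp cst qp (gh (gtens V W) i) (gK (gtens V W) i).
Proof.
have [A [a [Au hA KA]]] := gm_qp hV i; have [B [b [Bu hB KB]]] := gm_qp hW i.
exists (A *t B), (fun k => a (mxtens_unindex k).1 + b (mxtens_unindex k).2); split.
- have : (invmx A *t invmx B) *m (A *t B) = 1%:M by rewrite tensmx_mul !mulVmx // tens11.
  by case/mulmx1_unit.
- rewrite gtensh mulmxDl !tensmx_mul !mul1mx hA hB.
  rewrite -{1}[B]mulmx1 -{2}[A]mulmx1 -!tensmx_mul -mulmxDr; congr (_ *m _).
  rewrite -!diag_const_mx !tens_diag -linearD; congr diag_mx; apply/rowP => k.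
  by rewrite !mxE mulr1 mul1r (qcstD ax).
- rewrite gtensK tensmx_mul KA KB -tensmx_mul tens_diag; congr (_ *m diag_mx _).
  by apply/rowP => k; rewrite !mxE (qpD ax).
Qed.

End Two.
End TensMod.

Section TensIsMod.
Variables (C : numFieldType) (F : fieldType) (cst qp : C -> F).
Hypothesis ax : qexp cst qp.
Local Notation q := (qp 1).
Local Notation P M := (gpar_mx F M true).
Local Notation is_gmod := (is_gmod cst qp).
Local Notation car i j := ((cartan i j)%:~R : C).

Section Commute.
Variable M : gmod F.
Hypothesis hM : is_gmod M.

Lemma gpar_mxC (S : superspace) p p' : gpar_mx F S p *m gpar_mx F S p' = gpar_mx F S p' *m gpar_mx F S p.
Proof. exact: diag_mxC. Qed.

Lemma gKcomm i X c : gK M i *m X = qp c *: (X *m gK M i) ->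
  invmx (gK M i) *m X = qp (- c) *: (X *m invmx (gK M i)).
Proof.
move=> KX; have u := gK_unit ax hM i.
have := congr1 (fun Y => invmx (gK M i) *m Y *m invmx (gK M i)) KX.
rewrite -scalemxAr -scalemxAl -!mulmxA !mulmxV // !mulmxA mulVmx // mul1mx mulmx1 => ->.
by rewrite scalerA (qpN ax) mulVf ?scale1r // (qp_neq0 ax).
Qed.

Lemma gKE_mx i j : gK M i *m gE M j = qp (car i j) *: (gE M j *m gK M i).
Proof. by have := gKE ax hM i j 1%:M; rewrite !mulmx1. Qed.
Lemma gKF_mx i j : gK M i *m gF M j = qp (- car i j) *: (gF M j *m gK M i).
Proof. by have := gKF ax hM i j 1%:M; rewrite !mulmx1. Qed.
Lemma gKh_mx i j : gK M i *m gh M j = gh M j *m gK M i.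
Proof.
rewrite (gis_qp_comm ax (gm_qp hM i) (c := 0)) ?(qp0 ax) ?scale1r //.
by rewrite (gcst0 ax) scale0r addr0 (gm_hh hM).
Qed.
Lemma gKK_mx i j : gK M i *m gK M j = gK M j *m gK M i.
Proof.
rewrite (gis_qp_comm ax (gm_qp hM i) (c := 0)) ?(qp0 ax) ?scale1r //.
by rewrite (gcst0 ax) scale0r addr0 gKh_mx.
Qed.
Lemma gKP_mx i p : gK M i *m gpar_mx F M p = gpar_mx F M p *m gK M i.
Proof.
case: p; last by rewrite gpar_mxF mul1mx mulmx1.
by have := gKP ax hM i 1%:M; rewrite !mulmx1.
Qed.
Local Notation L i := (invmx (gK M i)).
Lemma gKVE_mx i j : L i *m gE M j = qp (- car i j) *: (gE M j *m L i).
Proof. exact: gKcomm (gKE_mx i j). Qed.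
Lemma gKVF_mx i j : L i *m gF M j = qp (car i j) *: (gF M j *m L i).
Proof. by rewrite (gKcomm (gKF_mx i j)) opprK. Qed.
Lemma gKV_comm i X : gK M i *m X = X *m gK M i -> L i *m X = X *m L i.
Proof. by move=> e; rewrite (gKcomm (c := 0)) ?oppr0 (qp0 ax) ?scale1r. Qed.
Lemma gKVh_mx i j : L i *m gh M j = gh M j *m L i. Proof. exact/gKV_comm/gKh_mx. Qed.
Lemma gKVP_mx i p : L i *m gpar_mx F M p = gpar_mx F M p *m L i. Proof. exact/gKV_comm/gKP_mx. Qed.
Lemma gKVKV_mx i j : L i *m L j = L j *m L i.
Proof. by apply: gKV_comm; symmetry; apply: gKV_comm; exact: gKK_mx. Qed.

Lemma gPE_mx p j : gpar_mx F M p *m gE M j = (-1) ^+ (p && gpar j) *: (gE M j *m gpar_mx F M p).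
Proof. by case: p; rewrite ?(gm_parE hM) // gpar_mxF mul1mx mulmx1 scale1r. Qed.
Lemma gPF_mx p j : gpar_mx F M p *m gF M j = (-1) ^+ (p && gpar j) *: (gF M j *m gpar_mx F M p).
Proof. by case: p; rewrite ?(gm_parF hM) // gpar_mxF mul1mx mulmx1 scale1r. Qed.
Lemma gPh_mx p j : gpar_mx F M p *m gh M j = gh M j *m gpar_mx F M p.
Proof. by case: p; rewrite ?(gm_parh hM) // gpar_mxF mul1mx mulmx1. Qed.

End Commute.

Variables V W : gmod F.
Hypotheses (hV : is_gmod V) (hW : is_gmod W).
Local Notation VW := (gtens V W).
Local Notation Pg i := (gpar_mx F V (gpar i)).
Local Notation L i := (invmx (gK V i)).
Local Notation E0 i := (gE V i *t (1%:M : 'M_(sdim W))).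
Local Notation E1 i := ((L i *m Pg i) *t gE W i).
Local Notation F0 i := (gF V i *t gK W i).
Local Notation F1 i := (Pg i *t gF W i).
Local Notation h0 i := (gh V i *t (1%:M : 'M_(sdim W))).
Local Notation h1 i := ((1%:M : 'M_(sdim V)) *t gh W i).

Lemma cartanC i j : cartan i j = cartan j i.
Proof. by case: (ord2P i) => ->; case: (ord2P j) => ->. Qed.

Lemma gtens_parE i : P VW *m gE VW i = (-1) ^+ gpar i *: (gE VW i *m P VW).
Proof.
rewrite gtensE gpar_tens mulmxDr mulmxDl !tensmx_mul mul1mx mulmx1.
have -> : P V *m (L i *m Pg i) = L i *m Pg i *m P V.
  by rewrite mulmxA -(gKVP_mx hV) -!mulmxA (gpar_mxC V true).
by rewrite (gPE_mx hV) (gPE_mx hW) tensZl tensZr scalerDr.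
Qed.

Lemma gtens_parF i : P VW *m gF VW i = (-1) ^+ gpar i *: (gF VW i *m P VW).
Proof.
rewrite gtensF gpar_tens mulmxDr mulmxDl !tensmx_mul.
by rewrite (gPF_mx hV) (gPF_mx hW) -(gKP_mx hW) (gpar_mxC V true) tensZl tensZr scalerDr.
Qed.

Lemma gtens_parh i : P VW *m gh VW i = gh VW i *m P VW.
Proof.
rewrite gtensh gpar_tens mulmxDr mulmxDl !tensmx_mul.
by rewrite (gPh_mx hV) (gPh_mx hW) !mul1mx !mulmx1.
Qed.

Lemma gtens_hh i j : gh VW i *m gh VW j = gh VW j *m gh VW i.
Proof.
rewrite !gtensh !mulmxDr !mulmxDl !tensmx_mul !mul1mx !mulmx1.
by rewrite (gm_hh hV) (gm_hh hW) addrACA [LHS]addrACA -!addrA; congr (_ + _); rewrite addrCA.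
Qed.

Lemma gtens_hE i j : gh VW i *m gE VW j = gE VW j *m gh VW i + (cartan i j)%:~R *: gE VW j.
Proof.
rewrite gtensh gtensE !mulmxDr !mulmxDl !tensmx_mul !mul1mx !mulmx1.
rewrite (gm_hE hV) (gm_hE hW) !tensDl !tensDr tensZl tensZr mulmxA -(gKVh_mx hV) -!mulmxA -(gPh_mx hV).
rewrite scalerDr; mx_linear; by apply/matrixP => u v; rewrite !mxE; ring.
Qed.

Lemma gtens_hF i j : gh VW i *m gF VW j = gF VW j *m gh VW i - (cartan i j)%:~R *: gF VW j.
Proof.
rewrite gtensh gtensF !mulmxDr !mulmxDl !tensmx_mul !mul1mx !mulmx1.
rewrite (gm_hF hV) (gm_hF hW) !tensDl !tensDr !tensNl !tensNr tensZl tensZr -(gPh_mx hV) (gKh_mx hW).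
rewrite scalerDr; mx_linear; by apply/matrixP => u v; rewrite !mxE; ring.
Qed.

(** The mixed terms supercommute: the sign comes from the parity operator, and the powers of q
    cancel by symmetry of the Cartan matrix. For i = j the other two telescope: (K - K^-1) (x) K +
    K^-1 (x) (K - K^-1) = K (x) K - K^-1 (x) K^-1. *)
Lemma gtens_EF i j : gE VW i *m gF VW j = (-1) ^+ (gpar i && gpar j) *: (gF VW j *m gE VW i)
  + (i == j)%:R *: ((q - q^-1)^-1 *: (gK VW i - invmx (gK VW i))).
Proof.
set s := (-1) ^+ _; set c := (q - q^-1)^-1.
have ss : s * s = 1 by rewrite -expr2 sqrr_sign.
have e1 : E0 i *m F0 j = s *: (F0 j *m E0 i) + (i == j)%:R *: (c *: ((gK V i - L i) *t gK W j)).
  by rewrite !tensmx_mul mul1mx mulmx1 (gm_EF hV) [LHS]tensDl !tensZl.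
have e2 : E0 i *m F1 j = s *: (F1 j *m E0 i).
  by rewrite !tensmx_mul mul1mx mulmx1 (gPE_mx hV) tensZl scalerA andbC ss scale1r.
have e3 : E1 i *m F0 j = s *: (F0 j *m E1 i).
  rewrite !tensmx_mul -!mulmxA (gPF_mx hV) -scalemxAr mulmxA (gKVF_mx hV) -scalemxAl (gKE_mx hW).
  by rewrite !tensZl tensZr cartanC !mulmxA.
have e4 : E1 i *m F1 j = s *: (F1 j *m E1 i)
    + (i == j)%:R *: (c *: ((L i *m Pg i *m Pg j) *t (gK W i - invmx (gK W i)))).
  rewrite !tensmx_mul (gm_EF hW) [LHS]tensDr !tensZr; congr (_ *: (_ *t _) + _).
  by rewrite mulmxA -(gKVP_mx hV) -!mulmxA gpar_mxC.
rewrite gtensE gtensF (gtensKV ax hV hW) gtensK !mulmxDr !mulmxDl e1 e2 e3 e4.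
have [<-|_] := eqVneq i j; last by rewrite !scale0r !addr0 !scalerDr -!addrA [X in _ + X]addrCA.
rewrite -mulmxA gpar_mxK mulmx1 !scale1r tensDl tensDr tensNl tensNr.
by mx_linear; apply/matrixP => u v; rewrite !mxE; ring.
Qed.

(** The mixed terms cancel: a_22 = 0 produces no power of q, and the parity operator anticommutes
    with E_2. *)
Lemma gtens_EE : gE VW i2 *m gE VW i2 = 0.
Proof.
rewrite gtensE mulmxDr !mulmxDl !tensmx_mul !mul1mx !mulmx1 (gm_EE hV) (gm_EE hW).
rewrite tens0mx tensmx0 add0r addr0 -mulmxA (gPE_mx hV) -scalemxAr mulmxA (gKVE_mx hV).
by rewrite oppr0 (qp0 ax) scale1r expr1 scaleN1r tensNl mulmxA addNr.
Qed.

Lemma gtens_FF : gF VW i2 *m gF VW i2 = 0.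
Proof.
rewrite gtensF mulmxDr !mulmxDl !tensmx_mul (gm_FF hV) (gm_FF hW).
rewrite tens0mx tensmx0 add0r addr0 (gKF_mx hW) (gPF_mx hV) oppr0 (qp0 ax) scale1r.
by rewrite expr1 scaleN1r tensNl addNr.
Qed.

Lemma gtens_serreE : gserre q (gE VW i1) (gE VW i2).
Proof.
rewrite !gtensE; apply: gserre_sum; first exact: (qp_neq0 ax).
- rewrite !tensmx_mul gpar_mxF !mulmx1 mul1mx (gKVE_mx hV) tensZl; congr (_ *: _).
  by rewrite -(qpD ax) -(qpN ax).
- by rewrite !tensmx_mul gpar_mxF !mulmx1 mul1mx (gKVE_mx hV) tensZl opprK.
- rewrite !tensmx_mul !mulmx1 mul1mx -mulmxA (gPE_mx hV) scale1r mulmxA (gKVE_mx hV).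
  by rewrite opprK -scalemxAl tensZl mulmxA.
- rewrite /gserre !tensmx_mul !mulmx1 -!tensZl -tensNl -!tensDl.
  by rewrite (gm_serreE hV) tens0mx.
- rewrite /gserre !tensmx_mul gpar_mxF !mulmx1 !mulmxA.
  have -> : L i1 *m L i2 *m Pg i2 *m L i1 = L i1 *m L i1 *m L i2 *m Pg i2.
    by rewrite -[_ *m _ *m L i1]mulmxA -(gKVP_mx hV) mulmxA -[_ *m _ *m L i1]mulmxA (gKVKV_mx hV) mulmxA.
  have -> : L i2 *m Pg i2 *m L i1 *m L i1 = L i1 *m L i1 *m L i2 *m Pg i2.
    have PL : Pg i2 *m L i1 = L i1 *m Pg i2 by rewrite (gKVP_mx hV).
    rewrite -(mulmxA (L i2)) PL mulmxA -(mulmxA (L i2 *m L i1)) PL mulmxA.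
    by rewrite (gKVKV_mx hV i2) -(mulmxA (L i1)) (gKVKV_mx hV i2) mulmxA.
  by rewrite -!tensZr -tensNr -!tensDr (gm_serreE hW) tensmx0.
Qed.

Lemma gserreV (d : nat) (X Y : 'M[F]_d) : gserre q^-1 X Y <-> gserre q X Y.
Proof. by rewrite /gserre invrK [q^-1 + q]addrC. Qed.

(** In the coproduct of the F_i the powers of q come out inverted, so [gserre_sum] is applied at
    q^-1; the Serre relation is the same for q and q^-1. *)
Lemma gtens_serreF : gserre q (gF VW i1) (gF VW i2).
Proof.
apply/gserreV; rewrite !gtensF; apply: gserre_sum; first by rewrite invr_eq0 (qp_neq0 ax).
- rewrite !tensmx_mul gpar_mxF !mulmx1 mul1mx (gKF_mx hW) tensZr scalerA.
  have -> : qp (- car i1 i1) = (q * q)^-1 by rewrite (qpN ax) -(qpD ax).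
  have q0 := qp_neq0 ax 1; rewrite [X in X *: _](_ : _ = 1) ?scale1r //.
  by field; rewrite q0 oner_neq0.
- rewrite !tensmx_mul gpar_mxF !mulmx1 mul1mx (gKF_mx hW) tensZr scalerA opprK.
  by rewrite mulVf ?(qp_neq0 ax) // scale1r.
- rewrite !tensmx_mul (gPF_mx hV) scale1r (gKF_mx hW) tensZr scalerA opprK.
  by rewrite mulVf ?(qp_neq0 ax) // scale1r.
- apply/gserreV; rewrite /gserre !tensmx_mul.
  have -> : gK W i1 *m gK W i2 *m gK W i1 = gK W i1 *m gK W i1 *m gK W i2.
    by rewrite -!mulmxA (gKK_mx hW i2).
  have -> : gK W i2 *m gK W i1 *m gK W i1 = gK W i1 *m gK W i1 *m gK W i2.
    by rewrite (gKK_mx hW i2) -!mulmxA (gKK_mx hW i2).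
  by rewrite -!tensZl -tensNl -!tensDl (gm_serreF hV) tens0mx.
- apply/gserreV; rewrite /gserre !tensmx_mul gpar_mxF !mulmx1 !mul1mx.
  by rewrite -!tensZr -tensNr -!tensDr (gm_serreF hW) tensmx0.
Qed.

Lemma gtens_gmod : is_gmod VW.
Proof.
split; [exact: gtens_parE | exact: gtens_parF | exact: gtens_parh | exact: gtens_qp |
 exact: gtens_hh | exact: gtens_hE | exact: gtens_hF | exact: gtens_EF | exact: gtens_EE |
 exact: gtens_FF | exact: gtens_serreE | exact: gtens_serreF].
Qed.

End TensIsMod.

(** * Direct sums and semisimplicity *)

Definition gsum (F : fieldType) (V W : gmod F) : gmod F :=
  @GMod F (ssum V W)
    (fun i => block_mx (gE V i) 0 0 (gE W i))
    (fun i => block_mx (gF V i) 0 0 (gF W i))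
    (fun i => block_mx (gh V i) 0 0 (gh W i))
    (fun i => block_mx (gK V i) 0 0 (gK W i)).

Definition gtriv (F : fieldType) (T : superspace) : gmod F :=
  @GMod F T (fun=> 0) (fun=> 0) (fun=> 0) (fun=> 1%:M).

Definition gzero (F : fieldType) : gmod F := gtriv F (@SuperSpace 0 (fun=> false)).

Definition gbigsum (F : fieldType) (s : seq (gmod F)) : gmod F :=
  foldr (@gsum F) (gzero F) s.

Section BlockDiag.
Variables (F : fieldType) (m n : nat).
Local Notation D A B := (block_mx (A : 'M[F]_m) 0 0 (B : 'M[F]_n)).

Lemma block_diagM (A A' : 'M[F]_m) (B B' : 'M[F]_n) : D A B *m D A' B' = D (A *m A') (B *m B').
Proof. by rewrite mulmx_block !mulmx0 !mul0mx !addr0 !add0r. Qed.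
Lemma block_diagD (A A' : 'M[F]_m) (B B' : 'M[F]_n) : D A B + D A' B' = D (A + A') (B + B').
Proof. by rewrite add_block_mx !addr0. Qed.
Lemma block_diagN (A : 'M[F]_m) (B : 'M[F]_n) : - D A B = D (- A) (- B).
Proof. by rewrite opp_block_mx !oppr0. Qed.
Lemma block_diagZ k (A : 'M[F]_m) (B : 'M[F]_n) : k *: D A B = D (k *: A) (k *: B).
Proof. by rewrite scale_block_mx !scaler0. Qed.
Lemma block_diag1 : D 1%:M 1%:M = 1%:M. Proof. by rewrite -scalar_mx_block. Qed.
Lemma block_diag0 : D 0 0 = 0. Proof. by rewrite block_mx0. Qed.
Lemma block_diagV (A : 'M[F]_m) (B : 'M[F]_n) : A \in unitmx -> B \in unitmx ->
  D A B \in unitmx /\ invmx (D A B) = D (invmx A) (invmx B).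
Proof.
move=> uA uB; have e : D (invmx A) (invmx B) *m D A B = 1%:M by rewrite block_diagM !mulVmx // block_diag1.
have [_ u] := mulmx1_unit e; split=> //.
by rewrite -[LHS]mul1mx -e -mulmxA mulmxV // mulmx1.
Qed.
End BlockDiag.

Section SumMod.
Variables (C : numFieldType) (F : fieldType) (cst qp : C -> F).
Hypothesis ax : qexp cst qp.
Local Notation q := (qp 1).
Local Notation P M := (gpar_mx F M true).
Local Notation is_gmod := (is_gmod cst qp).
Local Notation ghw := (ghw cst).
Local Notation gwt := (gwt cst).

Lemma gtriv_gmod T : is_gmod (gtriv F T).
Proof.
split=> //= *; rewrite ?mulmx0 ?mul0mx ?scaler0 ?addr0 ?subr0 //.
- exists 1%:M, (fun=> 0); split; first exact: unitmx1.
    rewrite mul0mx mul1mx; apply/matrixP => i j.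
    by rewrite !mxE (gcst0 ax) mul0rn.
  rewrite !mul1mx -diag_const_mx; congr diag_mx.
  by apply/rowP => j; rewrite !mxE (qp0 ax).
- by rewrite invmx1 subrr !scaler0 addr0.
Qed.

Lemma gpar_sum (S S' : superspace) : P (ssum S S') = block_mx (P S) 0 0 (P S').
Proof.
rewrite -diag_mx_row; congr diag_mx; apply/rowP => k; rewrite !mxE /=.
by case: split_ordP => i _; rewrite mxE.
Qed.

Lemma gsum_qp V W i : is_gmod V -> is_gmod W -> gis_qp cst qp (gh (gsum V W) i) (gK (gsum V W) i).
Proof.
move=> hV hW; have [A [a [Au hA KA]]] := gm_qp hV i; have [B [b [Bu hB KB]]] := gm_qp hW i.
have dE (f : C -> F) : diag_mx (\row_j f (match split j with inl j => a j | inr j => b j end))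
   = block_mx (diag_mx (\row_j f (a j))) 0 0 (diag_mx (\row_j f (b j))).
  rewrite -diag_mx_row; congr diag_mx; apply/rowP => k; rewrite !mxE.
  by case: split_ordP => j _; rewrite mxE.
exists (block_mx A 0 0 B), (fun k => match split k with inl j => a j | inr j => b j end); split.
- by case: (block_diagV Au Bu).
- by rewrite (dE cst) /= !block_diagM hA hB.
- by rewrite (dE qp) /= !block_diagM KA KB.
Qed.

Lemma gsum_gmod V W : is_gmod V -> is_gmod W -> is_gmod (gsum V W).
Proof.
move=> hV hW; split.
- by move=> i; rewrite gpar_sum /= !block_diagM (gm_parE hV) (gm_parE hW) block_diagZ.
- by move=> i; rewrite gpar_sum /= !block_diagM (gm_parF hV) (gm_parF hW) block_diagZ.
- by move=> i; rewrite gpar_sum /= !block_diagM (gm_parh hV) (gm_parh hW).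
- by move=> i; apply: gsum_qp.
- by move=> i j; rewrite /= !block_diagM (gm_hh hV) (gm_hh hW).
- by move=> i j; rewrite /= block_diagZ !block_diagM block_diagD (gm_hE hV) (gm_hE hW).
- by move=> i j; rewrite /= block_diagZ !block_diagM block_diagN block_diagD (gm_hF hV) (gm_hF hW).
- move=> i j /=; have [_ ->] := block_diagV (gK_unit ax hV i) (gK_unit ax hW i).
  by rewrite block_diagN block_diagD !block_diagM !block_diagZ block_diagD (gm_EF hV) (gm_EF hW).
- by rewrite /= !block_diagM (gm_EE hV) (gm_EE hW) block_diag0.
- by rewrite /= !block_diagM (gm_FF hV) (gm_FF hW) block_diag0.
- by rewrite /= !block_diagM block_diagZ block_diagN !block_diagD (gm_serreE hV) (gm_serreE hW) block_diag0.
- by rewrite /= !block_diagM block_diagZ block_diagN !block_diagD (gm_serreF hV) (gm_serreF hW) block_diag0.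
Qed.

Lemma gbigsum_gmod (I : eqType) (s : seq I) (A : I -> gmod F) :
  (forall i, is_gmod (A i)) -> is_gmod (gbigsum (map A s)).
Proof.
move=> hA; elim: s => [|i s IHs]; first exact: gtriv_gmod.
exact: gsum_gmod.
Qed.

(** * Existence of highest weight vectors *)

Section Existence.
Variable M : gmod F.
Hypothesis hM : is_gmod M.

(** The product of h_i - c over all eigenvalues c is zero. Applying its factors to u one at a time,
    the last nonzero vector is an eigenvector, and S holds along the way. *)
Lemma stable_eigenvector i (S : 'cV[F]_(sdim M) -> Prop) u :
  (forall u c, S u -> S (gh M i *m u - cst c *: u)) -> S u -> u != 0 ->
  exists w c, [/\ S w, w != 0 & gh M i *m w = cst c *: w].
Proof.
move=> Sh Su u0; have [A [a [Au hA _]]] := gm_qp hM i.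
pose T (c : C) w : 'cV_(sdim M) := gh M i *m w - cst c *: w.
have Tz s y : foldr T (A *m y) s = A *m (\col_k (\prod_(c <- s) (cst (a k) - cst c) * y k 0)).
  elim: s => [|c s IHs] /=.
    by congr (_ *m _); apply/colP => k; rewrite mxE big_nil mul1r.
  rewrite IHs /T mulmxA hA -mulmxA scalemxAr -mulmxBr; congr (_ *m _).
  by apply/colP => k; rewrite mul_diag_mx !mxE big_cons; ring.
have : foldr T u [seq a k | k <- enum 'I_(sdim M)] = 0.
  rewrite -[u](mul1mx _) -(mulmxV Au) -mulmxA Tz -[RHS](mulmx0 _ A); congr (_ *m _).
  apply/colP => k; rewrite [LHS]mxE [RHS]mxE (_ : \prod_(c <- _) _ = 0) ?mul0r //.
  apply/eqP; rewrite prodf_seq_eq0; apply/hasP; exists (a k); last by rewrite /= subrr.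
  by apply: map_f; rewrite mem_enum.
move: [seq a k | k <- enum 'I_(sdim M)] => s.
elim: s u u0 Su => [|c s IHs] u u0 Su /=; first by move=> e; rewrite e eqxx in u0.
have [e _|n] := eqVneq (foldr T u s) 0; first exact: (IHs u u0 Su e).
move=> Tc; exists (foldr T u s), c; split=> //; last by apply/eqP; rewrite -subr_eq0 -/(T _ _) Tc.
by elim: (s) => //= d t; exact: Sh.
Qed.

(** S first yields a common eigenvector of h_1 and h_2. Were there no highest weight vector in S,
    E_1 or E_2 could be applied forever without reaching 0. *)
Lemma stable_hw (S : 'cV[F]_(sdim M) -> Prop) u :
  (forall u w, S u -> S w -> S (u + w)) -> (forall u c, S u -> S (c *: u)) ->
  (forall u i, S u -> S (gE M i *m u)) -> (forall u i, S u -> S (gh M i *m u)) ->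
  S u -> u != 0 -> exists w a b, S w /\ ghw a b w.
Proof.
move=> SD SZ SE Sh Su u0.
have Shc (w : 'cV_(sdim M)) i c : S w -> S (gh M i *m w - cst c *: w).
  by move=> Sw; apply: SD; [exact: Sh | rewrite -scaleNr; exact: SZ].
have [w1 [a [Sw1 w10 h1]]] := stable_eigenvector (fun u c => @Shc u i1 c) Su u0.
pose S1 (w : 'cV_(sdim M)) := S w /\ gh M i1 *m w = cst a *: w.
have S1h (w : 'cV_(sdim M)) c : S1 w -> S1 (gh M i2 *m w - cst c *: w).
  case=> Sw hw; split; first exact: Shc.
  rewrite mulmxBr -scalemxAr hw mulmxA (gm_hh hM) -mulmxA hw -scalemxAr scalerBr.
  by rewrite !scalerA [cst c * _]mulrC.
have [w [b [[Sw h1w] w0 h2w]]] := stable_eigenvector S1h (conj Sw1 h1) w10.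
apply: contrapT => nhw.
(* E_1 and E_2 raise the eigenvalue of - h_1 - 3 h_2 by 1. *)
have chain k : exists w : 'cV_(sdim M), exists a' b', [/\ S w, w != 0, gwt a' b' w
    & - a' - 3 * b' = - a - 3 * b + k%:R * 1].
  elim: k => [|k [w' [a' [b' [Sw' w'0 ww' e]]]]].
    by exists w, a, b; split=> //; rewrite mul0r addr0.
  have ek : - a - 3 * b + k.+1%:R * 1 = - a - 3 * b + k%:R * 1 + 1 by rewrite -(natr1 k); ring.
  have [E0|] := pselect (forall i, gE M i *m w' = 0).
    by case: nhw; exists w', a', b'.
  move/existsNP => [i /eqP Ei]; case: (ord2P i) Ei => -> Ei.
    exists (gE M i1 *m w'), (a' + 2), (b' - 1); split=> //; [exact: SE | exact: (gwtE1 ax hM) |].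
    by rewrite ek -e; ring.
  exists (gE M i2 *m w'), (a' - 1), b'; split=> //; [exact: SE | exact: (gwtE2 ax hM) |].
  by rewrite ek -e; ring.
have [f fP] := choice chain.
have [||k /eqP] := @ex_zero_eigenvector _ _ _ _ _ (- gh M i1 - 3 *: gh M i2) (- a - 3 * b) 1 f ax.
- exact: oner_neq0.
- move=> k; have [a' [b' [_ _ [e1 e2] <-]]] := fP k.
  rewrite mulmxBl mulNmx -scalemxAl e1 e2 (qcstD ax) !(gcstN ax) scalerBl scaleNr.
  rewrite scalerA; congr (- _ - _ *: _).
  have -> : 3 * b' = b' + b' + b' by ring.
  by rewrite !(qcstD ax); ring.
by have [a' [b' [_ /negPf-> _ _]]] := fP k.
Qed.

End Existence.

Definition ghom (V M : gmod F) (Phi : 'M[F]_(sdim M, sdim V)) : Prop :=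
  [/\ Phi *m P V = P M *m Phi, forall i, Phi *m gE V i = gE M i *m Phi,
      forall i, Phi *m gF V i = gF M i *m Phi & forall i, Phi *m gh V i = gh M i *m Phi].

Lemma ghom_inj (V M : gmod F) (Phi : 'M[F]_(sdim M, sdim V)) : is_gmod V -> ghom Phi ->
  (forall a b (u : 'cV_(sdim V)), ghw a b u -> Phi *m u != 0) ->
  forall u : 'cV_(sdim V), Phi *m u = 0 -> u = 0.
Proof.
move=> hV [_ hE _ hh] hhw u Pu; apply/eqP/negP => /negP u0.
pose S (w : 'cV[F]_(sdim V)) := Phi *m w = 0.
have SD x y : S x -> S y -> S (x + y) by rewrite /S mulmxDr => -> ->; rewrite addr0.
have SZ x c : S x -> S (c *: x) by rewrite /S -scalemxAr => ->; rewrite scaler0.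
have SE x i : S x -> S (gE V i *m x) by rewrite /S mulmxA hE -mulmxA => ->; rewrite mulmx0.
have Sh x i : S x -> S (gh V i *m x) by rewrite /S mulmxA hh -mulmxA => ->; rewrite mulmx0.
have [w [a [b [Pw]]]] := stable_hw hV SD SZ SE Sh Pu u0.
by move/hhw; rewrite Pw eqxx.
Qed.

Lemma gwt_colP (V W : gmod F) a b (u : 'cV[F]_(sdim V)) (w : 'cV[F]_(sdim W)) :
  gwt (M := gsum V W) a b (col_mx u w) <-> gwt a b u /\ gwt a b w.
Proof.
rewrite /gwt /= !mul_block_col !mul0mx !addr0 !add0r !scale_col_mx.
by split=> [[/eq_col_mx[-> ->] /eq_col_mx[-> ->]]|[[-> ->] [-> ->]]].
Qed.

Lemma gE_colP (V W : gmod F) i (u : 'cV[F]_(sdim V)) (w : 'cV[F]_(sdim W)) :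
  gE (gsum V W) i *m (col_mx u w) = 0 <-> gE V i *m u = 0 /\ gE W i *m w = 0.
Proof.
rewrite /= !mul_block_col !mul0mx !addr0 !add0r -col_mx0.
by split=> [/eq_col_mx[-> ->]|[-> ->]].
Qed.

(** The nonzero components of a highest weight vector of the sum are highest weight vectors of one
    weight, and by hypothesis this weight occurs in a single summand. The second conclusion records
    which summand, for the induction. *)
Lemma ghom_bigsum (I : eqType) (s : seq I) (A : I -> gmod F) (M : gmod F)
    (Th : forall i, 'M[F]_(sdim M, sdim (A i))) : uniq s ->
  (forall i, i \in s -> ghom (Th i)) ->
  (forall i a b (u : 'cV_(sdim (A i))), i \in s -> ghw a b u -> Th i *m u != 0) ->
  (forall i j a b (u : 'cV_(sdim (A i))) (w : 'cV_(sdim (A j))), i \in s -> j \in s ->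
     ghw a b u -> ghw a b w -> i = j) ->
  exists Phi : 'M[F]_(sdim M, sdim (gbigsum (map A s))),
    ghom Phi /\ forall a b (u : 'cV_(sdim (gbigsum (map A s)))), ghw a b u ->
       Phi *m u != 0 /\ exists i, i \in s /\ exists w : 'cV_(sdim (A i)), ghw a b w.
Proof.
elim: s => [_ _ _ _|i s IHs /= /andP[nis us] hh hinj hdis].
  exists 0; split; first by split=> *; rewrite ?mul0mx ?mulmx0.
  by move=> a b u []; rewrite [u]flatmx0 eqxx.
have [|||Phi [hPhi Phw]] := IHs us.
- by move=> j js; apply: hh; rewrite inE js orbT.
- by move=> j a b u js; apply: hinj; rewrite inE js orbT.
- by move=> j k a b u w js ks; apply: hdis; rewrite inE (js, ks) orbT.
have [hP hE hF hH] := hPhi; have [|tP tE tF tH] := hh i; first exact: mem_head.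
exists (row_mx (Th i) Phi); split.
  split=> [|j|j|j] /=; rewrite ?gpar_sum mul_row_block !mulmx0 addr0 add0r mul_mx_row.
  - by rewrite tP hP.
  - by rewrite tE hE.
  - by rewrite tF hF.
  - by rewrite tH hH.
move=> a b u [u0 wu Eu]; rewrite -[u]vsubmxK in u0 wu Eu *.
set u1 := usubmx _ in u0 wu Eu *; set u2 := dsubmx _ in u0 wu Eu *.
have [wu1 wu2] := (gwt_colP a b u1 u2).1 wu.
have Eu1 j : gE (A i) j *m u1 = 0 by have [] := (gE_colP j u1 u2).1 (Eu j).
have Eu2 j : gE (gbigsum (map A s)) j *m u2 = 0 by have [] := (gE_colP j u1 u2).1 (Eu j).
rewrite mul_row_col; have [z1|n1] := eqVneq u1 0.
  have n2 : u2 != 0 by apply: contraNneq u0 => z2; rewrite z1 z2 col_mx0.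
  have [Pn [j [js [w hw]]]] := Phw a b u2 (And3 n2 wu2 Eu2).
  rewrite z1 mulmx0 add0r; split=> //; exists j; split; last by exists w.
  by rewrite inE js orbT.
have h1 : ghw a b u1 by split.
have [z2|n2] := eqVneq u2 0.
  rewrite z2 mulmx0 addr0; split; first by apply: hinj h1; exact: mem_head.
  by exists i; split; [exact: mem_head | exists u1].
have [_ [j [js [w hw]]]] := Phw a b u2 (And3 n2 wu2 Eu2).
have eij : i = j by apply: (hdis i j a b u1 w) => //; rewrite inE ?eqxx ?js ?orbT.
by rewrite eij js in nis.
Qed.

End SumMod.

(** * Multiplicity spaces *)

Section TensVec.
Variables (F : fieldType) (m n : nat).

(* [lten t] is the map [w |-> t (x) w] and [rten w] is the map [t |-> t (x) w]. *)
Definition lten (t : 'cV[F]_m) : 'M[F]_(m * n, n) :=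
  \matrix_(k, j) (t (mxtens_unindex k).1 0 * ((mxtens_unindex k).2 == j)%:R).
Definition rten (w : 'cV[F]_n) : 'M[F]_(m * n, m) :=
  \matrix_(k, i) (((mxtens_unindex k).1 == i)%:R * w (mxtens_unindex k).2 0).

Lemma sum_delta_r p (f : 'I_p -> F) j : \sum_k f k * (k == j)%:R = f j.
Proof.
rewrite (bigD1 j) //= eqxx mulr1 big1 ?addr0 // => i /negPf->.
by rewrite mulr0.
Qed.
Lemma sum_delta_l p (f : 'I_p -> F) j : \sum_k (j == k)%:R * f k = f j.
Proof. by rewrite -[RHS]sum_delta_r; apply: eq_bigr => k _; rewrite mulrC eq_sym. Qed.

Lemma tens_lten (A : 'M[F]_m) (B : 'M[F]_n) t : (A *t B) *m lten t = lten (A *m t) *m B.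
Proof.
apply/matrixP => k j; rewrite [RHS]mxE.
under [RHS]eq_bigr => l _ do rewrite mxE -mulrA.
rewrite -mulr_sumr sum_delta_l mxE.
rewrite -[B _ j]sum_delta_r mxE mulr_sum; apply: eq_bigr => l _.
by rewrite !mxE mulrACA.
Qed.

Lemma tens_rten (A : 'M[F]_m) (B : 'M[F]_n) w : (A *t B) *m rten w = rten (B *m w) *m A.
Proof.
apply/matrixP => k j; rewrite [RHS]mxE.
under [RHS]eq_bigr => l _ do rewrite mxE mulrAC.
rewrite -mulr_suml sum_delta_l mxE.
rewrite -[A _ j]sum_delta_r mxE mulr_sum; apply: eq_bigr => l _.
by rewrite !mxE mulrACA.
Qed.

Lemma lten_rten t w : lten t *m w = rten w *m t.
Proof.
apply/colP => k; rewrite !mxE.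
under eq_bigr => l _ do rewrite mxE -mulrA.
under [RHS]eq_bigr => l _ do rewrite mxE mulrAC.
by rewrite -mulr_sumr -mulr_suml !sum_delta_l.
Qed.

Lemma rtenZ c w : rten (c *: w) = c *: rten w.
Proof. by apply/matrixP => k j; rewrite !mxE mulrCA. Qed.
Lemma rten0 : rten 0 = 0.
Proof. by apply/matrixP => k j; rewrite !mxE mulr0. Qed.
Lemma ltenZ c t : lten (c *: t) = c *: lten t.
Proof. by apply/matrixP => k j; rewrite !mxE mulrA. Qed.

(** The component along the t-th basis vector of the left factor. *)
Definition lcontr (t : 'I_m) : 'M[F]_(n, m * n) := (lten (delta_mx t 0))^T.

Lemma lcontrE t j k : lcontr t j k = ((mxtens_unindex k).1 == t)%:R * ((mxtens_unindex k).2 == j)%:R.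
Proof. by rewrite !mxE eqxx andbT. Qed.

Lemma lcontr_tens t (d : 'rV[F]_m) (B : 'M[F]_n) :
  lcontr t *m (diag_mx d *t B) = d 0 t *: (B *m lcontr t).
Proof.
rewrite /lcontr -[_ *t _]trmxK -trmx_mul trmx_tens tr_diag_mx tens_lten.
have -> : diag_mx d *m delta_mx t 0 = d 0 t *: (delta_mx t 0 : 'cV_m).
  apply/colP => i; rewrite mul_diag_mx !mxE.
  by have [->|] := eqVneq i t; rewrite ?mulr1 // !mulr0.
by rewrite ltenZ -scalemxAl linearZ /= trmx_mul trmxK.
Qed.

Lemma lcontr_sum (u : 'cV[F]_(m * n)) : u = \sum_t lten (delta_mx t 0) *m (lcontr t *m u).
Proof.
apply/colP => k; rewrite summxE.
under eq_bigr => t _.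
  rewrite mxE.
  under eq_bigr => j _.
    rewrite mxE mxE eqxx andbT mxE; over.
  under eq_bigr => j _ do rewrite -mulrA.
  rewrite -mulr_sumr sum_delta_l; over.
rewrite /= sum_delta_l; rewrite (bigD1 k) //= big1 => [|l lk].
  by rewrite addr0 lcontrE !eqxx !mul1r.
rewrite lcontrE -natrM mulnb -xpair_eqE -!surjective_pairing.
by rewrite (inj_eq (can_inj (@mxtens_unindexK m n))) (negPf lk) mul0r.
Qed.

(** The map that is [phi t] on the copy e_t (x) - of the right factor. *)
Definition lglue d (phi : 'I_m -> 'M[F]_(d, n)) : 'M[F]_(d, m * n) :=
  \matrix_(r, k) phi (mxtens_unindex k).1 r (mxtens_unindex k).2.

Lemma lglueE d (phi : 'I_m -> 'M[F]_(d, n)) t : lglue phi *m lten (delta_mx t 0) = phi t.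
Proof.
apply/matrixP => r j; rewrite mxE (bigD1 (mxtens_index (t, j))) // big1 => [|k nk].
  by rewrite !mxE mxtens_indexK !eqxx !mulr1; exact: addr0.
rewrite !mxE eqxx andbT -natrM mulnb -xpair_eqE -surjective_pairing.
by rewrite -(inj_eq (can_inj (@mxtens_indexK m n))) mxtens_unindexK (negPf nk) mulr0.
Qed.

Lemma lten_ext d (A B : 'M[F]_(d, m * n)) :
  (forall t, A *m lten (delta_mx t 0) = B *m lten (delta_mx t 0)) -> A = B.
Proof.
move=> AB; apply/matrixP => r k; rewrite -[k]mxtens_unindexK.
have E (D : 'M[F]_(d, m * n)) t j : (D *m lten (delta_mx t 0)) r j = D r (mxtens_index (t, j)).
  rewrite mxE (bigD1 (mxtens_index (t, j))) // big1 => [|l nl].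
    by rewrite !mxE mxtens_indexK !eqxx !mulr1; exact: addr0.
  rewrite !mxE eqxx andbT -natrM mulnb -xpair_eqE -surjective_pairing.
  by rewrite -(inj_eq (can_inj (@mxtens_indexK m n))) mxtens_unindexK (negPf nl) mulr0.
by case: (mxtens_unindex k) => t j; rewrite -!E AB.
Qed.

End TensVec.

(** * Homomorphisms out of typical modules *)

Section Homs.
Variables (C : numFieldType) (F : fieldType) (cst qp : C -> F).
Hypothesis ax : qexp cst qp.
Local Notation q := (qp 1).
Local Notation P M := (gpar_mx F M true).
Local Notation is_gmod := (is_gmod cst qp).
Local Notation ghw := (ghw cst).
Local Notation gwt := (gwt cst).

(* The conditions on b amount to [b] != 0 and [x + b + 1] != 0 for quantum integers. *)
Definition typical (V : gmod F) x b v (p : bool) : Prop :=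
  [/\ is_gmod V, gsimple V, ghw (M := V) x%:R b v & P V *m v = (-1) ^+ p *: v] /\
  (b != 0 /\ x%:R + b + 1 != 0).

Definition fam_odd k := match k with 1 | 2 => true | _ => false end%N.

Lemma fam_parity (M : gmod F) (w : 'cV_(sdim M)) s k i : is_gmod M ->
  P M *m w = s *: w -> (k < 4)%N ->
  P M *m fam w k i = ((-1) ^+ fam_odd k * s) *: fam w k i.
Proof.
move=> hM Pw; have Pf0 j : P M *m F1k j w = s *: F1k j w.
  by elim: j => //= j IHj; rewrite (gPF1 hM) IHj -scalemxAr.
case: k => [|[|[|[|//]]]] _; rewrite /fam ?(gPF2 hM, gPF1 hM, mulmxN) Pf0 -?scalemxAr.
- by rewrite mul1r.
- by rewrite expr1 mulN1r scaleNr.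
- by rewrite expr1 mulN1r scaleNr.
- by rewrite opprK mul1r.
Qed.

Section Hom.
Variables (V M : gmod F) (x : nat) (b : C) (v : 'cV[F]_(sdim V)) (w : 'cV[F]_(sdim M)) (p : bool).
Hypotheses (tV : typical x b v p) (hM : is_gmod M).
Hypotheses (ww : gwt x%:R b w) (Ew : forall i, gE M i *m w = 0).

Let hV : is_gmod V. Proof. by case: tV => -[]. Qed.
Let wv : gwt x%:R b v. Proof. by case: tV => -[_ _ []]. Qed.
Let Ev i : gE V i *m v = 0. Proof. by case: tV => -[_ _ []]. Qed.

(** The family of v is a basis of V, so some matrix sends it to the family of w. The generators act
    on both by the same formulas, whose coefficients depend only on the weight. The sign accounts
    for v and w having possibly different parities. *)
Lemma hom_exists : exists phi : 'M[F]_(sdim M, sdim V),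
  [/\ phi *m v = w, forall i, phi *m gE V i = gE M i *m phi,
      forall i, phi *m gF V i = gF M i *m phi & forall i, phi *m gh V i = gh M i *m phi] /\
  forall p' : bool, P M *m w = (-1) ^+ p' *: w ->
    phi *m P V = (-1) ^+ (p (+) p') *: (P M *m phi).
Proof.
case: tV => -[_ sV hv Pv] [b0 xb0].
have [D [BD DB]] := typical_inv ax hV sV hv Pv b0 xb0.
pose phi := famx w x *m D.
have phiB : phi *m famx v x = famx w x by rewrite -mulmxA DB mulmx1.
clearbody phi.
have phif k i : (k < 4)%N -> phi *m fam v k i = fam w k i.
  move=> lk; have [le_ix|lt_xi] := leqP i x; last first.
    rewrite (fam_eq0 ax hM ww Ew erefl) // (fam_eq0 ax hV wv Ev erefl) //.
    by rewrite mulmx0.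
  pose d : 'cV[F]_(4 * x.+1) := delta_mx (mxtens_index (Ordinal lk, inord i)) 0.
  have : phi *m famx v x *m d = famx w x *m d by rewrite phiB.
  by rewrite -mulmxA !famx_index inordK.
have ext (A A' : 'M[F]_(sdim M, sdim V)) :
    (forall k i, (k < 4)%N -> A *m fam v k i = A' *m fam v k i) -> A = A'.
  move=> e; rewrite -[A]mulmx1 -[A']mulmx1 -BD !mulmxA; congr (_ *m _).
  by rewrite !mul_cols; apply/eq_cols => k; exact: e.
exists phi; split; first split.
- exact: (phif 0 0).
- move=> j; apply: ext => k i lk; rewrite -!mulmxA (phif k i lk).
  case: (ord2P j) k lk => -> [|[|[|[|//]]]] _.
  + by rewrite (famE1_0 ax hM ww Ew) (famE1_0 ax hV wv Ev) -scalemxAr phif.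
  + by rewrite (famE1_1 ax hM ww Ew) (famE1_1 ax hV wv Ev) -scalemxAr phif.
  + by rewrite (famE1_2 ax hM ww Ew) (famE1_2 ax hV wv Ev) mulmxDr -!scalemxAr !phif.
  + by rewrite (famE1_3 ax hM ww Ew) (famE1_3 ax hV wv Ev) -scalemxAr phif.
  + by rewrite (famE2_0 hM Ew) (famE2_0 hV Ev) mulmx0.
  + by rewrite (famE2_1 ax hM ww Ew) (famE2_1 ax hV wv Ev) -scalemxAr phif.
  + by rewrite (famE2_2 ax hM ww Ew) (famE2_2 ax hV wv Ev) -scalemxAr phif.
  + by rewrite (famE2_3 ax hM ww Ew) (famE2_3 ax hV wv Ev) mulmxBr -!scalemxAr !phif.
- move=> j; apply: ext => k i lk; rewrite -!mulmxA (phif k i lk).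
  case: (ord2P j) k lk => -> [|[|[|[|//]]]] _.
  + by rewrite !famF1_0 phif.
  + by rewrite !famF1_1 phif.
  + by rewrite (famF1_2 hM) (famF1_2 hV) mulmxBr -scalemxAr !phif.
  + by rewrite (famF1_3 ax hM) (famF1_3 ax hV) phif.
  + by rewrite !famF2_0 phif.
  + by rewrite (famF2_1 hM) (famF2_1 hV) mulmx0.
  + by rewrite !famF2_2 phif.
  + by rewrite (famF2_3 hM) (famF2_3 hV) mulmx0.
- move=> j; apply: ext => k i lk; rewrite -!mulmxA (phif k i lk).
  have [e1 e2] := gwt_fam ax hM ww k i; have [e3 e4] := gwt_fam ax hV wv k i.
  by case: (ord2P j) => ->; rewrite ?e1 ?e2 ?e3 ?e4 -scalemxAr phif.
move=> p' Pw; apply: ext => k i lk.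
rewrite -scalemxAl -!mulmxA (phif k i lk) (fam_parity i hM Pw lk) (fam_parity i hV Pv lk).
rewrite -scalemxAr phif // scalerA; congr (_ *: _).
by rewrite signr_addb -mulrA [_ ^+ p' * _]mulrCA -expr2 sqrr_sign mulr1 mulrC.
Qed.

End Hom.

Lemma gtrivE (T : superspace) (V : gmod F) i :
  gE (gtens (gtriv F T) V) i = gpar_mx F T (gpar i) *t gE V i.
Proof. by rewrite /= mul0mx tens0mx add0r invmx1 mul1mx. Qed.
Lemma gtrivF (T : superspace) (V : gmod F) i :
  gF (gtens (gtriv F T) V) i = gpar_mx F T (gpar i) *t gF V i.
Proof. by rewrite /= mul0mx tens0mx add0r mul1mx. Qed.
Lemma gtrivh (T : superspace) (V : gmod F) i :
  gh (gtens (gtriv F T) V) i = 1%:M *t gh V i.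
Proof. by rewrite /= mul0mx tens0mx add0r gpar_mxF mul1mx. Qed.

(** Each component of u along a basis vector of T is zero or a highest weight vector of V, hence a
    multiple of v, so that u = c (x) v. *)
Lemma gtriv_tens_hw (T : superspace) V x b v p a' b' u : typical (V := V) x b v p ->
  ghw (M := gtens (gtriv F T) V) a' b' u ->
  [/\ a' = x%:R, b' = b & exists c, u = rten (sdim T) v *m c].
Proof.
move=> tV [u0 [u1 u2] Eu]; have [[hV sV hv Pv] [b0 xb0]] := tV.
rewrite gtrivh in u1; rewrite gtrivh in u2.
pose w t := lcontr F (sdim V) t *m u.
have wt t : gwt a' b' (w t).
  have e X : lcontr F (sdim V) t *m ((1%:M : 'M_(sdim T)) *t X) = X *m lcontr F (sdim V) t.
    by rewrite -diag_const_mx lcontr_tens mxE scale1r.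
  by split; rewrite mulmxA -e -mulmxA ?u1 ?u2 -scalemxAr.
have Ew t i : gE V i *m w t = 0.
  have := congr1 (mulmx (lcontr F (sdim V) t)) (Eu i).
  rewrite gtrivE mulmx0 mulmxA lcontr_tens -scalemxAl => /eqP.
  by rewrite scaler_eq0 mxE signr_eq0 /= -mulmxA => /eqP.
have us : u = \sum_t lten (sdim V) (delta_mx t 0) *m w t := lcontr_sum u.
clearbody w.
have uniq t : w t != 0 -> [/\ a' = x%:R, b' = b & exists c, w t = c *: v].
  by move=> wt0; apply: (typical_hw_unique ax hV sV hv Pv b0 xb0).
have [t wt0] : exists t, w t != 0.
  apply: contrapT => /forallNP nw; case/eqP: u0; rewrite us big1 // => t _.
  by have := nw t; move/negP; rewrite negbK => /eqP ->; rewrite mulmx0.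
have [ea eb _] := uniq t wt0; split=> //.
have cs t' : exists c, w t' = c *: v.
  have [->|/uniq[]//] := eqVneq (w t') 0; by exists 0; rewrite scale0r.
have [c cE] := choice cs; exists (\col_t c t).
rewrite us; have -> : \col_t c t = \sum_t c t *: delta_mx t 0.
  by rewrite [LHS]matrix_sum_delta; apply: eq_bigr => k _; rewrite big_ord1 mxE.
rewrite mulmx_sumr; apply: eq_bigr => k _.
by rewrite cE -scalemxAr lten_rten scalemxAr.
Qed.

(** The map is e_t (x) y |-> phi_t (Q y), where phi_t sends v to the t-th column of H. E_i acts on T
    (x) V with the parity operator of T in front, and the twist Q undoes this sign; the parity given
    to T makes the map even. A highest weight vector c (x) v goes to H c up to sign, whence
    nonvanishing. *)
Lemma glue_hom (V M : gmod F) x b v (p p' : bool) (T : superspace) (H : 'M[F]_(sdim M, sdim T)) :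
  typical (V := V) x b v p -> is_gmod M ->
  gwt x%:R b H -> (forall i, gE M i *m H = 0) -> P M *m H = (-1) ^+ p' *: H ->
  (forall t, @spar T t = p (+) p') -> (forall c : 'cV_(sdim T), H *m c = 0 -> c = 0) ->
  exists Th : 'M[F]_(sdim M, sdim (gtens (gtriv F T) V)), ghom Th /\
    forall a' b' u, ghw a' b' u -> Th *m u != 0.
Proof.
move=> tV hM [H1 H2] EH PH Tp Hinj; have [[hV sV hv Pv] [b0 xb0]] := tV.
pose w t : 'cV_(sdim M) := H *m delta_mx t 0.
have ww t : gwt x%:R b (w t) by split; rewrite mulmxA ?H1 ?H2 -scalemxAl.
have Ew t i : gE M i *m w t = 0 by rewrite mulmxA EH mul0mx.
have Pw t : P M *m w t = (-1) ^+ p' *: w t by rewrite mulmxA PH -scalemxAl.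
have [phi phiP] := choice (fun t => hom_exists tV hM (ww t) (Ew t)).
pose Q := gpar_mx F V (p (+) p').
pose Th : 'M[F]_(sdim M, sdim (gtens (gtriv F T) V)) := lglue (fun t => phi t *m Q).
have ThL t : Th *m lten _ (delta_mx t 0) = phi t *m Q by exact: lglueE.
have TP pp : gpar_mx F T pp = ((-1) ^+ (pp && (p (+) p')))%:M.
  by rewrite -diag_const_mx; congr diag_mx; apply/rowP => t; rewrite !mxE Tp.
exists Th; split.
  split=> [|i|i|i]; apply: lten_ext => t.
  - rewrite gpar_tens -[RHS]mulmxA ThL -mulmxA tens_lten TP mul_scalar_mx ltenZ -scalemxAl.
    rewrite -scalemxAr [Th *m (_ *m _)]mulmxA ThL andTb -mulmxA (gpar_mxC F V) (mulmxA (phi t)).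
    have [_ /(_ _ (Pw t)) ->] := phiP t.
    by rewrite -scalemxAl scalerA -expr2 sqrr_sign scale1r mulmxA.
  - rewrite gtrivE -[RHS]mulmxA ThL -mulmxA tens_lten TP mul_scalar_mx ltenZ -scalemxAl.
    rewrite -scalemxAr [Th *m (_ *m _)]mulmxA ThL -mulmxA (gPE_mx hV) -scalemxAr scalerA.
    rewrite andbC -expr2 sqrr_sign scale1r !mulmxA.
    by have [[_ -> _ _] _] := phiP t.
  - rewrite gtrivF -[RHS]mulmxA ThL -mulmxA tens_lten TP mul_scalar_mx ltenZ -scalemxAl.
    rewrite -scalemxAr [Th *m (_ *m _)]mulmxA ThL -mulmxA (gPF_mx hV) -scalemxAr scalerA.
    rewrite andbC -expr2 sqrr_sign scale1r !mulmxA.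
    by have [[_ _ -> _] _] := phiP t.
  - rewrite gtrivh -[RHS]mulmxA ThL -mulmxA tens_lten mul1mx [Th *m (_ *m _)]mulmxA ThL -mulmxA (gPh_mx hV)
      !mulmxA.
    by have [[_ _ _ ->] _] := phiP t.
move=> a' b' u hu; have [_ _ [c uc]] := gtriv_tens_hw tV hu.
have Qv : Q *m v = (-1) ^+ ((p (+) p') && p) *: v.
  by rewrite /Q; case: (p (+) p'); rewrite ?Pv // gpar_mxF mul1mx scale1r.
have Thv : Th *m rten (sdim T) v = (-1) ^+ ((p (+) p') && p) *: H.
  apply/matrixP => r t; have e : Th *m rten (sdim T) v *m delta_mx t 0 =
      (-1) ^+ ((p (+) p') && p) *: H *m (delta_mx t 0 : 'cV_(sdim T)).
    rewrite -mulmxA -lten_rten mulmxA ThL -mulmxA Qv -scalemxAr -scalemxAl.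
    by have [[-> _ _ _] _] := phiP t.
  by move/colP/(_ r): e; rewrite -!colE !mxE.
apply: contraTneq isT => Tu; case: hu => /eqP[]; rewrite uc.
move: Tu; rewrite uc mulmxA Thv -scalemxAl => /eqP; rewrite scaler_eq0 signr_eq0 /= => /eqP/Hinj ->.
by rewrite mulmx0.
Qed.

(** * Multiplicities as dimensions of spaces of highest weight vectors *)

Section Multiplicity.

(** The columns of [B] form a basis of the space made of 0 and the highest weight vectors of weight
    (a, b). In this relational form, bases are transported through sums and isomorphisms. *)
Definition gmult (M : gmod F) a b n : Prop := exists B : 'M[F]_(sdim M, n),
  [/\ forall c : 'cV_n, B *m c = 0 -> c = 0, gwt a b B, forall i, gE M i *m B = 0
    & forall u : 'cV_(sdim M), gwt a b u -> (forall i, gE M i *m u = 0) -> exists c, u = B *m c].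

Lemma cols_in_span d n n' (B : 'M[F]_(d, n)) (B' : 'M[F]_(d, n')) :
  (forall k : 'I_n', exists c, B' *m (delta_mx k 0 : 'cV_n') = B *m c) -> exists Y, B' = B *m Y.
Proof.
move=> /(fin_all_exists (U := fun _ => 'cV[F]_n))[f Af]; exists (cols f).
by apply/matrixP => r k; have /colP/(_ r) := Af k; rewrite mul_cols -colE !mxE.
Qed.

Lemma inj_mulmx1 d n (B : 'M[F]_(d, n)) (Y : 'M_n) : (forall c : 'cV_n, B *m c = 0 -> c = 0) ->
  B *m Y = B -> Y = 1%:M.
Proof.
move=> Binj BY; apply/eqP; rewrite -subr_eq0; apply/eqP/matrixP => i j.
have := Binj ((Y - 1%:M) *m delta_mx j 0).
rewrite mulmxA mulmxBr BY mulmx1 subrr mul0mx => /(_ erefl)/colP/(_ i).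
by rewrite -colE !mxE.
Qed.

Lemma gmult_uniq (M : gmod F) a b n n' : gmult M a b n -> gmult M a b n' -> n = n'.
Proof.
have key m m' : gmult M a b m -> gmult M a b m' -> (m <= m')%N.
  move=> [B [Bi Bw BE Bs]] [B' [Bi' Bw' BE' Bs']].
  have [Y BY] : exists Y, B' = B *m Y.
    apply: cols_in_span => k; apply: Bs => [|i]; last by rewrite mulmxA BE' mul0mx.
    by case: Bw' => e1 e2; split; rewrite mulmxA ?e1 ?e2 -scalemxAl.
  have [Z BZ] : exists Z, B = B' *m Z.
    apply: cols_in_span => k; apply: Bs' => [|i]; last by rewrite mulmxA BE mul0mx.
    by case: Bw => e1 e2; split; rewrite mulmxA ?e1 ?e2 -scalemxAl.
  by apply: (mulmx1_size (A := Y) (B := Z)); apply: (inj_mulmx1 Bi); rewrite mulmxA -BY.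
by move=> h h'; apply/eqP; rewrite eqn_leq !key.
Qed.

Lemma gmult0 (M : gmod F) a b : (forall u : 'cV_(sdim M), ~ ghw a b u) -> gmult M a b 0.
Proof.
move=> nh; exists 0; split=> [c _||i|u wu Eu]; rewrite ?[c]flatmx0 ?mulmx0 //.
  by split; rewrite mulmx0 scaler0.
have [->|u0] := eqVneq u 0; first by exists 0; rewrite mulmx0.
by case: (nh u).
Qed.

Lemma gmult_triv (T : superspace) V x b v p a' b' : typical (V := V) x b v p ->
  gmult (gtens (gtriv F T) V) a' b' (if `[< a' = x%:R /\ b' = b >] then sdim T else 0%N).
Proof.
move=> tV; case: asboolP => [[-> ->]|nab]; last first.
  by apply: gmult0 => u /(gtriv_tens_hw tV)[? ? _]; apply: nab.
have [[_ _ [v0 [v1 v2] Ev] _] _] := tV.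
exists (rten (sdim T) v); split.
- move=> c; rewrite -lten_rten => cv; apply/colP => t; rewrite mxE.
  have [r vr] : exists r, v r 0 != 0.
    apply: contrapT => /forallNP nv; case/eqP: v0; apply/colP => r; rewrite mxE.
    by apply/eqP; rewrite -[_ == _]negbK; apply/negP/nv.
  have /colP/(_ (mxtens_index (t, r))) := cv; rewrite mxE [RHS]mxE.
  under eq_bigr => j _ do rewrite mxE mxtens_indexK -mulrA.
  rewrite -mulr_sumr sum_delta_l => /eqP; rewrite mulf_eq0 (negPf vr) orbF => /eqP //.
- by split; rewrite gtrivh tens_rten mulmx1 ?v1 ?v2 rtenZ.
- by move=> i; rewrite gtrivE tens_rten Ev rten0 mul0mx.
move=> u wu Eu; have [->|u0] := eqVneq u 0; first by exists 0; rewrite mulmx0.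
have hu : ghw (M := gtens (gtriv F T) V) x%:R b u by split.
by have [_ _] := gtriv_tens_hw tV hu.
Qed.

Lemma gmult_sum (V W : gmod F) a b n m : gmult V a b n -> gmult W a b m -> gmult (gsum V W) a b (n + m).
Proof.
move=> [B [Bi [B1 B2] BE Bs]] [B' [Bi' [B1' B2'] BE' Bs']].
exists (block_mx B 0 0 B'); split.
- move=> c; rewrite -[c]vsubmxK mul_block_col !mul0mx addr0 add0r -[X in _ = X -> _]col_mx0.
  by case/eq_col_mx => /Bi-> /Bi'->; rewrite col_mx0.
- by split; rewrite /= mulmx_block !mulmx0 !mul0mx !addr0 !add0r scale_block_mx !scaler0
    ?B1 ?B2 ?B1' ?B2'.
- by move=> i; rewrite /= mulmx_block !mulmx0 !mul0mx !addr0 !add0r BE BE' block_mx0.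
move=> u; rewrite -[u]vsubmxK => /(gwt_colP _ _ _ _)[wu wu'] Eu.
have [|c uc] := Bs _ wu; first by move=> i; have [] := (gE_colP i _ _).1 (Eu i).
have [|c' uc'] := Bs' _ wu'; first by move=> i; have [] := (gE_colP i _ _).1 (Eu i).
by exists (col_mx c c'); rewrite mul_block_col !mul0mx addr0 add0r uc uc'.
Qed.

Lemma gmult_bigsum (I : Type) (s : seq I) (A : I -> gmod F) a b (n : I -> nat) :
  (forall i, gmult (A i) a b (n i)) -> gmult (gbigsum (map A s)) a b (\sum_(i <- s) n i).
Proof.
move=> hA; elim: s => [|i s IHs]; last by rewrite big_cons; apply: gmult_sum.
by rewrite big_nil; apply: gmult0 => u []; rewrite [u]flatmx0 eqxx.
Qed.

Lemma gmult_iso (V M : gmod F) (Phi : 'M[F]_(sdim M, sdim V)) (Psi : 'M[F]_(sdim V, sdim M)) a b n :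
  Phi *m Psi = 1%:M -> Psi *m Phi = 1%:M ->
  (forall i, Phi *m gE V i = gE M i *m Phi) -> (forall i, Phi *m gh V i = gh M i *m Phi) ->
  gmult V a b n -> gmult M a b n.
Proof.
move=> PQ QP hE hh [B [Bi [B1 B2] BE Bs]]; exists (Phi *m B); split.
- move=> c /(congr1 (mulmx Psi)); rewrite !mulmxA QP mul1mx mulmx0; exact: Bi.
- by split; rewrite mulmxA -hh -mulmxA ?B1 ?B2 -scalemxAr.
- by move=> i; rewrite mulmxA -hE -mulmxA BE mulmx0.
move=> u [u1 u2] Eu.
have hE' i : Psi *m gE M i = gE V i *m Psi.
  by rewrite -[LHS]mulmx1 -PQ mulmxA -[Psi *m _ *m _]mulmxA -hE !mulmxA QP mul1mx.
have hh' i : Psi *m gh M i = gh V i *m Psi.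
  by rewrite -[LHS]mulmx1 -PQ mulmxA -[Psi *m _ *m _]mulmxA -hh !mulmxA QP mul1mx.
have [||c uc] := Bs (Psi *m u).
- by split; rewrite mulmxA -hh' -mulmxA ?u1 ?u2 -scalemxAr.
- by move=> i; rewrite mulmxA -hE' -mulmxA Eu mulmx0.
by exists c; rewrite -mulmxA -uc mulmxA PQ mul1mx.
Qed.

End Multiplicity.

End Homs.

(** * Kernels of E_1 in tensor powers *)

Section Kernel.
Variables (C : numFieldType) (F : fieldType) (cst qp : C -> F).
Hypothesis ax : qexp cst qp.
Local Notation q := (qp 1).
Local Notation qint := (qint qp).
Local Notation P M := (gpar_mx F M true).
Local Notation is_gmod := (is_gmod cst qp).
Local Notation ghw := (ghw cst).
Local Notation gwt := (gwt cst).
Local Notation typical := (typical cst qp).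

(** Contraction of the right factor with the linear form phi, inverse to [rten] up to the scalar
    phi(w). *)
Lemma rten_dual m n (phi : 'rV[F]_n) (w : 'cV[F]_n) :
  (rten m phi^T)^T *m rten m w = ((phi *m w) 0 0)%:M.
Proof.
apply/matrixP => i j; rewrite !mxE.
transitivity (\sum_(k1 < m) ((i == k1)%:R * (k1 == j)%:R) * \sum_k2 phi 0 k2 * w k2 0 :> F).
  rewrite -mulr_suml mulr_sum; apply: eq_bigr => k _.
  by rewrite !mxE (eq_sym i) mulrACA.
by rewrite -mulr_suml sum_delta_r mulr_natl.
Qed.

Section Step.
Variables (V : gmod F) (al : C) (v : 'cV[F]_(sdim V)) (p : bool).
Hypothesis tV : typical 0 al v p.
Variable M : gmod F.
Hypothesis hM : is_gmod M.
Local Notation fm k := (fam v k 0).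
Local Notation J k := (rten (sdim M) (fm k)).
Local Notation MV := (gtens M V).

Let hV : is_gmod V. Proof. by case: tV => -[]. Qed.
Let wv : gwt 0%:R al v. Proof. by case: tV => -[_ _ []]. Qed.
Let Ev i : gE V i *m v = 0. Proof. by case: tV => -[_ _ []]. Qed.
Let Pv : P V *m v = (-1) ^+ p *: v. Proof. by case: tV => -[]. Qed.
Let al0 : al != 0. Proof. by case: tV => _ []. Qed.
Let al1 : al + 1 != 0. Proof. by case: tV => _ [_]; rewrite add0r. Qed.

(** The four vectors [fm k] form a basis of V; contracting with the dual basis, the rows of the
    inverse D, isolates each A_k. *)
Lemma rten_fam_inj m (A0 A1 A2 A3 : 'M[F]_(sdim M, m)) :
  J 0 *m A0 + J 1 *m A1 + J 2 *m A2 + J 3 *m A3 = 0 -> [/\ A0 = 0, A1 = 0, A2 = 0 & A3 = 0].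
Proof.
case: tV => -[_ sV hv _] [_ xb0] e.
have [D [_ DB]] := typical_inv ax hV sV hv Pv al0 xb0.
pose R (k : 'I_4) := (rten (sdim M) (row (mxtens_index (k, ord0)) D)^T)^T.
have RJo (k l : 'I_4) : R k *m J l = ((k == l)%:R)%:M.
  have -> : fm l = famx v 0 *m delta_mx (mxtens_index (l, ord0)) 0 by rewrite famx_index.
  rewrite rten_dual; congr (_%:M).
  have -> (w : 'cV_(sdim V)) r : (row r D *m w) 0 0 = (D *m w) r 0.
    by rewrite !mxE; apply: eq_bigr => j _; rewrite mxE.
  rewrite mulmxA DB mul1mx mxE eqxx andbT (inj_eq (can_inj (@mxtens_indexK 4 1))).
  by rewrite xpair_eqE eqxx andbT.
have RJ k l (lk : (k < 4)%N) (ll : (l < 4)%N) (A : 'M[F]_(sdim M, m)) :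
    R (Ordinal lk) *m (J l *m A) = (k == l)%:R *: A.
  by rewrite mulmxA (RJo (Ordinal lk) (Ordinal ll)) mul_scalar_mx.
have key k (lk : (k < 4)%N) : (k == 0)%:R *: A0 + (k == 1)%:R *: A1 + (k == 2)%:R *: A2
    + (k == 3)%:R *: A3 = 0.
  by have := congr1 (mulmx (R (Ordinal lk))) e; rewrite mulmx0 !mulmxDr !RJ.
have := (key 0 isT, key 1%N isT, (key 2 isT, key 3 isT)).
by rewrite !scale0r !scale1r !addr0 !add0r => -[[-> ->] [-> ->]].
Qed.

Lemma gMV_E1 k m (A : 'M[F]_(sdim M, m)) :
  gE MV i1 *m (J k *m A) = J k *m (gE M i1 *m A) + rten _ (gE V i1 *m fm k) *m (invmx (gK M i1) *m A).
Proof. by rewrite gtensE gpar_mxF mulmx1 mulmxDl !mulmxA !tens_rten mul1mx. Qed.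

Lemma gMV_E2 k m (A : 'M[F]_(sdim M, m)) :
  gE MV i2 *m (J k *m A) = J k *m (gE M i2 *m A)
    + rten _ (gE V i2 *m fm k) *m (invmx (gK M i2) *m (P M *m A)).
Proof. by rewrite gtensE mulmxDl !mulmxA !tens_rten mul1mx !mulmxA. Qed.

Lemma gMV_wt k m (A : 'M[F]_(sdim M, m)) a b : gwt a b A ->
  gwt (M := MV) (a + fam_a C k) (b + al + fam_b C k) (J k *m A).
Proof.
move=> [A1 A2]; have [e1 e2] := gwt_fam ax hV wv k 0.
rewrite mul0r !subr0 add0r in e1; rewrite addr0 in e2.
split; rewrite gtensh mulmxDl !mulmxA !tens_rten mul1mx ?e1 ?e2 mulmx1 rtenZ -mulmxA ?A1 ?A2.
  by rewrite -scalemxAl -scalemxAr -scalerDl (qcstD ax).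
by rewrite -scalemxAl -scalemxAr -scalerDl -(qcstD ax) addrA.
Qed.

Lemma gMV_P k m (A : 'M[F]_(sdim M, m)) s : (k < 4)%N -> P M *m A = s *: A ->
  P MV *m (J k *m A) = ((-1) ^+ fam_odd k * (-1) ^+ p * s) *: (J k *m A).
Proof.
move=> lk PA; rewrite gpar_tens mulmxA tens_rten (fam_parity 0 hV Pv lk) rtenZ -mulmxA PA.
by rewrite -scalemxAl -scalemxAr scalerA.
Qed.

Lemma famV_E1 : [/\ gE V i1 *m fm 0 = 0, gE V i1 *m fm 1 = 0, gE V i1 *m fm 2 = fm 1
  & gE V i1 *m fm 3 = 0].
Proof.
rewrite (famE1_0 ax hV wv Ev) (famE1_1 ax hV wv Ev) (famE1_2 ax hV wv Ev) (famE1_3 ax hV wv Ev).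
rewrite (qint0 ax) !mul0r !scale0r subr0 !add0r; split=> //.
by rewrite (qint1 ax) scale1r.
Qed.

Lemma famV_E2 : [/\ gE V i2 *m fm 0 = 0, gE V i2 *m fm 1 = qint al *: fm 0, gE V i2 *m fm 2 = 0
  & gE V i2 *m fm 3 = qint (al + 1) *: fm 2].
Proof.
rewrite (famE2_0 hV Ev) (famE2_1 ax hV wv Ev) (famE2_2 ax hV wv Ev) (famE2_3 ax hV wv Ev).
have z k : fam v k 1 = 0 by exact: (fam_eq0 ax hV wv Ev erefl).
by rewrite !addr0 !z !scaler0 subr0.
Qed.

Lemma gE1212 m (X : 'M_(_, m)) : gE M i1 *m (gE M i2 *m (gE M i1 *m (gE M i2 *m X))) =
  gE M i2 *m (gE M i1 *m (gE M i2 *m (gE M i1 *m X))).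
Proof.
have e1 := gE1E1E2 hM (gE M i2 *m X); rewrite (gE2E2 hM) !mulmx0 in e1.
have e2 := congr1 (mulmx (gE M i2)) (gE1E1E2 hM X).
move/esym/eqP: e1; rewrite subr_eq0 => /eqP e1.
move: e2; rewrite -e1 mulmxBr (gE2E2 hM) subr0 -scalemxAr => /(scalerI _); apply.
by rewrite -(qint2 ax) (qint_eq0 ax) pnatr_eq0.
Qed.

(* A highest weight vector of M (x) V is determined by its component along the highest weight
   vector of V, and this component can be any vector killed by E_1. *)
Lemma hw_of_kernel m (G : 'M[F]_(sdim M, m)) a c (p' : bool) :
  gwt a c G -> gE M i1 *m G = 0 -> P M *m G = (-1) ^+ p' *: G ->
  exists H : 'M[F]_(sdim MV, m),
    [/\ gwt (M := MV) a (c + al) H, forall i, gE MV i *m H = 0, P MV *m H = (-1) ^+ (p (+) p') *: H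
      & forall u : 'cV_m, H *m u = 0 -> G *m u = 0].
Proof.
move=> wG EG PG; set s := (-1) ^+ p' in PG *.
have s0 : s != 0 by rewrite signr_eq0.
have ss : s * s = 1 by rewrite -expr2 sqrr_sign.
have qal : qint al != 0 by rewrite (qint_eq0 ax).
have qal1 : qint (al + 1) != 0 by rewrite (qint_eq0 ax).
have [E10 E11 E12 E13] := famV_E1; have [E20 E21 E22 E23] := famV_E2.
pose X1 := gE M i2 *m G; pose X2 := gE M i1 *m X1; pose X3 := gE M i2 *m X2.
have EX1 : gE M i2 *m X1 = 0 by rewrite /X1 (gE2E2 hM).
have EX2 : gE M i1 *m X2 = 0.
  by rewrite /X2 /X1 (gE1E1E2 hM) EG !mulmx0 scaler0 subr0.
have EX31 : gE M i1 *m X3 = 0 by rewrite /X3 /X2 /X1 gE1212 EG !mulmx0.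
have EX32 : gE M i2 *m X3 = 0 by rewrite /X3 (gE2E2 hM).
have w1 := gwtE2 ax hM wG; rewrite -/X1 in w1.
have w2 := gwtE1 ax hM w1; rewrite -/X2 in w2.
have w3 := gwtE2 ax hM w2; rewrite -/X3 in w3.
have P1 : P M *m X1 = (- s) *: X1 by rewrite /X1 (gPE2 hM) PG -scalemxAr scaleNr.
have P2 : P M *m X2 = (- s) *: X2 by rewrite /X2 (gPE1 hM) P1 -scalemxAr.
have P3 : P M *m X3 = s *: X3 by rewrite /X3 (gPE2 hM) P2 -scalemxAr scaleNr opprK.
(* With v_k = [fm k], the vector sought is the sum of the k_i X_i (x) v_i, with k_0 = 1 and X_0 = G.
   In its image under E_2, [k1] cancels the component along v_0 and [k3] the one along v_2; [k2]
   cancels the component along v_1 of its image under E_1. All other components vanish by the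
   relations among the X_i. *)
pose k1 := (qint al * s * qp (- c))^-1.
pose k2 := - k1 * qp (a - 1 + 2).
pose k3 := - k2 / (qint (al + 1) * s * qp (- (c - 1))).
have [_ h2X1] := w1; have [h1X2 _] := w2; have [_ h2X3] := w3.
have L1 := gKVeig ax hM h2X1; have L2 := gKVeig ax hM h1X2; have L3 := gKVeig ax hM h2X3.
have qc := qp_neq0 ax (- c); have qc1 := qp_neq0 ax (- (c - 1)).
have qa := qp_neq0 ax (a - 1 + 2).
exists (J 0 *m G + J 1 *m (k1 *: X1) + J 2 *m (k2 *: X2) + J 3 *m (k3 *: X3)); split.
- have g0 := gMV_wt 0 wG; have g1 := gMV_wt 1%N (gwtZ k1 w1).
  have g2 := gMV_wt 2 (gwtZ k2 w2); have g3 := gMV_wt 3 (gwtZ k3 w3).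
  rewrite /fam_a /fam_b in g0 g1 g2 g3.
  have ha : [/\ a + 0 = a, a - 1 + 1 = a, a - 1 + 2 + -1 = a & a - 1 + 2 - 1 + 0 = a] by split; ring.
  have hb : [/\ c + al + 0 = c + al & c - 1 + al + 1 = c + al] by split; ring.
  case: ha hb => a0 a1 a2 a3 [c0 c1].
  rewrite ?a3 ?a0 ?a1 ?a2 ?c0 ?c1 in g0 g1 g2 g3.
  exact: gwtD (gwtD (gwtD g0 g1) g2) g3.
- move=> i; case: (ord2P i) => ->.
    rewrite !mulmxDr !gMV_E1 E10 E11 E12 E13 !rten0 !mul0mx !addr0 EG -!scalemxAr EX2 EX31 -/X2 L2.
    rewrite !mulmx0 -scalemxAr !scaler0 !add0r addr0 scalerA -scalerDl.
    by rewrite /k2 -mulrA -(qpD ax) (subrr (a - 1 + 2)) (qp0 ax) mulr1 subrr scale0r.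
  rewrite !mulmxDr !gMV_E2 E20 E21 E22 E23 !rten0 !mul0mx !addr0 -!scalemxAr EX1 EX32 -/X1 -/X3.
  rewrite P1 P3 -!scalemxAr L1 L3 !mulmx0 !scaler0 !rtenZ -!scalemxAl -!scalemxAr !scalerA.
  have -> : k1 * - s * qint al * qp (- c) = - 1 by rewrite /k1; field; rewrite qc s0 qal.
  have -> : k3 * s * qint (al + 1) * qp (- (c - 1)) = - k2.
    by rewrite /k3; field; rewrite qc1 s0 qal1.
  by rewrite !add0r scaleN1r scaleNr subrr add0r subrr.
- have Q k (X : 'M[F]_(sdim M, m)) t : (k < 4)%N -> P M *m X = ((-1) ^+ fam_odd k * s) *: X ->
      P MV *m (J k *m (t *: X)) = (-1) ^+ (p (+) p') *: (J k *m (t *: X)).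
    move=> lk PX; rewrite -!scalemxAr (gMV_P lk PX) scalerA [t * _]mulrC -scalerA.
    congr (_ *: _).
    by rewrite signr_addb -/s mulrACA -expr2 sqrr_sign mul1r.
  have Q0 := Q 0%N G 1 isT; rewrite expr0 mul1r scale1r in Q0.
  rewrite !mulmxDr !scalerDr Q0 // (Q 1%N) ?expr1 ?mulN1r // (Q 2%N) ?expr1 ?mulN1r //.
  by rewrite (Q 3%N) // expr0 mul1r.
move=> u; rewrite !mulmxDl -!mulmxA => /rten_fam_inj[]//.
Qed.

(* G0, G1, G2, G3 contribute through the moves M_1, M_2, M_4, M_3; for g in G2 the vector killed by
   E_1 is F_1 g (x) v_1 - [x + 1] q^(x + 1) g (x) v_2, where v_1 = F_2 v and v_2 = F_1 F_2 v. *)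
Lemma kernel_step m0 m1 m2 m3 (x : nat) c (p' : bool) (G0 : 'M[F]_(sdim M, m0)) (G1 : 'M[F]_(sdim M, m1))
    (G2 : 'M[F]_(sdim M, m2)) (G3 : 'M[F]_(sdim M, m3)) :
  [/\ gwt x%:R c G0, gwt (x%:R - 1) c G1, gwt x.+1%:R (c - 1) G2 & gwt x%:R (c - 1) G3] ->
  [/\ gE M i1 *m G0 = 0, gE M i1 *m G1 = 0, gE M i1 *m G2 = 0 & gE M i1 *m G3 = 0] ->
  [/\ P M *m G0 = (-1) ^+ p' *: G0, P M *m G1 = (-1) ^+ (~~ p') *: G1,
      P M *m G2 = (-1) ^+ (~~ p') *: G2 & P M *m G3 = (-1) ^+ p' *: G3] ->
  [/\ forall u : 'cV_m0, G0 *m u = 0 -> u = 0, forall u : 'cV_m1, G1 *m u = 0 -> u = 0,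
      forall u : 'cV_m2, G2 *m u = 0 -> u = 0 & forall u : 'cV_m3, G3 *m u = 0 -> u = 0] ->
  exists G : 'M[F]_(sdim MV, m0 + m1 + m2 + m3),
    [/\ gwt (M := MV) x%:R (c + al) G, gE MV i1 *m G = 0, P MV *m G = (-1) ^+ (p (+) p') *: G
      & forall u : 'cV_(m0 + m1 + m2 + m3), G *m u = 0 -> u = 0].
Proof.
move=> [w0 w1 w2 w3] [e0 e1 e2 e3] [P0 P1 P2 P3] [i0 i1 i2 i3].
have [E10 E11 E12 E13] := famV_E1.
(* E_1 sends F_1 g (x) v_1 to [x + 1] g (x) v_1 and g (x) v_2 to q^-(x + 1) g (x) v_1; this factor
   makes them cancel. *)
pose k := - (qint x.+1%:R * qp x.+1%:R).
have k0 : k != 0.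
  by rewrite oppr_eq0 mulf_neq0 ?(qp_neq0 ax) // (qint_eq0 ax) pnatr_eq0.
pose X := gF M ord0 *m G2.
have EX : gE M ord0 *m X = qint x.+1%:R *: G2.
  by case: w2 => h _; rewrite (gE1F1 ax hM h) e2 mulmx0 add0r.
have wX := gwtF1 ax hM w2; rewrite -/X in wX.
have PX : P M *m X = (-1) ^+ (~~ p') *: X by rewrite /X (gPF1 hM) P2 -scalemxAr.
clearbody X.
have L2 : invmx (gK M ord0) *m G2 = qp (- x.+1%:R) *: G2.
  by case: w2 => h _; apply: gKVeig h.
exists (row_mx (row_mx (row_mx (J 0 *m G0) (J 1 *m G1)) (J 1 *m X + J 2 *m (k *: G2))) (J 3 *m G3)).
have wrow a b n n' (A : 'M[F]_(sdim MV, n)) (B : 'M[F]_(sdim MV, n')) :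
    gwt (M := MV) a b A -> gwt (M := MV) a b B -> gwt (M := MV) a b (row_mx A B).
  by move=> [h1 h2] [h3 h4]; split; rewrite mul_mx_row scale_row_mx ?h1 ?h2 ?h3 ?h4.
have g0 := gMV_wt 0 w0; have g1 := gMV_wt 1%N w1; have gX := gMV_wt 1%N wX.
have g2 := gMV_wt 2 (gwtZ k w2); have g3 := gMV_wt 3 w3.
rewrite /fam_a /fam_b in g0 g1 gX g2 g3.
have ha : [/\ x%:R + 0 = x%:R :> C, x%:R - 1 + 1 = x%:R :> C, x.+1%:R - 2 + 1 = x%:R :> C
   & x.+1%:R - 1 = x%:R :> C] by rewrite -(natr1 x); split; ring.
have hb : [/\ c + al + 0 = c + al, c - 1 + 1 + al + 0 = c + al & c - 1 + al + 1 = c + al].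
  by split; ring.
case: ha hb => a0 a1 aX a2 [c0 cX c2].
rewrite ?a0 ?a1 ?aX ?a2 ?c0 ?cX ?c2 in g0 g1 gX g2 g3.
have Q kk mm (Y : 'M[F]_(sdim M, mm)) : (kk < 4)%N -> P M *m Y = (-1) ^+ (p' (+) fam_odd kk) *: Y ->
    P MV *m (J kk *m Y) = (-1) ^+ (p (+) p') *: (J kk *m Y).
  move=> lk PY; rewrite (gMV_P lk PY); congr (_ *: _).
  by rewrite !signr_addb mulrC -!mulrA; case: (fam_odd kk); rewrite ?expr1 ?expr0; ring.
split.
- by do 2!apply: (wrow) => //; [apply: wrow | apply: gwtD].
- rewrite !mul_mx_row mulmxDr !gMV_E1 E10 E11 E12 E13 e0 e1 e3 !rten0 !mul0mx !mulmx0 !addr0.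
  rewrite -!scalemxAr e2 mulmx0 scaler0 add0r EX L2 -!scalemxAr scalerA -scalerDl.
  rewrite /k mulNr -mulrA -(qpD ax) subrr (qp0 ax) mulr1 subrr scale0r.
  by rewrite !row_mx0.
- rewrite !mul_mx_row !scale_row_mx mulmxDr scalerDr.
  rewrite !Q ?addbT ?addbF // -scalemxAr P2 !scalerA mulrC //.
move=> u; rewrite -[u]vsubmxK -[usubmx u]vsubmxK -[usubmx (usubmx u)]vsubmxK.
move: (dsubmx u) (dsubmx (usubmx u)) (usubmx (usubmx (usubmx u))) (dsubmx (usubmx (usubmx u))).
move=> u3 u2 u0 u1; rewrite !mul_row_col mulmxDl -!mulmxA => e.
have [] := @rten_fam_inj _ (G0 *m u0) (G1 *m u1 + X *m u2) (k *: G2 *m u2) (G3 *m u3).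
  by rewrite mulmxDr -e !addrA.
(* The component along v_2 involves G2 only and must be settled first, since the one along v_1 mixes
   G1 with F_1 G2. *)
move=> /i0 -> h1 h2 /i3 ->; have z2 : u2 = 0.
  by apply: i2; move/eqP: h2; rewrite -scalemxAl scaler_eq0 (negPf k0) => /eqP.
by move: h1; rewrite z2 mulmx0 addr0 => /i1 ->; rewrite !col_mx0.
Qed.

End Step.
End Kernel.

(** * Paths *)

Fixpoint npath (n : nat) (p z : nat * nat) : nat :=
  if n is n'.+1 then
    (npath n' p z + npath n' (p.1.+1, p.2) z + npath n' (p.1, p.2.+1) z
     + (if p.1 is a.+1 then npath n' (a, p.2.+1) z else 0))%N
  else (p == z).

Lemma card_run n p z : #|[set s : n.-tuple 'I_4 | run s p == Some z]| = npath n p z.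
Proof.
rewrite cardsE -sum1_card big_mkcond /=.
elim: n p => [|n IHn] p.
  rewrite (bigD1 [tuple]) //= big1 => [|s ns]; last by rewrite (tuple0 s) in ns.
  by rewrite addn0 unfold_in /=; case: (p == z).
rewrite (reindex (fun q : 'I_4 * n.-tuple 'I_4 => [tuple of q.1 :: q.2])) /=; last first.
  exists (fun s : n.+1.-tuple 'I_4 => (thead s, [tuple of behead s])) => [[m s] _|s _] /=.
    by congr (_, _); apply: val_inj.
  by rewrite [RHS]tuple_eta; apply: val_inj.
rewrite -(pair_bigA _ (fun (m : 'I_4) (s : n.-tuple 'I_4) =>
  if [tuple of m :: s] \in [pred s : n.+1.-tuple 'I_4 | run s p == Some z] then 1%N else 0%N)) /=.
have E m : (\sum_(s : n.-tuple 'I_4)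
    (if [tuple of m :: s] \in [pred s : n.+1.-tuple 'I_4 | run s p == Some z] then 1 else 0) =
    if apply_move m p is Some p' then npath n p' z else 0)%N.
  case e : (apply_move m p) => [p'|].
    by rewrite -IHn; apply: eq_bigr => s _; rewrite !unfold_in /= e.
  by rewrite big1 // => s _; rewrite unfold_in /= e.
under eq_bigr => m _ do rewrite E.
rewrite !big_ord_recl big_ord0 addn0 /= -!addnA; do 3!congr (_ + _)%N.
by rewrite /apply_move /=; case: p {E} => [[|a] b].
Qed.

Lemma npathS n a b z : npath n.+1 (a, b) z =
  (npath n (a, b) z + npath n (a.+1, b) z + npath n (a, b.+1) z
     + (if a is a'.+1 then npath n (a', b.+1) z else 0))%N.
Proof. by []. Qed.

(** [npath] branches on the first move, but a new tensor factor adds the last one. The summands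
    stand in the order M_1, M_2, M_4, M_3 of [kernel_step]. *)
Lemma npath_last n p x y :
  (npath n.+1 p (x, y) = npath n p (x, y) + (if x is x'.+1 then npath n p (x', y) else 0)
    + (if y is y'.+1 then npath n p (x.+1, y') else 0)
    + (if y is y'.+1 then npath n p (x, y') else 0))%N.
Proof.
elim: n p => [|n IHn] p; last first.
  by case: p => -[|a] b; rewrite [LHS]npathS ![in LHS]IHn !npathS;
    case: x {IHn} => [|x]; case: y => [|y]; rewrite ?npathS; lia.
case: p => [[|a] b] /=; rewrite !xpair_eqE; case: x => [|x]; case: y => [|y];
  rewrite ?eqSS ?xpair_eqE ?eqSS /=; lia.
Qed.

Lemma npath_bound n p x y : (npath n p (x, y) != 0)%N -> (x + y <= p.1 + p.2 + n)%N.
Proof.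
elim: n p => [|n IHn] [a b] /=.
  by case: ((a, b) =P (x, y)) => [[-> ->] _|_ //]; lia.
rewrite -!lt0n !addn_gt0 !lt0n => /orP[/orP[/orP[/IHn|/IHn]|/IHn]|] /=; try lia.
by case: a => // a /IHn /=; lia.
Qed.

(** The moves from (a, b) lead to points of weights a + 1, a + 2, a + 1 and a, with sum 4 (a + 1);
    at a = 0 the forbidden move would have weight 0. The bounds on N keep all end points inside the
    grid. *)
Lemma sum_npath n p N : (p.1 + n < N)%N -> (p.2 + n < N)%N ->
  (\sum_(x <- iota 0 N) \sum_(y <- iota 0 N) npath n p (x, y) * x.+1 = 4 ^ n * p.1.+1)%N.
Proof.
elim: n p => [|n IHn] [a b] /=; rewrite ?addn0 => la lb.
  rewrite mul1n (bigD1_seq a) ?iota_uniq ?mem_iota //= (bigD1_seq b) ?iota_uniq ?mem_iota //=.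
  rewrite eqxx mul1n [X in (_ + X + _)%N]big1 => [|y yb]; last first.
    by rewrite xpair_eqE [b == y]eq_sym (negPf yb) andbF.
  rewrite [X in (_ + X)%N]big1 ?addn0 // => x xa; rewrite big1 // => y _.
  by rewrite xpair_eqE eq_sym (negPf xa).
have S p' : (p'.1 + n < N)%N -> (p'.2 + n < N)%N ->
  (\sum_(x <- iota 0 N) \sum_(y <- iota 0 N) npath n p' (x, y) * x.+1 = 4 ^ n * p'.1.+1)%N by exact: IHn.
under eq_bigr => x _.
  under eq_bigr => y _ do rewrite !mulnDl.
  rewrite !big_split; over.
rewrite !big_split /= !S /=; try lia.
case: a la => [|a] la.
  rewrite big1 => [|x _]; last by rewrite big1.
  by rewrite expnS; lia.
by rewrite S /=; [rewrite expnS|..]; lia.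
Qed.

Lemma card_paths n x y : #|paths n x y| = npath n (0, 0)%N (x, y).
Proof. exact: card_run. Qed.

(** * Decomposition of tensor powers *)

Fixpoint gtpow (F : fieldType) (V : gmod F) (n : nat) : gmod F :=
  if n is n'.+1 then gtens (gtpow V n') V else gtriv F (@SuperSpace 1 (fun=> false)).

Definition giso (F : fieldType) (V W : gmod F) : Prop :=
  exists (Phi : 'M[F]_(sdim W, sdim V)) (Psi : 'M[F]_(sdim V, sdim W)),
    [/\ Phi *m Psi = 1%:M, Psi *m Phi = 1%:M & ghom Phi].

Definition gdec (C : numFieldType) (F : fieldType) (V : nat -> C -> gmod F) (al : C) (n : nat)
    (T : nat -> nat -> superspace) : Prop :=
  exists N : nat, (forall x y, ~~ ((x < N) && (y < N))%N -> sdim (T x y) = 0%N) /\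
    giso (gtpow (V 0%N al) n)
      (gbigsum [seq gtens (gtriv F (T x y)) (V x (al *+ n + y%:R)) | x <- iota 0 N, y <- iota 0 N]).

Lemma ghom_inv (F : fieldType) (V W : gmod F) (Phi : 'M[F]_(sdim W, sdim V)) (Psi : 'M[F]_(sdim V, sdim W)) :
  Phi *m Psi = 1%:M -> Psi *m Phi = 1%:M -> ghom Phi -> ghom Psi.
Proof.
move=> PQ QP [hP hE hF hh].
have key (A : 'M_(sdim V)) (B : 'M_(sdim W)) : Phi *m A = B *m Phi -> Psi *m B = A *m Psi.
  by move=> e; rewrite -[LHS]mulmx1 -PQ mulmxA -[Psi *m _ *m _]mulmxA -e !mulmxA QP mul1mx.
by split=> [|i|i|i]; apply: key.
Qed.

Lemma inj_square_inv (F : fieldType) m n (A : 'M[F]_(m, n)) : m = n ->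
  (forall u : 'cV_n, A *m u = 0 -> u = 0) -> exists B : 'M[F]_(n, m), A *m B = 1%:M /\ B *m A = 1%:M.
Proof.
move=> e; case: n / e A => A Ai.
have u : A \in unitmx.
  rewrite -unitmx_tr -row_free_unit; apply/row_freeP; apply: contrapT => nB.
  have /negP[] : ~~ (kermx A^T != 0).
    apply/negPn/eqP/row_matrixP => i; rewrite row0; apply/eqP; rewrite -trmx_eq0; apply/eqP/Ai.
    by apply: trmx_inj; rewrite trmx_mul trmxK trmx0 -row_mul mulmx_ker row0.
  rewrite kermx_eq0; apply/negP => /row_freeP; exact: nB.
by exists (invmx A); rewrite mulmxV ?mulVmx.
Qed.

Section Decomposition.
Variables (C : numFieldType) (F : fieldType) (cst qp : C -> F).
Hypothesis ax : qexp cst qp.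
Local Notation P M := (gpar_mx F M true).
Local Notation is_gmod := (is_gmod cst qp).
Local Notation ghw := (ghw cst).
Local Notation gwt := (gwt cst).
Local Notation typical := (typical cst qp).
Variable V : nat -> C -> gmod F.
Hypothesis hV : forall (a : nat) b,
  [/\ is_gmod (V a b), gsimple (V a b) & exists v, ghw (M := V a b) a%:R b v].
Variable al : C.
Hypothesis hal : forall k m : nat, al *+ k.+1 + m%:R != 0.
Local Notation bt n y := (al *+ n + y%:R).

Lemma typicalV n x y : exists v p, typical (V := V x (bt n.+1 y)) x (bt n.+1 y) v p.
Proof.
have [hm hs [v hv]] := hV x (bt n.+1 y).
have [w [p [hw Pw]]] := ghw_homogeneous hm hv.
exists w, p; split=> //; split; first exact: hal.
have -> : x%:R + bt n.+1 y + 1 = bt n.+1 (x + y + 1) by rewrite !natrD; ring.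
exact: hal.
Qed.

Lemma typicalV0 : exists v p, typical (V := V 0%N al) 0%N al v p.
Proof. by have := typicalV 0 0 0; rewrite addr0 mulr1n. Qed.

Lemma gtpow_gmod n : is_gmod (gtpow (V 0%N al) n).
Proof.
elim: n => [|n IHn]; first exact: gtriv_gmod.
by apply: gtens_gmod => //; case: (hV 0%N al).
Qed.

Section Fixed.
Variables (v : 'cV[F]_(sdim (V 0%N al))) (p : bool).
Hypothesis tV : typical 0%N al v p.
Local Notation W n := (gtpow (V 0%N al) n).

Lemma gtpow_dim n : sdim (W n) = (4 ^ n)%N.
Proof.
have [[h1 h2 h3 h4] [h5 h6]] := tV.
have d : sdim (V 0%N al) = 4%N by rewrite (typical_dim ax h1 h2 h3 h4 h5 h6).
by elim: n => [|n IHn] //; rewrite expnSr -IHn -d.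
Qed.

(** The parity is constant on each space: every factor contributes p, and F_2 v and F_1 F_2 v, the
    odd vectors relative to v, enter exactly for M_2 and M_4, the moves that change x by 1. *)
Lemma kernel_vectors n x y : exists G : 'M[F]_(sdim (W n), npath n (0, 0)%N (x, y)),
  [/\ gwt (M := W n) x%:R (bt n y) G, gE (W n) i1 *m G = 0,
      P (W n) *m G = (-1) ^+ odd (x + n * p) *: G
    & forall u : 'cV_(npath n (0, 0)%N (x, y)), G *m u = 0 -> u = 0].
Proof.
have zc d (A B : 'M[F]_(d, 0)) : A = B by apply/matrixP => ? [].
elim: n x y => [|n IHn] x y.
  case: x => [|x]; last first.
    exists 0; split; [split | | |]; try exact: zc; by move=> u _; apply/colP => -[].
  case: y => [|y]; last first.
    exists 0; split; [split | | |]; try exact: zc; by move=> u _; apply/colP => -[].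
  exists (1%:M : 'M_1); split.
  - by split; rewrite mul0mx /= ?mulr0n ?add0r (gcst0 ax) scale0r.
  - by rewrite mul0mx.
  - rewrite mulmx1 (_ : odd (0 + 0 * p) = false) ?expr0 ?scale1r -?diag_const_mx //; congr diag_mx.
    by apply/rowP => j; rewrite !mxE.
  by move=> u; rewrite mul1mx.
rewrite npath_last.
have [G0 [w0 e0 p0 i0]] := IHn x y.
pose m1 := if x is x'.+1 then npath n (0, 0)%N (x', y) else 0%N.
have [G1 [w1 e1 p1 i1']] : exists G : 'M[F]_(sdim (W n), m1),
    [/\ gwt (M := W n) (x%:R - 1) (bt n y) G, gE (W n) i1 *m G = 0,
        P (W n) *m G = (-1) ^+ (~~ odd (x + n * p)) *: G & forall u : 'cV_m1, G *m u = 0 -> u = 0].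
  rewrite /m1; case: x {G0 w0 e0 p0 i0 m1} => [|x].
    exists 0; split; [split | | |]; try exact: zc; by move=> u _; apply/colP => -[].
  have [G [w e pp i]] := IHn x y; exists G; split=> //; first by rewrite -(natr1 x) addrK.
  by rewrite addSn /= negbK.
pose m2 := if y is y'.+1 then npath n (0, 0)%N (x.+1, y') else 0%N.
have [G2 [w2 e2 p2 i2']] : exists G : 'M[F]_(sdim (W n), m2),
    [/\ gwt (M := W n) x.+1%:R (bt n y - 1) G, gE (W n) i1 *m G = 0,
        P (W n) *m G = (-1) ^+ (~~ odd (x + n * p)) *: G & forall u : 'cV_m2, G *m u = 0 -> u = 0].
  rewrite /m2; case: y {G0 w0 e0 p0 i0 G1 w1 e1 p1 i1' m1 m2} => [|y].
    exists 0; split; [split | | |]; try exact: zc; by move=> u _; apply/colP => -[].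
  have [G [w e pp i]] := IHn x.+1 y; exists G; split=> //.
  by rewrite -(natr1 y) addrA addrK.
pose m3 := if y is y'.+1 then npath n (0, 0)%N (x, y') else 0%N.
have [G3 [w3 e3 p3 i3]] : exists G : 'M[F]_(sdim (W n), m3),
    [/\ gwt (M := W n) x%:R (bt n y - 1) G, gE (W n) i1 *m G = 0,
        P (W n) *m G = (-1) ^+ odd (x + n * p) *: G & forall u : 'cV_m3, G *m u = 0 -> u = 0].
  rewrite /m3; case: y {G0 w0 e0 p0 i0 G1 w1 e1 p1 i1' m1 G2 w2 e2 p2 i2' m2 m3} => [|y].
    exists 0; split; [split | | |]; try exact: zc; by move=> u _; apply/colP => -[].
  have [G [w e pp i]] := IHn x y; exists G; split=> //.
  by rewrite -(natr1 y) addrA addrK.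
have [G [w e pp i]] := kernel_step ax tV (gtpow_gmod n) (And4 w0 w1 w2 w3) (And4 e0 e1 e2 e3)
  (And4 p0 p1 p2 p3) (And4 i0 i1' i2' i3).
exists G; split=> //; first by rewrite mulrSr addrAC.
rewrite pp; congr (_ ^+ nat_of_bool _ *: _).
by rewrite mulSn addnCA [RHS]oddD; case: (p).
Qed.

Lemma hw_vectors n x y : exists H : 'M[F]_(sdim (W n.+1), npath n (0, 0)%N (x, y)),
  [/\ gwt (M := W n.+1) x%:R (bt n.+1 y) H, forall i, gE (W n.+1) i *m H = 0,
      exists p' : bool, P (W n.+1) *m H = (-1) ^+ p' *: H
    & forall u : 'cV_(npath n (0, 0)%N (x, y)), H *m u = 0 -> u = 0].
Proof.
have [G [w e pp i]] := kernel_vectors n x y.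
have [H [wH eH pH iH]] := hw_of_kernel ax tV (gtpow_gmod n) w e pp.
exists H; split=> //; first by rewrite mulrSr addrAC.
  by eexists; exact: pH.
by move=> u /iH/i.
Qed.

End Fixed.

Lemma sdim_gbigsum (I : Type) (s : seq I) (A : I -> gmod F) :
  sdim (gbigsum (map A s)) = (\sum_(i <- s) sdim (A i))%N.
Proof. by elim: s => [|i s IHs]; rewrite ?big_nil ?big_cons //= -IHs. Qed.

Definition grid N : seq (nat * nat) := [seq (x, y) | x <- iota 0 N, y <- iota 0 N].

Lemma gdecP n T : gdec V al n T <-> exists N : nat,
  (forall x y, ~~ ((x < N) && (y < N))%N -> sdim (T x y) = 0%N) /\
    giso (gtpow (V 0%N al) n)
      (gbigsum (map (fun z => gtens (gtriv F (T z.1 z.2)) (V z.1 (bt n z.2))) (grid N))).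
Proof.
by rewrite /gdec /grid; split=> -[N [h1 h2]]; exists N; split=> //; move: h2; rewrite map_allpairs.
Qed.

Lemma decomposition_exists n : exists T, gdec V al n.+1 T /\
  forall x y, sdim (T x y) = npath n (0, 0)%N (x, y).
Proof.
have [v [p tV]] := typicalV0.
pose M := gtpow (V 0%N al) n.+1.
pose A (T : superspace) (z : nat * nat) := gtens (gtriv F T) (V z.1 (bt n.+1 z.2)).
have ex z : exists T : superspace, sdim T = npath n (0, 0)%N z /\
    exists Th : 'M[F]_(sdim M, sdim (A T z)), ghom Th /\ forall a b u, ghw a b u -> Th *m u != 0.
  case: z => x y; have [w [r tw]] := typicalV n x y.
  have [H [wH eH [p' pH] iH]] := hw_vectors tV n x y.
  (* This parity of T(x, y) compensates the difference between the highest weight vector of V(x, -),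
     of parity r, and those of the tensor power, of parity p'. *)
  exists (@SuperSpace (npath n (0, 0)%N (x, y)) (fun=> r (+) p')); split=> //.
  exact: (@glue_hom _ _ _ _ ax _ _ _ _ _ _ _ (@SuperSpace _ (fun=> r (+) p')) H
    tw (gtpow_gmod n.+1) wH eH pH).
have [f fP] := choice ex.
pose Th z : 'M[F]_(sdim M, sdim (A (f z) z)) := projT1 (cid (fP z).2).
have ThP z : ghom (Th z) /\ forall a b u, ghw a b u -> Th z *m u != 0 := projT2 (cid (fP z).2).
have fd z : sdim (f z) = npath n (0, 0)%N z := (fP z).1.
exists (fun x y => f (x, y)); split; last by move=> x y; rewrite fd.
apply/gdecP; exists n.+1; split.
  move=> x y nxy; rewrite fd; apply/eqP; rewrite -[_ == _]negbK; apply: contra nxy => /npath_bound /=.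
  by lia.
have -> : [seq gtens (gtriv F (f (z.1, z.2))) (V z.1 (bt n.+1 z.2)) | z <- grid n.+1] =
    [seq A (f z) z | z <- grid n.+1] by apply: eq_map => -[].
have Ag z : is_gmod (A (f z) z).
  by apply: gtens_gmod => //; [exact: gtriv_gmod | case: (hV z.1 (bt n.+1 z.2))].
have us : uniq (grid n.+1) by apply: allpairs_uniq; rewrite ?iota_uniq // => -[? ?] [? ?].
have hh z : z \in grid n.+1 -> ghom (Th z) by move=> _; case: (ThP z).
have hi z a b (u : 'cV_(sdim (A (f z) z))) : z \in grid n.+1 -> ghw a b u -> Th z *m u != 0.
  by move=> _; case: (ThP z) => _; apply.
have hd z z' a b (u : 'cV_(sdim (A (f z) z))) (u' : 'cV_(sdim (A (f z') z'))) :
    z \in grid n.+1 -> z' \in grid n.+1 -> ghw a b u -> ghw a b u' -> z = z'.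
  move=> _ _ hu hu'.
  have [w [r tw]] := typicalV n z.1 z.2; have [w' [r' tw']] := typicalV n z'.1 z'.2.
  have [e1 e2 _] := gtriv_tens_hw ax tw hu; have [e1' e2' _] := gtriv_tens_hw ax tw' hu'.
  rewrite (surjective_pairing z) (surjective_pairing z'); congr (_, _).
    by apply/eqP; rewrite -(eqr_nat C) -e1 -e1'.
  by apply/eqP; rewrite -(eqr_nat C); apply/eqP/(@addrI _ (al *+ n.+1)); rewrite -e2 -e2'.
have [Phi [hPhi Phw]] := ghom_bigsum (A := fun z => A (f z) z) us hh hi hd.
have Pi := ghom_inj ax (gbigsum_gmod ax (grid n.+1) Ag) hPhi (fun a b u hu => (Phw a b u hu).1).
(* Both dimensions are 4^(n+1): the x + 1 for the end points (x, y) of the paths sum to 4^n. *)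
have [|Psi [h1 h2]] := inj_square_inv _ Pi.
  rewrite sdim_gbigsum (gtpow_dim tV) /grid big_allpairs.
  have := @sum_npath n (0, 0)%N n.+1 (ltnSn _) (ltnSn _); rewrite muln1 => e.
  rewrite expnS -e big_distrr; apply: eq_bigr => x _; rewrite big_distrr; apply: eq_bigr => y _ /=.
  have [w [r [[g1 g2 g3 g4] [g5 g6]]]] := typicalV n x y.
  by rewrite fd (typical_dim ax g1 g2 g3 g4 g5 g6); lia.
by exists Psi, Phi; split=> //; apply: ghom_inv hPhi.
Qed.

(** Distinct (x, y) give distinct weights, so only the summand of index (x, y) contributes; outside
    the grid T(x, y) is 0. *)
Lemma gdec_gmult n T x y : gdec V al n.+1 T ->
  gmult cst (gtpow (V 0%N al) n.+1) x%:R (bt n.+1 y) (sdim (T x y)).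
Proof.
move=> /gdecP[N [T0 [Phi [Psi [PQ QP hPhi]]]]].
have [_ hE _ hh] := ghom_inv PQ QP hPhi.
apply: (gmult_iso QP PQ hE hh).
have -> : sdim (T x y) = (\sum_(z <- grid N)
    (if `[< x%:R = z.1%:R :> C /\ bt n.+1 y = bt n.+1 z.2 >] then sdim (T z.1 z.2) else 0))%N.
  have E z : `[< x%:R = z.1%:R :> C /\ bt n.+1 y = bt n.+1 z.2 >] = (z == (x, y)).
    case: z => x' y'; rewrite xpair_eqE.
    apply/asboolP/andP => /= [[/eqP e1 /addrI/eqP e2]|[/eqP-> /eqP->] //].
    by move: e1 e2; rewrite !eqr_nat => /eqP-> /eqP->.
  under eq_bigr => z _ do rewrite E.
  rewrite -big_mkcond /=; have [xyN|nxy] := boolP ((x, y) \in grid N).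
    rewrite (big_rem _ xyN) /= eqxx big1_seq ?addn0 // => z /andP[/eqP-> zr].
    have us : uniq (grid N) by apply: allpairs_uniq; rewrite ?iota_uniq // => -[? ?] [? ?].
    by rewrite rem_filter // mem_filter /= eqxx in zr.
  rewrite big1_seq ?T0 //; last by move=> z /andP[/eqP-> ?]; case/negP: nxy.
  by apply: contra nxy => /andP[xN yN]; apply: allpairs_f; rewrite mem_iota.
apply: gmult_bigsum => -[x' y'] /=.
by have [w [r tw]] := typicalV n x' y'; exact: (gmult_triv ax _ _ _ tw).
Qed.

Lemma decomposition_dim n T x y : gdec V al n.+1 T -> sdim (T x y) = npath n (0, 0)%N (x, y).
Proof.
move=> hT; have [T' [hT' <-]] := decomposition_exists n.
exact: gmult_uniq (gdec_gmult x y hT) (gdec_gmult x y hT').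
Qed.

End Decomposition.

(** * The tensor power 0, and translation of simplicity and parity *)

Section Zero.
Variables (C : numFieldType) (F : fieldType) (cst qp : C -> F).
Hypothesis ax : qexp cst qp.
Local Notation P M := (gpar_mx F M true).

(** For b = 0, E_2 F_2 v = [0] v = 0, so a nonzero F_2 v would be a highest weight vector of weight
    (1, 0), contrary to [simple_hw_weight]. The line of v is therefore a submodule. *)
Lemma one_dim_simple (V : gmod F) b v : b = 0 -> is_gmod cst qp V -> gsimple V ->
  ghw cst (M := V) 0%:R b v ->
  sdim V = 1%N /\ exists p : bool, [/\ P V = ((-1) ^+ p)%:M, forall i, gE V i = 0, forall i, gF V i = 0
    & forall i, gh V i = 0].
Proof.
move=> b0 hV sV hv; have [w [p [hw Pw]]] := ghw_homogeneous hV hv.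
have [w0 [h1 h2] Ew] := hw.
have F1w : gF V i1 *m w = 0 := F1k_eq0 ax hV h1 (Ew _) erefl (ltnSn 0).
have F2w : gF V i2 *m w = 0.
  apply/eqP/negP => /negP n2.
  have hF : ghw cst (M := V) (0%:R + 1) b (gF V i2 *m w).
    split=> [//||i]; first exact: (gwtF2 ax hV (conj h1 h2)).
    case: (ord2P i) => ->; first by rewrite (gE1F2 hV) Ew mulmx0.
    by rewrite (gE2F2 ax hV h2) Ew mulmx0 oppr0 add0r b0 (qint0 ax) scale0r.
  have [/eqP] := simple_hw_weight ax hV sV hw hF.
  by rewrite eq_sym addrC -subr_eq0 addrK oner_eq0.
have hw0 i : gh V i *m w = 0.
  by case: (ord2P i) => ->; rewrite ?h1 ?h2 ?b0 (gcst0 ax) scale0r.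
have [|D wD] := sV 1%N w w0.
  split=> [|i].
    by exists ((-1) ^+ p)%:M; rewrite Pw mul_mx_scalar.
  split; exists 0; rewrite mulmx0 ?Ew ?hw0 //.
  by case: (ord2P i) => ->.
have z (A : 'M_(sdim V)) : A *m w = 0 -> A = 0.
  by move=> Aw; rewrite -[A]mulmx1 -wD mulmxA Aw mul0mx.
have d1 : sdim V = 1%N.
  apply/eqP; rewrite eqn_leq (mulmx1_size wD) lt0n; apply: contraNneq w0 => d0.
  by apply/eqP/colP => -[k lk]; exfalso; rewrite d0 in lk.
split=> //; exists p; split=> [|i|i|i].
- apply/eqP; rewrite -subr_eq0; apply/eqP/z.
  by rewrite mulmxBl Pw mul_scalar_mx subrr.
- exact/z/Ew.
- by apply: z; case: (ord2P i) => ->.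
- exact/z/hw0.
Qed.

(** Here V(0, 0) is one-dimensional, possibly odd. Giving T(0, 0) the same parity makes the tensor
    product even, like the unit module. *)
Lemma decomposition0 (V : nat -> C -> gmod F) (al : C) :
  (forall (a : nat) b, [/\ is_gmod cst qp (V a b), gsimple (V a b)
     & exists v, ghw cst (M := V a b) a%:R b v]) ->
  exists T, gdec V al 0 T.
Proof.
move=> hV; have [hm hs [v hv]] := hV 0%N (al *+ 0 + 0%:R).
have [d1 [p [hP hE hF hh]]] := one_dim_simple (addr0 0) hm hs hv.
pose T (x y : nat) := @SuperSpace ((x == 0%N) && (y == 0%N)) (fun=> p).
exists T, 1%N; split.
  by move=> x y; rewrite !ltnS !leqn0 /= => /negPf->.
rewrite /=; set W := gsum _ _.
have dW : sdim W = 1%N by rewrite /= d1.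
have W0 i : [/\ gE W i = 0, gF W i = 0 & gh W i = 0].
  by rewrite /W [gE _ _]/= [gF _ _]/= [gh _ _]/= hE hF hh !mul0mx !tens0mx !tensmx0 !addr0 !block_mx0.
have PW : P W = 1%:M.
  rewrite /W gpar_sum gpar_tens hP.
  have -> : P (gtriv F (T 0 0)%N) = ((-1) ^+ p)%:M.
    by rewrite -diag_const_mx; congr diag_mx; apply/rowP => k; rewrite !mxE.
  rewrite -![((-1) ^+ p)%:M]scalemx1 tensZl tensZr tens11 scalerA -expr2 sqrr_sign scale1r.
  by rewrite [P _]flatmx0 -[RHS]block_diag1 [X in _ = block_mx _ _ _ X]flatmx0.
pose Phi : 'M[F]_(sdim W, 1) := const_mx 1.
have [|Psi [PQ QP]] := inj_square_inv dW (A := Phi).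
  move=> u e; apply/colP => k; rewrite ord1.
  have k0 : 'I_(sdim W) by rewrite dW; exact: ord0.
  by move/colP/(_ k0): e; rewrite !mxE big_ord1 mxE mul1r.
exists Phi, Psi; split=> //; split=> [|i|i|i].
- rewrite PW mul1mx.
  suff -> : P (gtpow (V 0%N al) 0) = 1%:M by rewrite mulmx1.
  by rewrite -diag_const_mx; congr diag_mx; apply/rowP => k; rewrite !mxE.
- by have [-> _ _] := W0 i; rewrite mulmx0 mul0mx.
- by have [_ -> _] := W0 i; rewrite mulmx0 mul0mx.
- by have [_ _ ->] := W0 i; rewrite mulmx0 mul0mx.
Qed.

Lemma gsimple_vspace (M : gmod F) :
  (forall U : {vspace 'cV[F]_(sdim M)},
    (forall v, v \in U -> P M *m v \in U /\
       forall i, [/\ gE M i *m v \in U, gF M i *m v \in U & gh M i *m v \in U]) ->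
    U = 0%VS \/ U = fullv) -> gsimple M.
Proof.
move=> sM m B B0 [[YP hP] hi].
pose f := linfun (mulmx B : 'cV_m -> 'cV_(sdim M)).
have fE u : f u = B *m u by rewrite lfunE.
have inU v : reflect (exists u, v = B *m u) (v \in limg f).
  apply: (iffP memv_imgP) => [[u _ ->]|[u ->]]; first by exists u; rewrite fE.
  by exists u; rewrite ?memvf ?fE.
have st (A : 'M_(sdim M)) Y v : A *m B = B *m Y -> v \in limg f -> A *m v \in limg f.
  by move=> e /inU[u ->]; apply/inU; exists (Y *m u); rewrite !mulmxA e.
have [] := sM (limg f).
- move=> v vU; split; first exact: (st _ _ _ hP vU).
  by move=> i; have [[Y1 e1] [Y2 e2] [Y3 e3]] := hi i; split;
    [exact: (st _ _ _ e1) | exact: (st _ _ _ e2) | exact: (st _ _ _ e3)].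
- move=> U0; case/eqP: B0; apply/matrixP => i j.
  have : B *m (delta_mx j 0 : 'cV_m) \in limg f by apply/inU; eexists.
  by rewrite U0 memv0 -colE => /eqP/colP/(_ i); rewrite !mxE.
move=> Uf; have : forall k : 'I_(sdim M), exists c, 1%:M *m (delta_mx k 0 : 'cV_(sdim M)) = B *m c.
  by move=> k; apply/inU; rewrite Uf memvf.
by case/cols_in_span => Y ->; exists Y.
Qed.

(** Both sides scale each entry of A by a sign, and a nonzero entry forces the signs to agree; -1
    and 1 differ in F because its characteristic is 0. *)
Lemma homogeneousP (S S' : superspace) (p : bool) (A : 'M[F]_(sdim S', sdim S)) :
  (forall i j, A i j != 0 -> spar i = spar j (+) p) <->
  gpar_mx F S' true *m A = (-1) ^+ p *: (A *m gpar_mx F S true).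
Proof.
have n1 : (-1 == 1 :> F) = false.
  apply/negbTE; rewrite eq_sym -subr_eq0 opprK -[1 + 1]/(2%:R) (gnatr_eq0 ax) //.
have e i j : (gpar_mx F S' true *m A) i j = (-1) ^+ spar i * A i j by rewrite mul_diag_mx !mxE.
have e' i j : ((-1) ^+ p *: (A *m gpar_mx F S true)) i j = (-1) ^+ (spar j (+) p) * A i j.
  by rewrite mxE mul_mx_diag !mxE signr_addb /= [A i j * _]mulrC mulrA [_ ^+ p * _]mulrC.
split=> [h|h i j Aij].
  apply/matrixP => i j; rewrite e e'; have [->|/h->//] := eqVneq (A i j) 0.
  by rewrite !mulr0.
move/matrixP/(_ i j): h; rewrite e e' => /(mulIf Aij).
case: (spar i); case: (_ (+) _) => //= /eqP; rewrite expr0 expr1 ?n1 //.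
by rewrite eq_sym n1.
Qed.

End Zero.

(** * The field of Laurent series *)

Section Laurent.
Variable R : realType.
Local Notation LK := (laurent R).

Lemma fps_constD (K : fieldType) (a b : K) : fps_const (a + b) = fps_const a + fps_const b.
Proof. by apply: fpsP => -[|n] //=; rewrite addr0. Qed.

Definition fexp (K : fieldType) (z : K) : fps K := Fps (fun m => (z / 2%:R) ^+ m / (m`!)%:R).

Lemma fexpD (K : numFieldType) (a b : K) : fexp (a + b) = fexp a * fexp b.
Proof.
apply: fpsP => n /=; rewrite mulrDl exprDn mulr_suml [RHS](reindex_inj rev_ord_inj) /=.
apply: eq_bigr => i _; have le_in : (i <= n)%N by rewrite -ltnS.
rewrite subSS subKn // -mulr_natl -(bin_fact le_in) !natrM.
have f0 k : (k`!)%:R != 0 :> K by rewrite pnatr_eq0 -lt0n fact_gt0.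
have b0 : ('C(n, i))%:R != 0 :> K by rewrite pnatr_eq0 -lt0n bin_gt0.
by field; rewrite !f0 b0.
Qed.

Lemma fexp0 (K : numFieldType) : fexp (0 : K) = 1.
Proof.
apply: fpsP => n /=; rewrite mul0r expr0n; case: n => [|n] /=; last by rewrite mul0r.
by rewrite fact0 divr1.
Qed.

(** The coefficient of hbar is a / 2. *)
Lemma fexp_eq1 (K : numFieldType) (a : K) : fexp a = 1 -> a = 0.
Proof.
move/(congr1 (fun f => fcoef f 1)) => /=; rewrite expr1 divr1 => /eqP.
by rewrite mulf_eq0 invr_eq0 pnatr_eq0 orbF => /eqP.
Qed.

Lemma laurent_qexp : qexp (C := R[i]) (F := laurent R) (@cst R) (@qpow R).
Proof.
split.
- by move=> a b; rewrite /cst fps_constD tofracD.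
- exact: tofrac1.
- move=> a b /eqP; rewrite tofrac_eq => /eqP/(congr1 (fun f => fcoef f 0)) /= //.
- move=> a b; rewrite /qpow -tofracM; congr (FracField.tofrac _); exact: fexpD.
- rewrite /qpow -tofrac1; congr (FracField.tofrac _); exact: fexp0.
- move=> a; rewrite /qpow -tofrac1 => /eqP; rewrite tofrac_eq => /eqP; exact: fexp_eq1.
Qed.

Definition to_gmod (V : uqdata R) : gmod LK :=
  @GMod LK (uspace V) (@uE R V) (@uF R V) (@uh R V) (@uK R V).

Lemma to_gmod_pow V n : to_gmod (utpow V n) = gtpow (to_gmod V) n.
Proof. by elim: n => [|n IHn] //=; rewrite -IHn. Qed.

Lemma to_gmod_bigsum s : to_gmod (ubigsum s) = gbigsum (map to_gmod s).
Proof. by elim: s => [|V s IHs] //=; rewrite -IHs. Qed.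

Lemma to_gmod_hw (V : uqdata R) a b (v : 'cV_(sdim V)) :
  is_hwvector (V := V) a b v -> ghw (@cst R) (M := to_gmod V) a b v.
Proof. by case=> v0 h1 h2 Ev; split. Qed.

Lemma to_gmod_gmod (V : uqdata R) : is_uqmodule V -> is_gmod (@cst R) (@qpow R) (to_gmod V).
Proof.
case: V => U E F h K [H1 H2 H3 [H4 H5] [H6 H7]].
have hp := homogeneousP laurent_qexp.
split=> /=.
- by move=> i; have [e _ _ _] := H1 i; exact: (hp U U _ _).1 e.
- by move=> i; have [_ e _ _] := H1 i; exact: (hp U U _ _).1 e.
- by move=> i; have [_ _ e _] := H1 i; have := (hp U U _ _).1 e; rewrite expr0 scale1r.
- by move=> i; case: (H1 i).
- by move=> i j; have [/subr0_eq e _ _] := H2 i j.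
- by move=> i j; have [_ <- _] := H2 i j; rewrite addrC subrK.
- by move=> i j; have [_ _ e] := H2 i j; rewrite -scaleNr -e addrC subrK.
- by move=> i j; rewrite -H3 addrC subrK.
- exact: H4.
- exact: H5.
- exact: H6.
- exact: H7.
Qed.

Lemma to_gmod_simple (V : uqdata R) : is_simple V -> gsimple (to_gmod V).
Proof. by case=> _ sV; apply: gsimple_vspace => U sU; apply: sV. Qed.

Lemma ghom_of_even (V W : uqdata R) (A : 'M[LK]_(sdim W, sdim V)) :
  ghom (V := to_gmod V) (M := to_gmod W) A <->
  homogeneous (S := V) (S' := W) false A /\
    forall i, [/\ A *m uE V i = uE W i *m A, A *m uF V i = uF W i *m A & A *m uh V i = uh W i *m A].
Proof.
have hp := homogeneousP laurent_qexp.
split=> [[hP hE hF hh]|[h0 h]].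
  split; last by move=> i; split; [exact: hE | exact: hF | exact: hh].
  by refine ((hp V W false A).2 _); rewrite expr0 scale1r; symmetry; exact: hP.
have hP := (hp V W false A).1 h0; rewrite expr0 scale1r in hP.
split; first by symmetry; exact: hP.
- by move=> i; case: (h i).
- by move=> i; case: (h i).
- by move=> i; case: (h i).
Qed.

Lemma to_gmod_dec (V : nat -> R[i] -> uqdata R) al n T :
  is_decomposition V al n T <-> gdec (fun a b => to_gmod (V a b)) al n T.
Proof.
have E N : gbigsum [seq gtens (gtriv LK (T x y)) (to_gmod (V x (al *+ n + y%:R)))
      | x <- iota 0 N, y <- iota 0 N] =
    to_gmod (ubigsum [seq utens (triv R (T x y)) (V x (al *+ n + y%:R)) | x <- iota 0 N, y <- iota 0 N]).
  by rewrite to_gmod_bigsum map_allpairs.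
split=> -[N [h0]].
  move=> [P [Q [PQ QP hP h]]]; exists N; split=> //; rewrite E -to_gmod_pow.
  by exists P, Q; split=> //; apply/ghom_of_even.
rewrite E -to_gmod_pow => -[P [Q [PQ QP /ghom_of_even[hP h]]]].
by exists N; split=> //; exists P, Q.
Qed.

Lemma irrational_weight (al : R[i]) : (forall r : rat, al <> ratr r) ->
  forall k m : nat, al *+ k.+1 + m%:R != 0.
Proof.
move=> hal k m; apply/eqP => e; apply: (hal (- m%:R / k.+1%:R)).
have k0 : (k.+1)%:R != 0 :> R[i] by rewrite pnatr_eq0.
rewrite fmorph_div rmorphN !rmorph_nat; apply: (mulIf k0).
by rewrite divfK // mulr_natr; apply/eqP; rewrite -addr_eq0 e.
Qed.

End Laurent.

Unset Implicit Arguments.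
Set Strict Implicit.

Theorem theorem2 (R : realType) (V : nat -> R[i] -> uqdata R)
    (hV : forall (a1 : nat) (a2 : R[i]), is_simple_hw a1 a2 (V a1 a2))
    (alpha : R[i]) (halpha : forall r : rat, alpha <> ratr r) :
  (forall n : nat, exists T : nat -> nat -> superspace,
     is_decomposition V alpha n T) /\
  (forall (n : nat) (T : nat -> nat -> superspace),
     is_decomposition V alpha n.+1 T ->
     forall x y : nat, sdim (T x y) = #|paths n x y|).
Proof.
have ax := laurent_qexp R; have irr := irrational_weight halpha.
have hG a b : [/\ is_gmod (@cst R) (@qpow R) (to_gmod (V a b)), gsimple (to_gmod (V a b))
    & exists v, ghw (@cst R) (M := to_gmod (V a b)) a%:R b v].
  have [h1 h2 [v hv _]] := hV a b.
  split; [exact: to_gmod_gmod | exact: to_gmod_simple | exists v; exact: to_gmod_hw].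
split=> [[|n]|n T /to_gmod_dec hT x y].
- by have [T hT] := decomposition0 ax alpha hG; exists T; apply/to_gmod_dec.
- by have [T [hT _]] := decomposition_exists ax hG irr n; exists T; apply/to_gmod_dec.
- by rewrite card_paths; apply: (decomposition_dim ax hG irr).
Qed.
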